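(* Let $N\ge 1$, $m\in\{2,3,\dots\}$ and $\theta\in(0,2)$. Define $$K(x,t):=G_\theta\left(x,t^{\frac{\theta}{2m}}\right),\quad x\in\mathbf{R}^N,\ t>0.$$ Then $K(x,t)>0$ in $\mathbf{R}^N\times(0,\infty)$ and the following properties hold. (a) For any $j=0,1,2,\dots$, there exist $d_j>0$ and $d_j'>0$ such that $$|\partial_x^\alpha G_m(x,t)|\le d_j\,t^{-\frac{j}{2m}}K(x,t)\le d_j'\,t^{-\frac{N}{2m}-\frac{j}{2m}}$$ for all $x\in\mathbf{R}^N$, $t>0$ and all multi-indices $\alpha$ with $|\alpha|=j$. (b) There exists $d''>0$ such that $$\|S_K(t)\mu\|_\infty\le d''t^{-\frac{N}{2m}}\sup_{x\in\mathbf{R}^N}\mu(B(x,t^{\frac{1}{2m}})),\quad t>0,$$ for every nonnegative Radon measure $\mu$ in $\mathbf{R}^N$. (c) There exists $d_*>0$ such that $$\int_{\mathbf{R}^N}K(x-y,t-s)K(y,s)\,dy\le d_*K(x,t)$$ for all $x\in\mathbf{R}^N$ and $t>s>0$.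
   Context: $G_m$ ($m=2,3,\dots$) is the fundamental solution of $\partial_t u+(-\Delta)^m u=0$ in $\mathbf{R}^N\times(0,\infty)$, and $G_\theta$ ($0<\theta<2$) is the fundamental solution of $\partial_t u+(-\Delta)^{\theta/2}u=0$ in $\mathbf{R}^N\times(0,\infty)$: $$G_m(x,t)=(2\pi)^{-N}\int_{\mathbf{R}^N}e^{ix\cdot\xi}e^{-t|\xi|^{2m}}\,d\xi,\qquad G_\theta(x,t)=(2\pi)^{-N}\int_{\mathbf{R}^N}e^{ix\cdot\xi}e^{-t|\xi|^{\theta}}\,d\xi.$$ For a nonnegative Radon measure $\mu$, $[S_K(t)\mu](x):=\int_{\mathbf{R}^N}K(x-y,t)\,d\mu(y)$. $\|\cdot\|_\infty$ is the norm of $L^\infty(\mathbf{R}^N)$, $B(x,R):=\{y\in\mathbf{R}^N:|x-y|<R\}$, and for $\alpha=(\alpha_1,\dots,\alpha_N)\in(\mathbf{N}\cup\{0\})^N$, $|\alpha|=\sum_i\alpha_i$ and $\partial_x^\alpha=\partial^{|\alpha|}/\partial x_1^{\alpha_1}\cdots\partial x_N^{\alpha_N}$. *)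

(* Defs.v *)
From HB Require Import structures.
From mathcomp Require Import all_boot all_order all_algebra.
From mathcomp Require Import complex lra.
From mathcomp Require Import all_classical all_reals all_analysis.
From mathcomp Require Import measurable_realfun ess_sup_inf.

Set Implicit Arguments.
Unset Strict Implicit.
Unset Printing Implicit Defensive.

Import Order.TTheory GRing.Theory Num.Theory.
Import numFieldNormedType.Exports.

Local Open Scope classical_set_scope.
Local Open Scope ring_scope.

Section borel_rV.
Context {R : realType} (n : nat).

(* The Borel sigma-algebra; by measurable_fun_rVP below it is also the one
   generated by the coordinates. *)
HB.instance Definition _ := @isMeasurable.Build default_measure_display
  'rV[R]_n <<s (open : set (set 'rV[R]_n)) >>
  (@sigma_algebra0 _ _ _) (@sigma_algebraC _ _) (@sigma_algebra_bigcup _ _ _).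

End borel_rV.

Section borel_rV_theory.
Context {R : realType}.

Lemma open_measurable_rV n (U : set 'rV[R]_n) : open U -> measurable U.
Proof. by move=> oU; exact: sub_sigma_algebra. Qed.

Lemma continuous_measurable_fun_rV n (f : 'rV[R]_n -> R) :
  continuous f -> measurable_fun [set: 'rV[R]_n] f.
Proof.
move=> /continuousP cf; apply: (measurability _ (RGenOpens.measurableE R)).
move=> _ [_ [a [b ->] <-]]; rewrite setTI; apply: open_measurable_rV.
exact/cf/interval_open.
Qed.

Lemma measurable_coord_rV n (i : 'I_n) :
  measurable_fun [set: 'rV[R]_n] (fun v : 'rV[R]_n => v ord0 i).
Proof.
by apply: continuous_measurable_fun_rV => v; exact: coord_continuous.
Qed.

Lemma open_rVE n (U : set 'rV[R]_n) : open U ->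
  U = \bigcup_(qk in [set qk : 'rV[rat]_n * nat |
        ball (map_mx ratr qk.1 : 'rV[R]_n) qk.2.+1%:R^-1 `<=` U])
      [set v | forall i, ball (ratr (qk.1 ord0 i) : R) qk.2.+1%:R^-1 (v ord0 i)].
Proof.
move=> oU; apply/seteqP; split=> [v Uv|v [[q k] /= qkU vqk]]; last first.
  apply: qkU; split => [|i j]; first by rewrite invr_gt0.
  by rewrite ord1 mxE; exact: vqk.
have /nbhs_ballP[e /= e0 veU] : nbhs v U by exact: open_nbhs_nbhs.
have [k ke] : exists k : nat, k.+1%:R^-1 + k.+1%:R^-1 < e.
  have e20 : 0 < e / 2 by rewrite divr_gt0.
  exists (Num.truncn (e / 2)^-1).
  rewrite [ltRHS]splitr.
  have : (Num.truncn (e / 2)^-1).+1%:R^-1 < e / 2.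
    rewrite invf_plt ?posrE//.
    by rewrite truncnS_gt.
  by move=> h; exact: ltrD.
have k0 : 0 < k.+1%:R^-1 :> R by rewrite invr_gt0.
have /choice[q qP] (i : 'I_n) : exists q : rat, ball (v ord0 i) k.+1%:R^-1 (ratr q : R).
  have /rat_in_itvoo[q] : v ord0 i - k.+1%:R^-1 < v ord0 i + k.+1%:R^-1.
    by rewrite ltrD2l gtrN.
  rewrite in_itv/= => /andP[q1 q2]; exists q.
  by rewrite /ball/= ltr_distlC q1 q2.
exists (\row_i q i, k) => [w [_ /= qw]|i]; last first.
  by rewrite /= mxE; apply: ball_sym; exact: qP.
apply: veU; split=> // i j; rewrite ord1; apply: le_ball (ltW ke) _ _.
apply: ball_triangle; first exact: qP.
by have := qw ord0 j; rewrite !mxE.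
Qed.

Lemma measurable_fun_rVP d (T : measurableType d) n (f : T -> 'rV[R]_n) :
  measurable_fun [set: T] f <->
  forall i, measurable_fun [set: T] (fun t => f t ord0 i).
Proof.
split=> [mf i|mf].
  exact: (measurableT_comp (measurable_coord_rV i)).
apply: (measurability (open : set (set 'rV[R]_n))) => //.
move=> _ [U oU <-]; rewrite setTI (open_rVE oU) preimage_bigcup bigcup_mkcond.
apply: countable_bigcupT_measurable => // -[q k].
case: ifPn => // _.
rewrite (_ : _ @^-1` _ = \bigcap_(i in [set: 'I_n])
    ((fun t => f t ord0 i) @^-1` ball (ratr (q ord0 i) : R) k.+1%:R^-1)).
  apply: fin_bigcap_measurable => // i _; rewrite -[X in measurable X]setTI.
  by apply: mf => //; exact: measurable_ball.
by apply/seteqP; split=> t /= h i => [_|]; exact: h.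
Qed.

(* The factor is measurableTypeR R rather than R because this is the carrier
   of lebesgue_measure; both have the same measurable sets. *)
Definition cons_rV n (p : measurableTypeR R * 'rV[R]_n) : 'rV[R]_n.+1 :=
  \row_i oapp (p.2 ord0) p.1 (unlift ord0 i).

Lemma measurable_cons_rV n : measurable_fun setT (@cons_rV n).
Proof.
apply/measurable_fun_rVP => i.
under eq_fun do rewrite mxE.
case: unliftP => [j _|_] /=; last exact: measurable_fst.
exact: (measurableT_comp (measurable_coord_rV j)).
Qed.

Definition uncons_rV n (v : 'rV[R]_n.+1) : measurableTypeR R * 'rV[R]_n :=
  (v ord0 ord0, \row_j v ord0 (lift ord0 j)).

Lemma measurable_uncons_rV n : measurable_fun setT (@uncons_rV n).
Proof.
apply: measurable_fun_pair; first exact: measurable_coord_rV.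
apply/measurable_fun_rVP => i; under eq_fun do rewrite mxE.
exact: measurable_coord_rV.
Qed.

Lemma cons_rVK n : cancel (@cons_rV n) (@uncons_rV n).
Proof.
move=> [x v]; congr pair; first by rewrite mxE unlift_none.
by apply/rowP => j; rewrite !mxE liftK.
Qed.

Lemma uncons_rVK n : cancel (@uncons_rV n) (@cons_rV n).
Proof.
by move=> v; apply/rowP => i; rewrite mxE; case: unliftP => [j|] -> //=; rewrite mxE.
Qed.

End borel_rV_theory.

Section lebesgue_rV_succ.
Context {R : realType} (n : nat).
Variable mu : {sigma_finite_measure set 'rV[R]_n -> \bar R}.

Definition lebesgue_rV_succ : set 'rV[R]_n.+1 -> \bar R :=
  pushforward (@lebesgue_measure R \x mu)%E (@cons_rV R n).

Let lebesgue_rV_succ0 : lebesgue_rV_succ set0 = 0%E.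
Proof. by rewrite /lebesgue_rV_succ /pushforward preimage_set0 measure0. Qed.

Let lebesgue_rV_succ_ge0 A : (0 <= lebesgue_rV_succ A)%E.
Proof. by rewrite /lebesgue_rV_succ /pushforward measure_ge0. Qed.

Let preimage_cons_rV A : measurable A -> measurable (@cons_rV R n @^-1` A).
Proof.
by move=> mA; rewrite -[X in measurable X]setTI; exact: measurable_cons_rV.
Qed.

Let lebesgue_rV_succ_sigma_additive : semi_sigma_additive lebesgue_rV_succ.
Proof.
move=> F mF tF mUF; rewrite /lebesgue_rV_succ /pushforward preimage_bigcup.
apply: measure_semi_sigma_additive.
- by move=> k; exact: preimage_cons_rV.
- apply/trivIsetP => /= i j _ _ ij; rewrite -preimage_setI.
  by move/trivIsetP : tF => /(_ _ _ _ _ ij) ->//; rewrite preimage_set0.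
- by rewrite -preimage_bigcup; exact: preimage_cons_rV.
Qed.

HB.instance Definition _ := isMeasure.Build _ _ _ lebesgue_rV_succ
  lebesgue_rV_succ0 lebesgue_rV_succ_ge0 lebesgue_rV_succ_sigma_additive.

Let lebesgue_rV_succ_sigma_finite : sigma_finite setT lebesgue_rV_succ.
Proof.
have /sigma_finiteP[F [TF ndF Foo]] := sigma_finiteT (@lebesgue_measure R).
have /sigma_finiteP[G [TG ndG Goo]] := sigma_finiteT mu.
exists (fun k => @uncons_rV R n @^-1` (F k `*` G k)).
  rewrite -preimage_bigcup predeqE => v; split=> // _.
  have [i _ Fi] : (\bigcup_i F i) (uncons_rV v).1 by rewrite -TF.
  have [j _ Gj] : (\bigcup_i G i) (uncons_rV v).2 by rewrite -TG.
  exists (maxn i j) => //; split.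
  - exact: (subsetPset _ _ (ndF _ _ (leq_maxl i j))).
  - exact: (subsetPset _ _ (ndG _ _ (leq_maxr i j))).
move=> k; have [mF Fk] := Foo k; have [mG Gk] := Goo k; split.
  rewrite -[X in measurable X]setTI; apply: measurable_uncons_rV => //.
  exact: measurableX.
rewrite /lebesgue_rV_succ /pushforward (_ : _ @^-1` _ = F k `*` G k).
  by rewrite product_measure1E// lte_mul_pinfty// ge0_fin_numE.
by apply/seteqP; split=> p; rewrite /preimage /mkset cons_rVK.
Qed.

HB.instance Definition _ := Measure_isSigmaFinite.Build _ _ _ lebesgue_rV_succ
  lebesgue_rV_succ_sigma_finite.

End lebesgue_rV_succ.

(* n-dimensional Lebesgue measure, as an iterated product; lebesgue_rV_box
   below gives its value on boxes. *)
Fixpoint lebesgue_rV (R : realType) (n : nat) :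
    {sigma_finite_measure set 'rV[R]_n -> \bar R} :=
  match n with
  | 0 => \d_(0 : 'rV[R]_0)
  | k.+1 => lebesgue_rV_succ (lebesgue_rV R k)
  end.

Section lebesgue_rV_theory.
Context {R : realType}.

Lemma lebesgue_rVS n (A : set 'rV[R]_n.+1) :
  lebesgue_rV R n.+1 A =
  (@lebesgue_measure R \x lebesgue_rV R n)%E (@cons_rV R n @^-1` A).
Proof. by []. Qed.

Lemma measurable_box_rV n (A : 'I_n -> set R) :
  (forall i, measurable (A i)) ->
  measurable [set v : 'rV[R]_n | forall i, A i (v ord0 i)].
Proof.
move=> mA; rewrite (_ : mkset _ = \bigcap_(i in [set: 'I_n])
    ((fun v : 'rV[R]_n => v ord0 i) @^-1` A i)).
  apply: fin_bigcap_measurable => // i _; rewrite -[X in measurable X]setTI.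
  exact: measurable_coord_rV.
by apply/seteqP; split=> v /= h i => [_|]; exact: h.
Qed.

Lemma lebesgue_rV_box n (A : 'I_n -> set R) : (forall i, measurable (A i)) ->
  lebesgue_rV R n [set v | forall i, A i (v ord0 i)] =
  (\prod_(i < n) @lebesgue_measure R (A i))%E.
Proof.
elim: n A => [|n IH] A mA.
  by rewrite big_ord0 /= diracE mem_set//= => -[].
rewrite lebesgue_rVS big_ord_recl.
rewrite (_ : _ @^-1` _ = A ord0 `*`
    [set v : 'rV[R]_n | forall j, A (lift ord0 j) (v ord0 j)]).
  have mB : measurable [set v : 'rV[R]_n | forall j, A (lift ord0 j) (v ord0 j)].
    by apply: (@measurable_box_rV n (fun j => A (lift ord0 j))) => j; exact: mA.
  rewrite product_measure1E//; last exact: mA.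
  by rewrite (IH (fun j => A (lift ord0 j)))// => j; exact: mA.
apply/seteqP; split=> -[x v] /=.
  move=> h; split=> [|j]; first by have := h ord0; rewrite mxE unlift_none.
  by have := h (lift ord0 j); rewrite mxE liftK.
by move=> [Ax Av] i; rewrite mxE; case: unliftP => [j|] ->//=.
Qed.

Let leb1 : {sigma_finite_measure set (measurableTypeR R) -> \bar R} :=
  @lebesgue_measure R.

Let measurable_opp1 :
  measurable_fun [set: measurableTypeR R] (-%R : measurableTypeR R -> measurableTypeR R).
Proof. exact: (@oppr_measurable R). Qed.

Let lebesgue_measureN (A : set R) : measurable A ->
  @lebesgue_measure R (-%R @^-1` A) = @lebesgue_measure R A.
Proof.
move=> mA; apply/esym.
apply: (@lebesgue_measure_unique R
  (measure_function_pushforward__canonical__measure_function_Measure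
     leb1 measurable_opp1)) => //.
move=> _ [[a b] _ <-] /=; rewrite /pushforward /=.
rewrite (_ : _ @^-1` _ = `[- b, - a[%classic).
  by rewrite !lebesgue_measure_itv/= !lte_fin ltrN2 opprK addrC.
by apply/seteqP; split => x /=; rewrite !in_itv/= => /andP[h1 h2]; lra.
Qed.

Lemma measurable_oppr_rV n : measurable_fun setT (-%R : 'rV[R]_n -> 'rV[R]_n).
Proof.
apply/measurable_fun_rVP => i; under eq_fun do rewrite mxE.
by apply: measurableT_comp => //; exact: measurable_coord_rV.
Qed.

Lemma lebesgue_rVN n (A : set 'rV[R]_n) : measurable A ->
  lebesgue_rV R n (-%R @^-1` A) = lebesgue_rV R n A.
Proof.
elim: n A => [|n IH] A mA.
  congr (_ _); apply/seteqP; split=> v /=; rewrite (thinmx0 v) oppr0//.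
pose negp (p : measurableTypeR R * 'rV[R]_n) : measurableTypeR R * 'rV[R]_n :=
  (- (p.1 : R), - p.2).
have mneg : measurable_fun setT negp.
  apply: measurable_fun_pair.
    exact: (measurableT_comp measurable_opp1 measurable_fst).
  exact: (measurableT_comp (@measurable_oppr_rV n) measurable_snd).
have mcA : measurable (@cons_rV R n @^-1` A).
  by rewrite -[X in measurable X]setTI; exact: measurable_cons_rV.
rewrite !lebesgue_rVS.
rewrite (_ : _ @^-1` (_ @^-1` _) = negp @^-1` (@cons_rV R n @^-1` A)); last first.
  apply/seteqP; split=> p /=;
    rewrite (_ : - cons_rV p = cons_rV (negp p))//;
    by apply/rowP => i; rewrite !mxE; case: unliftP => [j|] _ //=; rewrite mxE.
pose m' := measure_function_pushforward__canonical__measure_function_Measure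
  (leb1 \x lebesgue_rV R n)%E mneg.
suff /(_ _ mcA) : forall X, measurable X -> (leb1 \x lebesgue_rV R n)%E X = m' X.
  by move=> ->.
apply: product_measure_unique => B C mB mC.
rewrite /= /pushforward.
rewrite (_ : _ @^-1` _ = (-%R @^-1` B) `*` (-%R @^-1` C))//.
rewrite product_measure1E.
- by congr (_ * _)%E; [exact: lebesgue_measureN|exact: IH].
- by rewrite -[X in measurable X]setTI; exact: measurable_opp1.
- by rewrite -[X in measurable X]setTI; exact: measurable_oppr_rV.
Qed.

Lemma ge0_integral_rVN n (f : 'rV[R]_n -> \bar R) :
  measurable_fun setT f -> (forall v, 0 <= f v)%E ->
  (\int[lebesgue_rV R n]_v f (- v)%R = \int[lebesgue_rV R n]_v f v)%E.
Proof.
move=> mf f0.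
have := @ge0_integral_pushforward _ _ _ _ _ _ (@measurable_oppr_rV n)
  (lebesgue_rV R n) setT f measurableT mf (fun v _ => f0 v).
rewrite preimage_setT => <-.
apply: eq_measure_integral => [|mN A mA _]; first exact: measurable_oppr_rV.
exact: lebesgue_rVN.
Qed.

Lemma Rintegral_rV_odd n (f : 'rV[R]_n -> R) :
  measurable_fun setT f -> (forall v, f (- v) = - f v) ->
  \int[lebesgue_rV R n]_v f v = 0.
Proof.
move=> mf fN; rewrite /Rintegral integralE.
rewrite (_ : (\int[lebesgue_rV R n]_v (fun v => (f v)%:E)^\- v =
              \int[lebesgue_rV R n]_v (fun v => (f v)%:E)^\+ v)%E); last first.
  rewrite -[RHS]ge0_integral_rVN//.
  - by apply: eq_integral => v _; rewrite funenegE funeposE fN EFinN.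
  - by apply: measurable_funepos; exact/measurable_EFinP.
by case: (\int[_]_v _)%E => [r| |]//=; rewrite subrr.
Qed.

End lebesgue_rV_theory.

Section euclidean.
Context {R : realType} {n : nat}.
Implicit Types (x y : 'rV[R]_n) (r : R).

Definition dotp x y : R := \sum_(i < n) x ord0 i * y ord0 i.

Definition enorm x : R := Num.sqrt (dotp x x).

(* `ball` and the norm of 'rV[R]_n come from the sup norm, so the Euclidean
   ball needs its own definition. *)
Definition eball x r : set 'rV[R]_n := [set y | enorm (x - y) < r].

(* mu is a Borel measure that is finite on compact sets and inner regular. *)
Definition radon (mu : set 'rV[R]_n -> \bar R) : Prop :=
  (forall C, compact C -> mu C < +oo)%E /\
  (forall A, measurable A ->
    mu A = ereal_sup [set mu C | C in [set C | compact C /\ C `<=` A]]).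

Definition partial (i : 'I_n) (f : 'rV[R]_n -> R) : 'rV[R]_n -> R :=
  'D_(delta_mx ord0 i) f.

(* 'D_v is a total operator, so mpartial alpha f x is meaningful only where
   the successive derivatives exist. *)
Definition mpartial (alpha : {ffun 'I_n -> nat}) (f : 'rV[R]_n -> R) :
    'rV[R]_n -> R :=
  foldr (fun i => iter (alpha i) (partial i)) f (enum 'I_n).

End euclidean.

Section fundamental_solution.
Context {R : realType} {n : nat}.
Implicit Types (x xi : 'rV[R]_n) (t : R) (p : R -> R).

(* e^{iy} *)
Definition expi (y : R) : R[i] := (cos y +i* sin y)%C.

Definition cintegral (f : 'rV[R]_n -> R[i]) : R[i] :=
  ((\int[lebesgue_rV R n]_v complex.Re (f v)) +i*
   (\int[lebesgue_rV R n]_v complex.Im (f v)))%C.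

(* (2 pi)^{-n} \int e^{i x.xi} e^{- t p(|xi|)} dxi, the fundamental solution
   attached to the Fourier multiplier p(|xi|). *)
Definition cfundsol p x t : R[i] :=
  ((2 * pi) ^- n)%:C%C *
  cintegral (fun xi => expi (dotp x xi) * (expR (- (t * p (enorm xi))))%:C%C).

(* The integral is real, see cfundsol_real. *)
Definition fundsol p x t : R := complex.Re (cfundsol p x t).

Lemma measurable_dotp x : measurable_fun setT (dotp x).
Proof.
apply: measurable_sum => i; apply: measurable_funM => //.
exact: measurable_coord_rV.
Qed.

Lemma measurable_enorm : measurable_fun setT (@enorm R n).
Proof.
rewrite (_ : @enorm R n = Num.sqrt \o (fun x => dotp x x))//.
apply: measurableT_comp.
  apply: continuous_measurable_fun; exact: sqrt_continuous.
by apply: measurable_sum => i; apply: measurable_funM; exact: measurable_coord_rV.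
Qed.

Lemma enormN x : enorm (- x) = enorm x.
Proof.
by congr Num.sqrt; apply: eq_bigr => i _; rewrite mxE mulrNN.
Qed.

Lemma dotpN x xi : dotp x (- xi) = - dotp x xi.
Proof. by rewrite -sumrN; apply: eq_bigr => i _; rewrite mxE mulrN. Qed.

Lemma cfundsol_real p x t : measurable_fun setT p ->
  cfundsol p x t = (fundsol p x t)%:C%C.
Proof.
move=> mp; rewrite /fundsol /cfundsol /cintegral.
rewrite (_ : \int[_]_v complex.Im _ = 0) => [|]; first last.
  rewrite (@eq_Rintegral _ _ _ _ _
    (fun v => sin (dotp x v) * expR (- (t * p (enorm v))))) => [|v _]; last first.
    by rewrite /= mulr0 add0r.
  apply: Rintegral_rV_odd => [|v].
    apply: measurable_funM.
      apply: measurableT_comp; last exact: measurable_dotp.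
      by apply: continuous_measurable_fun => y; exact: continuous_sin.
    apply: measurableT_comp => //; apply: measurableT_comp => //.
    apply: measurable_funM => //.
    by apply: measurableT_comp => //; exact: measurable_enorm.
  by rewrite dotpN enormN sinN mulNr.
by apply/eqP; rewrite eq_complex /= ?(mulr0, mul0r, addr0, subr0) !eqxx.
Qed.

End fundamental_solution.

Section kernels.
Context {R : realType} {n : nat}.
Implicit Types (x y : 'rV[R]_n) (s t theta : R) (m : nat).

(* The multiplier of (-Delta)^m. *)
Definition poly_kernel m x t : R := fundsol (fun r => r ^+ (2 * m)) x t.

(* The multiplier of (-Delta)^(theta / 2). *)
Definition frac_kernel theta x t : R := fundsol (fun r => r `^ theta) x t.

(* [S_k(t) mu](x) as an element of [0, +oo], for a positive kernel k. *)
Definition potential (k : 'rV[R]_n -> R -> R) t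
    (mu : {measure set 'rV[R]_n -> \bar R}) x : \bar R :=
  (\int[mu]_y (k (x - y)%R t)%:E)%E.

End kernels.

(* Main.v *)
(** With rho = t^(1/2m), K(., t) is the isotropic th-stable density at scale rho,
    and everything follows from its comparability with
      decay th rho z = rho^th (rho + |z|)^-(N + th).

    For this comparison, exp(- l^b) with b = th/2 < 1 is approximated by finite
    positive combinations F of exponentials exp(- s l): complete monotonicity
    makes q |-> exp(- (1/n + n (1 - q))^b) absolutely monotone on [0, 1], and one
    substitutes q = exp(- l/n) in its Taylor expansion.  The Fourier transform of
    F(|xi|^2) is then a positive combination of Gaussians, and any pointwise bound
    of the Gaussian of variance parameter a^2 at distance r by a combination of
    functions exp(- k (a/r)^2) becomes, after passing to the limit, a bound of the
    stable density by the same combination of numbers exp(- k^b (rho/r)^th).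
    The upper bound comes from 1 - exp(- z), the lower one from
    exp(- z) (1 - exp(- z)) (1 - e - exp(- z)), which is negative near z = 0, where
    the Gaussian is flat, while its limit has a first-order term proportional to
    2 * 2^b - 1 - 3^b > 0 up to e.

    The derivatives of G_m and the Gaussians (m = 1) are both treated as
    oscillatory integrals of a polynomial times exp(- |a xi|^(2m)).  Translation
    invariance of Lebesgue measure gives the integration by parts, which trades
    powers of x for powers of a, and for m = 1 a linear equation along rays. *)
Require Import Defs.
From HB Require Import structures.
From mathcomp Require Import all_boot all_order all_algebra.
From mathcomp Require Import ring lra.
From mathcomp Require Import all_classical all_reals all_analysis.
From mathcomp Require Import measurable_realfun ess_sup_inf.

Set Implicit Arguments.
Unset Strict Implicit.
Unset Printing Implicit Defensive.

Import Order.TTheory GRing.Theory Num.Theory.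
Import numFieldNormedType.Exports.

Local Open Scope classical_set_scope.
Local Open Scope ring_scope.

(** * Lebesgue measure on row vectors *)

(** The Fourier formula of the stable density oscillates, so neither its sign nor its power tail is
    visible there. Gaussians have a closed form, and bounding them by combinations of exp(- k
    (a/r)^2) makes the weights of the mixture disappear: for a Gaussian of scale a = rho sqrt(s)
    this exponential is exp(- s k (rho/r)^2), so the weighted sum is again F, evaluated at k
    (rho/r)^2, where its limit is known. The three coefficients of the lower combination add up to
    zero, which cancels the constant term and leaves a multiple of (rho/r)^th as rho/r tends to 0.
    This only covers points at distance at least a fixed multiple of rho; closer points follow
    because mixtures of Gaussians decrease with |x|. The scale of K(., t) is t^(1/2m) and not
    t^(1/th), so K does not compose as a semigroup in t. The convolution bound survives because
    t^(1/2m) is increasing and subadditive, and this is all that the product inequality between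
    decay profiles asks of the scales. *)

Section translation_invariance.
Context {R : realType}.

Let leb1 : {sigma_finite_measure set (measurableTypeR R) -> \bar R} :=
  @lebesgue_measure R.

Let measurable_add1 (c : R) : measurable_fun [set: measurableTypeR R]
  (fun x : R => x + c : measurableTypeR R).
Proof.
suff : measurable_fun [set: R] (fun x : R => x + c) by [].
by apply: measurable_funD => //; exact: measurable_id.
Qed.

Lemma lebesgue_measureD (c : R) (A : set R) : measurable A ->
  @lebesgue_measure R ((fun x => x + c) @^-1` A) = @lebesgue_measure R A.
Proof.
move=> mA; apply/esym.
apply: (@lebesgue_measure_unique R
  (measure_function_pushforward__canonical__measure_function_Measure
     leb1 (measurable_add1 c))) => //.
move=> _ [[a b] _ <-] /=; rewrite /pushforward /=.
rewrite (_ : _ @^-1` _ = `]a - c, b - c]%classic).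
  rewrite !lebesgue_measure_itv/= !lte_fin ltrD2r -!EFinB.
  by rewrite opprB addrA subrK.
by apply/seteqP; split => x /=; rewrite !in_itv/= => /andP[h1 h2]; lra.
Qed.

Lemma measurable_addr_rV n (w : 'rV[R]_n) :
  measurable_fun setT (fun v : 'rV[R]_n => v + w).
Proof.
apply/measurable_fun_rVP => i; under eq_fun do rewrite mxE.
by apply: measurable_funD => //; exact: measurable_coord_rV.
Qed.

(** Induction on the dimension: a product measure is determined by its values on rectangles, and on
    those a translation acts factor by factor. *)
Lemma lebesgue_rVD n (w : 'rV[R]_n) (A : set 'rV[R]_n) : measurable A ->
  lebesgue_rV R n ((fun v => v + w) @^-1` A) = lebesgue_rV R n A.
Proof.
elim: n w A => [|n IH] w A mA.
  by congr (_ _); apply/seteqP; split=> v /=; rewrite (thinmx0 w) addr0.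
pose w' : 'rV[R]_n := \row_j w ord0 (lift ord0 j).
pose tr (p : measurableTypeR R * 'rV[R]_n) : measurableTypeR R * 'rV[R]_n :=
  ((p.1 : R) + w ord0 ord0, p.2 + w').
have mtr : measurable_fun setT tr.
  apply: measurable_fun_pair.
    exact: (measurableT_comp (measurable_add1 _) measurable_fst).
  exact: (measurableT_comp (measurable_addr_rV w') measurable_snd).
have mcA : measurable (@cons_rV R n @^-1` A).
  by rewrite -[X in measurable X]setTI; exact: measurable_cons_rV.
rewrite !lebesgue_rVS.
rewrite (_ : _ @^-1` (_ @^-1` _) = tr @^-1` (@cons_rV R n @^-1` A)); last first.
  by apply/seteqP; split=> p /=;
    rewrite (_ : cons_rV p + w = cons_rV (tr p))//;
    apply/rowP => i; rewrite !mxE; case: unliftP => [j|] -> //=; rewrite !mxE.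
pose m' := measure_function_pushforward__canonical__measure_function_Measure
  (leb1 \x lebesgue_rV R n)%E mtr.
suff /(_ _ mcA) : forall X, measurable X -> (leb1 \x lebesgue_rV R n)%E X = m' X.
  by move=> ->.
apply: product_measure_unique => B C mB mC.
rewrite /= /pushforward.
rewrite (_ : _ @^-1` _ = ((fun x : R => x + w ord0 ord0) @^-1` B) `*`
                         ((fun v => v + w') @^-1` C))//.
rewrite product_measure1E.
- by congr (_ * _)%E; [exact: lebesgue_measureD|exact: IH].
- by rewrite -[X in measurable X]setTI; exact: measurable_add1.
- by rewrite -[X in measurable X]setTI; exact: measurable_addr_rV.
Qed.

Lemma ge0_integral_rVD n (w : 'rV[R]_n) (f : 'rV[R]_n -> \bar R) :
  measurable_fun setT f -> (forall v, 0 <= f v)%E ->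
  (\int[lebesgue_rV R n]_v f (v + w)%R = \int[lebesgue_rV R n]_v f v)%E.
Proof.
move=> mf f0.
have := @ge0_integral_pushforward _ _ _ _ _ _ (measurable_addr_rV w)
  (lebesgue_rV R n) setT f measurableT mf (fun v _ => f0 v).
rewrite preimage_setT => <-.
apply: eq_measure_integral => [|mD A mA _]; first exact: measurable_addr_rV.
exact: lebesgue_rVD.
Qed.

(** Positive and negative parts have equal, possibly infinite, integrals on both sides, so the
    equality persists where [fine] takes its default value. *)
Lemma Rintegral_rVD n (w : 'rV[R]_n) (f : 'rV[R]_n -> R) :
  measurable_fun setT f ->
  \int[lebesgue_rV R n]_v f (v + w) = \int[lebesgue_rV R n]_v f v.
Proof.
move=> mf; rewrite /Rintegral integralE [in RHS]integralE.
have mg : measurable_fun setT (EFin \o f) by exact/measurable_EFinP.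
congr (fine (_ - _)%E).
- rewrite -[RHS](ge0_integral_rVD w)//; last exact: measurable_funepos.
  by apply: eq_integral => v _; rewrite !funeposE.
- rewrite -[RHS](ge0_integral_rVD w)//; last exact: measurable_funeneg.
  by apply: eq_integral => v _; rewrite !funenegE.
Qed.

Lemma ge0_integral_rVB n (w : 'rV[R]_n) (f : 'rV[R]_n -> \bar R) :
  measurable_fun setT f -> (forall v, 0 <= f v)%E ->
  (\int[lebesgue_rV R n]_v f (w - v)%R = \int[lebesgue_rV R n]_v f v)%E.
Proof.
move=> mf f0; rewrite -[RHS](ge0_integral_rVD w)// -[RHS]ge0_integral_rVN//.
- by apply: eq_integral => v _; rewrite addrC.
- by apply: (measurableT_comp mf); exact: measurable_addr_rV.
Qed.

Lemma ge0_integral_cons_rV n (f : 'rV[R]_n.+1 -> \bar R) :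
  measurable_fun setT f -> (forall v, 0 <= f v)%E ->
  (\int[lebesgue_rV R n.+1]_v f v =
   \int[lebesgue_measure]_(x in [set: measurableTypeR R])
      \int[lebesgue_rV R n]_v f (cons_rV (x, v)))%E.
Proof.
move=> mf f0.
rewrite -(@fubini_tonelli1 _ _ _ _ _ leb1 (lebesgue_rV R n) (f \o @cons_rV R n))//=.
- have := @ge0_integral_pushforward _ _ _ _ _ _ (@measurable_cons_rV R n)
    (leb1 \x lebesgue_rV R n)%E setT f measurableT mf (fun v _ => f0 v).
  rewrite preimage_setT => <-.
  by apply: eq_measure_integral => //; exact: measurable_cons_rV.
by apply: (measurableT_comp mf); exact: measurable_cons_rV.
Qed.

Lemma ge0_integral_prod_rV n (f : 'I_n -> R -> R) :
  (forall i, measurable_fun setT (f i)) -> (forall i x, 0 <= f i x) ->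
  (\int[lebesgue_rV R n]_v (\prod_(i < n) f i (v ord0 i))%:E =
   \prod_(i < n) \int[lebesgue_measure]_x (f i x)%:E)%E.
Proof.
elim: n f => [|n IH] f mf f0.
  rewrite big_ord0 /=; under eq_integral do rewrite big_ord0.
  by rewrite integral_dirac//= diracT mul1e.
rewrite big_ord_recl ge0_integral_cons_rV; first last.
- by move=> v; rewrite lee_fin prodr_ge0.
- apply/measurable_EFinP; apply: measurable_prod => i _.
  exact: (measurableT_comp (mf i) (measurable_coord_rV i)).
have mg : measurable_fun setT (fun v : 'rV[R]_n =>
    \prod_(j < n) f (lift ord0 j) (v ord0 j)).
  apply: measurable_prod => i _.
  exact: (measurableT_comp (mf _) (measurable_coord_rV i)).
rewrite -(IH (fun j => f (lift ord0 j)))//.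
set c := (\int[lebesgue_rV R n]_v _)%E.
have c0 : (0 <= c)%E by apply: integral_ge0 => v _; rewrite lee_fin prodr_ge0.
rewrite -ge0_integralZr//; last 2 first.
- have /measurable_EFinP : measurable_fun [set: R] (f ord0) by [].
  by [].
- by move=> x _; rewrite lee_fin.
apply: eq_integral => x _; rewrite /c -ge0_integralZl//; last 3 first.
- exact/measurable_EFinP.
- by move=> v _; rewrite lee_fin prodr_ge0.
- by rewrite lee_fin.
apply: eq_integral => v _; rewrite big_ord_recl EFinM mxE unlift_none/=.
by congr (_ * _%:E)%E; apply: eq_bigr => j _; rewrite mxE liftK.
Qed.

End translation_invariance.

(** * The Euclidean norm and power decay *)

Section euclidean_norm.
Context {R : realType} {n : nat}.
Implicit Types x y z : 'rV[R]_n.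

Lemma dotp_ge0 x : 0 <= dotp x x.
Proof. by apply: sumr_ge0 => i _; rewrite -expr2 sqr_ge0. Qed.

Lemma enorm_ge0 x : 0 <= enorm x.
Proof. exact: sqrtr_ge0. Qed.

Lemma sqr_enorm x : enorm x ^+ 2 = dotp x x.
Proof. by rewrite sqr_sqrtr// dotp_ge0. Qed.

Lemma dotpC x y : dotp x y = dotp y x.
Proof. by apply: eq_bigr => i _; rewrite mulrC. Qed.

Lemma dotpDl x y z : dotp (x + y) z = dotp x z + dotp y z.
Proof. by rewrite -big_split; apply: eq_bigr => i _; rewrite mxE mulrDl. Qed.

Lemma dotpDr x y z : dotp x (y + z) = dotp x y + dotp x z.
Proof. by rewrite dotpC dotpDl !(dotpC x). Qed.

Lemma dotpZl a x y : dotp (a *: x) y = a * dotp x y.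
Proof. by rewrite mulr_sumr; apply: eq_bigr => i _; rewrite mxE mulrA. Qed.

Lemma dotpZr a x y : dotp x (a *: y) = a * dotp x y.
Proof. by rewrite dotpC dotpZl dotpC. Qed.

Lemma dotp0l y : dotp (0 : 'rV[R]_n) y = 0.
Proof. by rewrite -(scale0r y) dotpZl mul0r. Qed.

Lemma dotp_delta i x : dotp x (delta_mx ord0 i) = x ord0 i.
Proof.
rewrite /dotp (bigD1 i)//= mxE !eqxx mulr1 big1 ?addr0// => j ji.
by rewrite mxE (negbTE ji) andbF mulr0.
Qed.

Lemma enormZ a x : enorm (a *: x) = `|a| * enorm x.
Proof.
by rewrite /enorm dotpZl dotpZr mulrA -expr2 sqrtrM ?sqr_ge0// sqrtr_sqr.
Qed.

Lemma enorm_delta i : enorm (delta_mx ord0 i : 'rV[R]_n) = 1.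
Proof. by rewrite /enorm dotp_delta mxE !eqxx sqrtr1. Qed.

Lemma coord_le_enorm i x : `|x ord0 i| <= enorm x.
Proof.
rewrite -sqrtr_sqr ler_sqrt ?dotp_ge0// /dotp (bigD1 i)//= -expr2 lerDl.
by apply: sumr_ge0 => j _; rewrite -expr2 sqr_ge0.
Qed.

(** Cauchy-Schwarz, from the nonnegativity of the squared norm of |x|^2 y - (x.y) x. *)
Lemma dotp_le_enorm x y : `|dotp x y| <= enorm x * enorm y.
Proof.
have [->|] := eqVneq x 0; first by rewrite dotp0l normr0 mulr_ge0 ?enorm_ge0.
move=> x0; have ex0 : 0 < dotp x x.
  rewrite lt_neqAle dotp_ge0 andbT eq_sym; apply: contra x0.
  rewrite psumr_eq0 => [/allP h|i _]; last by rewrite -expr2 sqr_ge0.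
  apply/eqP/rowP => i; rewrite mxE; apply/eqP.
  by have := h i (mem_index_enum _); rewrite /= mulf_eq0 orbb.
rewrite -ler_sqr ?nnegrE ?mulr_ge0 ?enorm_ge0// real_normK ?num_real// exprMn !sqr_enorm.
have := dotp_ge0 (dotp x x *: y + - dotp x y *: x).
rewrite !(dotpDl, dotpDr, dotpZl, dotpZr) (dotpC y x).
set L := (X in 0 <= X -> _).
have -> : L = dotp x x * (dotp x x * dotp y y - dotp x y ^+ 2) by rewrite /L; ring.
by rewrite pmulr_rge0// subr_ge0.
Qed.

Lemma enormD x y : enorm (x + y) <= enorm x + enorm y.
Proof.
rewrite -ler_sqr ?nnegrE ?addr_ge0 ?enorm_ge0//.
rewrite sqrrD !sqr_enorm dotpDl !dotpDr (dotpC y x).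
have := le_trans (ler_norm _) (dotp_le_enorm x y); lra.
Qed.

Lemma enorm_le_sum x : enorm x <= \sum_(i < n) `|x ord0 i|.
Proof.
rewrite -ler_sqr ?nnegrE ?enorm_ge0 ?sumr_ge0// sqr_enorm expr2 mulr_suml.
apply: ler_sum => i _; rewrite -expr2 -real_normK ?num_real// expr2 ler_wpM2l//.
by rewrite (bigD1 i)//= lerDl sumr_ge0.
Qed.

End euclidean_norm.

Section decay.
Context {R : realType}.

(* The profile of the stable densities: comparable to
   rho^-n (1 + |z| / rho)^-(n + th). *)
Definition decay n (th rho : R) (z : 'rV[R]_n) : R :=
  rho `^ th * (rho + enorm z) `^ (- (n%:R + th)).

Lemma measurable_powR_comp n (a : R) (f : 'rV[R]_n -> R) :
  measurable_fun setT f -> measurable_fun setT (fun x => f x `^ a).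
Proof.
by move=> mf; apply: (measurableT_comp (measurable_powR _) mf).
Qed.

Lemma measurable_decay n th rho : measurable_fun setT (@decay n th rho).
Proof.
apply: measurable_funM => //; apply: measurable_powR_comp.
by apply: measurable_funD => //; exact: measurable_enorm.
Qed.

Lemma decay_ge0 n th rho z : 0 <= @decay n th rho z.
Proof. by rewrite mulr_ge0// powR_ge0. Qed.

Lemma decay_gt0 n th rho z : 0 < rho -> 0 < @decay n th rho z.
Proof.
by move=> r0; rewrite mulr_gt0// powR_gt0// ltr_wpDr// enorm_ge0.
Qed.

Lemma le_powRN (a b x : R) : 0 <= x -> 0 < a -> a <= b -> b `^ (- x) <= a `^ (- x).
Proof.
move=> x0 a0 ab; rewrite !powRN lef_pV2 ?posrE ?powR_gt0 ?(lt_le_trans a0 ab)//.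
by rewrite ge0_ler_powR// ?nnegrE ltW// (lt_le_trans a0 ab).
Qed.

Lemma integral_powRN (rho e : R) : 0 < rho -> 0 < e ->
  (\int[lebesgue_measure]_x ((rho + `|x|) `^ (- (1 + e)))%:E
   = (2 * (rho `^ (- e) / e))%:E)%E.
Proof.
move=> rho0 e0.
have cf : continuous (fun x : R => (rho + `|x|) `^ (- (1 + e))).
  move=> x.
  have c1 : (fun x : R => rho + `|x|) @ x --> rho + `|x|.
    by apply: cvgD; [exact: cvg_cst|exact: norm_continuous].
  have r0 : 0 < rho + `|x| by rewrite ltr_wpDr.
  have h : {for x, continuous ((fun y : R => y `^ (- (1 + e))) \o (fun x : R => rho + `|x|))}.
    apply: continuous_comp; first exact: c1.
    apply/differentiable_continuous/derivable1_diffP.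
    by have [] := is_derive1_powR (- (1 + e)) r0.
  exact: h.
rewrite ge0_symfun_integralT//; last 2 first.
- by move=> x; exact: powR_ge0.
- by move=> x /=; rewrite normrN.
rewrite -set_itvcy.
pose F (x : R) := - ((rho + x) `^ (- e) / e).
have dF (x : R) : 0 <= x -> is_derive x 1 F ((rho + `|x|) `^ (- (1 + e))).
  move=> x0; have r0 : 0 < rho + x by rewrite ltr_wpDr.
  have dsh : is_derive x 1 (fun x : R => rho + x) 1.
    have := is_deriveD (is_derive_cst rho x 1) (is_derive_id x 1).
    by rewrite add0r.
  have := is_derive1_comp (is_derive1_powR (- e) r0) dsh.
  move=> /(is_deriveZ (- e^-1)) h; apply: is_derive_eq.
    rewrite (_ : F = (- e^-1 \*: ((fun y => y `^ (- e)) \o (fun x : R => rho + x)))).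
      exact: h.
    by apply/funext => y; rewrite /F /= /GRing.scale/= mulNr mulrC.
  rewrite ger0_norm// /GRing.scale/= mulr1 mulrA mulrNN mulVf ?gt_eqF// mul1r.
  by congr (_ `^ _); lra.
rewrite (@ge0_continuous_FTC2y R (fun x => (rho + `|x|) `^ (- (1 + e))) F 0 0).
- by rewrite -EFinB sub0r /F addr0 opprK.
- by move=> x _; exact: powR_ge0.
- exact: continuous_subspaceT.
- rewrite /F -[X in _ --> X]oppr0 -[X in _ --> - X](mul0r e^-1).
  apply: cvgN; apply: cvgMl; apply/cvgr0Pnorm_lt => d d0.
  exists (d `^ (- e^-1)); split; first exact: num_real.
  move=> x dx; rewrite ger0_norm ?powR_ge0// powRN.
  rewrite invf_plt ?posrE ?powR_gt0 ?(ltr_wpDl (ltW rho0))//; last first.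
    by rewrite (lt_trans _ dx)// powR_gt0.
  rewrite (_ : d^-1 = (d `^ (- e^-1)) `^ e).
    apply: gt0_ltr_powR; rewrite ?nnegrE ?powR_ge0//.
      by rewrite addr_ge0 ?(ltW rho0)// (le_trans _ (ltW dx))// powR_ge0.
    by rewrite (lt_trans dx)// ltrDr.
  by rewrite -powRrM mulNr mulVf ?gt_eqF// powR_inv1// ltW.
- by move=> x /ltW /dF[].
- apply: cvg_at_right_filter; apply/differentiable_continuous/derivable1_diffP.
  by have [] := dF 0 (lexx _).
- move=> x; rewrite in_itv/= andbT => /ltW /dF h.
  by rewrite derive1E; exact: derive_val.
Qed.

(** Since |v| dominates each coordinate and n + th = n (1 + e) with e = th / n, the radial power is
    below a product of one-variable powers. Each factor integrates to 2 rho^(-e) / e, and rho^th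
    cancels the product of the powers of rho: the bound is independent of the scale. *)
Lemma integral_decay n (th : R) : (0 < n)%N -> 0 < th ->
  exists2 C : R, 0 < C & forall rho : R, 0 < rho ->
    (\int[lebesgue_rV R n]_v (decay th rho v)%:E <= C%:E)%E.
Proof.
move=> n0 th0; pose e := th / n%:R.
have e0 : 0 < e by rewrite divr_gt0// ltr0n.
have en : e * n%:R = th by rewrite /e divfK// pnatr_eq0 -lt0n.
exists ((2 / e) ^+ n); first by rewrite exprn_gt0// divr_gt0.
move=> rho rho0.
have le_prod (v : 'rV[R]_n) :
    decay th rho v <= rho `^ th * \prod_(i < n) (rho + `|v ord0 i|) `^ (- (1 + e)).
  rewrite ler_wpM2l ?powR_ge0//.
  have r0 : 0 < rho + enorm v by rewrite ltr_wpDr// enorm_ge0.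
  rewrite (_ : - (n%:R + th) = - (1 + e) * n%:R); last first.
    by rewrite mulNr mulrDl mul1r en.
  rewrite powRrM powR_mulrn ?powR_ge0// -[X in _ ^+ X](card_ord n) -prodr_const.
  apply: ler_prod => i _; rewrite powR_ge0/= le_powRN//.
  - by rewrite addr_ge0// ltW.
  - by rewrite ltr_wpDr.
  - by rewrite lerD2l coord_le_enorm.
have mp (f : 'rV[R]_n -> R) := @measurable_powR_comp n (- (1 + e)) f.
have mf : measurable_fun setT (fun x : R => (rho + `|x|) `^ (- (1 + e))).
  apply: (measurableT_comp (measurable_powR _)).
  by apply: measurable_funD => //; exact: measurableT_comp.
have mprod : measurable_fun setT (fun v : 'rV[R]_n =>
   \prod_(i < n) (rho + `|v ord0 i|) `^ (- (1 + e))).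
  apply: measurable_prod => i _.
  exact: (measurableT_comp mf (measurable_coord_rV i)).
apply: (@le_trans _ _ (\int[lebesgue_rV R n]_v
   (rho `^ th * \prod_(i < n) (rho + `|v ord0 i|) `^ (- (1 + e)))%:E)%E).
  apply: ge0_le_integral => //.
  - by move=> v _; rewrite lee_fin decay_ge0.
  - by apply/measurable_EFinP; exact: measurable_decay.
  - by apply/measurable_EFinP; exact: measurable_funM.
  - by move=> v _; rewrite lee_fin.
under eq_integral do rewrite EFinM.
rewrite ge0_integralZl//; last 3 first.
- exact/measurable_EFinP.
- by move=> v _; rewrite lee_fin prodr_ge0// => i _; exact: powR_ge0.
- by rewrite lee_fin powR_ge0.
rewrite (ge0_integral_prod_rV (f := fun _ x => (rho + `|x|) `^ (- (1 + e))))//;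
  last by move=> i x; exact: powR_ge0.
rewrite (eq_bigr (fun=> (2 * (rho `^ (- e) / e))%:E)); last first.
  by move=> i _; rewrite integral_powRN.
rewrite prodEFin prodr_const card_ord -EFinM lee_fin.
rewrite (_ : 2 * (rho `^ (- e) / e) = 2 / e * rho `^ (- e)); last by ring.
rewrite exprMn mulrCA -(powR_mulrn n (powR_ge0 rho (- e))) -powRrM mulNr en powRN.
by rewrite divff ?mulr1// gt_eqF// powR_gt0.
Qed.

End decay.

(** * Taylor bounds and polynomial functions *)

Section calculus.
Context {R : realType}.

Lemma mvt_from0 (f f1 : R -> R) (h : R) : (forall t : R, is_derive t 1 f (f1 t)) ->
  exists2 c, `|c| <= `|h| & f h - f 0 = f1 c * h.
Proof.
move=> df.
have cf : continuous f.
  move=> x; apply/differentiable_continuous/derivable1_diffP.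
  by have [] := df x.
have [h0|h0] := leP 0 h.
  have [c] := MVT_segment h0 (fun x _ => df x) (continuous_subspaceT cf).
  rewrite in_itv/= subr0 => /andP[c0 ch] e; exists c => //.
  by rewrite !ger0_norm.
have [c] := MVT_segment (ltW h0) (fun x _ => df x) (continuous_subspaceT cf).
rewrite in_itv/= sub0r => /andP[hc c0] e; exists c.
  by rewrite !ler0_norm ?lerN2// ltW.
by rewrite -opprB e mulrN opprK.
Qed.

(** The mean value theorem, applied twice, writes the error as f2 d * (c * h) with |c| <= |h|; the
    lost factor 1/2 is harmless. *)
Lemma taylor2_bound (f f1 f2 : R -> R) (h M : R) :
  (forall t : R, is_derive t 1 f (f1 t)) -> (forall t : R, is_derive t 1 f1 (f2 t)) ->
  (forall t, `|t| <= `|h| -> `|f2 t| <= M) ->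
  `|f h - f 0 - h * f1 0| <= M * h ^+ 2.
Proof.
move=> df df1 fM.
have [c ch ->] := mvt_from0 h df.
have [d dc] := mvt_from0 c df1.
move=> /eqP; rewrite subr_eq => /eqP ->.
rewrite (_ : (f2 d * c + f1 0) * h - h * f1 0 = f2 d * (c * h)); last by ring.
rewrite normrM ler_pM ?fM ?(le_trans dc)//.
by rewrite normrM -real_normK ?num_real// expr2 ler_wpM2r.
Qed.

(** Differentiation under the integral sign goes through this criterion: a pointwise second-order
    Taylor error is integrated and becomes an error C h^2 for the integral. *)
Lemma is_derive_quadratic (V : normedModType R) (f : V -> R) (x v : V) (d C e : R) :
  0 < e -> (forall h : R, `|h| <= e -> `|f (h *: v + x) - f x - h * d| <= C * h ^+ 2) ->
  is_derive x v f d.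
Proof.
move=> e0 fC.
have C0 : 0 <= C.
  have := le_trans (normr_ge0 _) (fC e _).
  by rewrite gtr0_norm// lexx => /(_ isT); rewrite pmulr_lge0// exprn_gt0.
have cv : h^-1 *: ((f \o shift x) (h *: v) - f x) @[h --> 0^'] --> d.
  apply/cvgrPdist_lt => eps eps0.
  pose del := Num.min e (eps / (C + 1)).
  have del0 : 0 < del by rewrite lt_min e0/= divr_gt0// ltr_wpDl.
  exists del => //= h; rewrite /= sub0r normrN => hdel h0.
  have hn0 : 0 < `|h| by rewrite normr_gt0.
  have he : `|h| <= e by rewrite (le_trans (ltW hdel))// ge_min lexx.
  rewrite -(ltr_pM2l hn0) -normrM mulrBr /GRing.scale/= mulrA divff// mul1r.
  rewrite distrC (le_lt_trans (fC h he))//.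
  rewrite -real_normK ?num_real// expr2 mulrCA ltr_pM2l//.
  rewrite (@le_lt_trans _ _ ((C + 1) * `|h|))//; first by rewrite ler_wpM2r// lerDl.
  rewrite mulrC -ltr_pdivlMr; last by rewrite ltr_wpDl.
  by rewrite (lt_le_trans hdel)// ge_min lexx orbT.
split; first by apply/cvg_ex; exists d.
exact: cvg_lim cv.
Qed.

(** The derivative of the cosine is written as a phase shift by pi / 2, so that derivatives of waves
    are again waves. *)
Lemma cos_taylor (A u : R) : `|cos (A + u) - cos A - u * cos (A + pi / 2)| <= u ^+ 2.
Proof.
have df (g g' : R -> R) (dg : forall t : R, is_derive t 1 g (g' t)) (t : R) :
    is_derive t 1 (fun t => g (A + t)) (g' (A + t)).
  have dsh : is_derive t 1 (fun x : R => A + x) 1.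
    by have := is_deriveD (is_derive_cst A t 1) (is_derive_id t 1); rewrite add0r.
  by have := is_derive1_comp (dg (A + t)) dsh; rewrite mulr1.
have dNsin (t : R) : is_derive t 1 (fun x : R => - sin x) (- cos t).
  exact: is_deriveN.
have := @taylor2_bound (fun u => cos (A + u)) (fun u => - sin (A + u))
  (fun u => - cos (A + u)) u 1 (df _ _ (@is_derive_cos R)) (df _ _ dNsin).
by rewrite cosDpihalf mul1r !addr0; apply => t _; rewrite normrN cos_max.
Qed.

Lemma exprn_le_expR (u : R) k : 0 <= u -> u ^+ k <= k`!%:R * expR u.
Proof.
move=> u0; case: k => [|k]; first by rewrite mul1r expr0 -expR0 ler_expR.
rewrite mulrC -ler_pdivrMr ?ltr0n ?fact_gt0//.
by apply: le_trans (expR_ge1Dxn k u0); rewrite lerDr.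
Qed.

End calculus.

Section polyfun.
Context {R : realType} {N : nat}.

(** Polynomials are kept as functions, without coefficients: what matters is closure under
    derivatives along lines, measurability and polynomial growth. *)
Inductive polyfun : ('rV[R]_N -> R) -> Prop :=
| polyfun_cst c : polyfun (cst c)
| polyfun_coord i : polyfun (fun v => v ord0 i)
| polyfun_add p q : polyfun p -> polyfun q -> polyfun (fun v => p v + q v)
| polyfun_mul p q : polyfun p -> polyfun q -> polyfun (fun v => p v * q v).

Lemma polyfun_sum (I : Type) (s : seq I) (p : I -> 'rV[R]_N -> R) :
  (forall i, polyfun (p i)) -> polyfun (fun v => \sum_(i <- s) p i v).
Proof.
move=> pp; elim: s => [|i s IH].
  rewrite (_ : (fun _ => _) = cst 0); first exact: polyfun_cst.
  by apply/funext => v; rewrite big_nil.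
rewrite (_ : (fun _ => _) = fun v => p i v + \sum_(i <- s) p i v).
  exact: polyfun_add.
by apply/funext => v; rewrite big_cons.
Qed.

Lemma polyfun_exp p k : polyfun p -> polyfun (fun v => p v ^+ k).
Proof.
move=> pp; elim: k => [|k IH]; first exact: (polyfun_cst 1).
rewrite (_ : (fun _ => _) = fun v => p v * p v ^+ k); first exact: polyfun_mul.
by apply/funext => v; rewrite exprS.
Qed.

Lemma polyfun_dotpl x : polyfun (dotp x).
Proof.
apply: polyfun_sum => i; apply: polyfun_mul; last exact: polyfun_coord.
exact: (polyfun_cst (x ord0 i)).
Qed.

Lemma polyfun_dotp : polyfun (fun v => dotp v v).
Proof. by apply: polyfun_sum => i; apply: polyfun_mul; exact: polyfun_coord. Qed.

Lemma measurable_polyfun p : polyfun p -> measurable_fun setT p.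
Proof.
elim=> [c|i|{}p q _ mp _ mq|{}p q _ mp _ mq].
- exact: measurable_cst.
- exact: measurable_coord_rV.
- exact: measurable_funD.
- exact: measurable_funM.
Qed.

Lemma polyfun_growth p : polyfun p ->
  exists (C : R) k, 0 <= C /\ forall v, `|p v| <= C * (1 + enorm v) ^+ k.
Proof.
have e1 (v : 'rV[R]_N) k : 1 <= (1 + enorm v) ^+ k.
  by rewrite exprn_ege1// lerDl enorm_ge0.
elim=> [c|i|{}p q _ [C [k [C0 pC]]] _ [D [l [D0 qD]]]|
         {}p q _ [C [k [C0 pC]]] _ [D [l [D0 qD]]]].
- by exists `|c|, 0%N; split=> // v; rewrite mulr1.
- exists 1, 1%N; split=> // v; rewrite mul1r (le_trans (coord_le_enorm _ _))//.
  by rewrite lerDr.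
- exists (C + D), (k + l)%N; split; first exact: addr_ge0.
  move=> v; rewrite (le_trans (ler_normD _ _))// mulrDl exprD.
  apply: lerD; [apply: (le_trans (pC v))|apply: (le_trans (qD v))].
  + by rewrite ler_wpM2l// ler_peMr// (le_trans ler01 (e1 v k)).
  + by rewrite ler_wpM2l// ler_peMl// (le_trans ler01 (e1 v l)).
- exists (C * D), (k + l)%N; split; first exact: mulr_ge0.
  by move=> v; rewrite normrM exprD mulrACA ler_pM.
Qed.

Definition line (w xi : 'rV[R]_N) (t : R) : 'rV[R]_N := xi + t *: w.

Lemma polyfun_derive w p : polyfun p -> exists2 q, polyfun q &
  forall (xi : 'rV[R]_N) (t : R), is_derive t 1 (fun t => p (line w xi t)) (q (line w xi t)).
Proof.
elim=> [c|j|{}p q pp [p' pp' dp] pq [q' pq' dq]|{}p q pp [p' pp' dp] pq [q' pq' dq]].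
- exists (cst 0); first exact: polyfun_cst.
  by move=> xi t; exact: is_derive_cst.
- exists (cst (w ord0 j)); first exact: polyfun_cst.
  move=> xi t; rewrite (_ : (fun _ => _) = cst (xi ord0 j) + w ord0 j \*: (@id R)).
    have := is_deriveD (is_derive_cst (xi ord0 j) t 1)
      (is_deriveZ (w ord0 j) (is_derive_id t 1)).
    by rewrite add0r /GRing.scale/= mulr1.
  by apply/funext => s; rewrite /line !mxE mulrC.
- exists (fun v => p' v + q' v); first exact: polyfun_add.
  by move=> xi t; exact: is_deriveD.
- exists (fun v => p v * q' v + q v * p' v).
    by apply: polyfun_add; apply: polyfun_mul.
  by move=> xi t; exact: is_deriveM.
Qed.

End polyfun.

(** * Oscillatory integrals *)

Section oscillatory.
Context {R : realType} {N : nat} (m : nat).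
Hypothesis N0 : (0 < N)%N.
Hypothesis m0 : (0 < m)%N.
Implicit Types (p q : 'rV[R]_N -> R) (x xi eta : 'rV[R]_N) (a phi : R).
Local Notation mu := (lebesgue_rV R N).

Definition gE (eta : 'rV[R]_N) : R := expR (- dotp eta eta ^+ m).

Lemma gE_ge0 eta : 0 <= gE eta.
Proof. exact: expR_ge0. Qed.

Lemma measurable_polyfunM_gE p : polyfun p ->
  measurable_fun setT (fun v => p v * gE v).
Proof.
move=> pp; apply: measurable_funM; first exact: measurable_polyfun.
apply: (measurableT_comp (@measurable_expR R)); apply: measurable_funN.
by apply: measurable_polyfun; apply: polyfun_exp; exact: polyfun_dotp.
Qed.

(** The derivative in direction w is stated along all lines, in the form that one-variable Taylor
    bounds consume. *)
Definition derivesE w p q := forall (xi : 'rV[R]_N) (t : R),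
  is_derive t 1 (fun t => p (line w xi t) * gE (line w xi t))
                (q (line w xi t) * gE (line w xi t)).

Lemma derivesEP w p d q :
  (forall (xi : 'rV[R]_N) (t : R), is_derive t 1
     (fun t => dotp (line w xi t) (line w xi t) ^+ m) (d (line w xi t))) ->
  (forall (xi : 'rV[R]_N) (t : R), is_derive t 1
     (fun t => p (line w xi t)) (q (line w xi t))) ->
  derivesE w p (fun v => q v - p v * d v).
Proof.
move=> dd dp xi t.
have h := @is_derive1_comp R expR
  (- (fun t : R => dotp (line w xi t) (line w xi t) ^+ m)) t _ _
  (is_derive_expR _) (is_deriveN (dd xi t)).
have h' := is_deriveM (dp xi t) h.
by apply: is_derive_eq; rewrite /GRing.scale/= /gE; ring.
Qed.

Lemma polyfun_derivesE w p : polyfun p -> exists2 q, polyfun q & derivesE w p q.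
Proof.
move=> pp; have [p' pp' dp] := polyfun_derive w pp.
have [d pd dd] := polyfun_derive w (polyfun_exp m (@polyfun_dotp R N)).
exists (fun v => p' v - p v * d v); last exact: derivesEP.
apply: polyfun_add => //.
rewrite (_ : (fun _ => _) = fun v => cst (-1) v * (p v * d v)).
  by apply: polyfun_mul; [exact: polyfun_cst|exact: polyfun_mul].
by apply/funext => v; rewrite /= mulN1r.
Qed.

Lemma decay1E rho xi : 0 < rho -> decay 1 rho xi = rho * (rho + enorm xi) ^- N.+1.
Proof.
move=> r0; have r1 : 0 <= rho + enorm xi by rewrite addr_ge0 ?enorm_ge0// ltW.
by rewrite /decay powRr1 ?(ltW r0)// -{1}(natrD _ N 1) addn1 powR_invn.
Qed.

(** Plays the role of the change of variables xi -> a xi: combined with the scale-free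
    [integral_decay], it yields the factor a^-N in integrals of functions of a xi. *)
Lemma decay1Z a xi : 0 < a -> decay 1 1 (a *: xi) = a ^- N * decay 1 a^-1 xi.
Proof.
move=> a0; rewrite !decay1E ?invr_gt0// mul1r enormZ gtr0_norm//.
rewrite (_ : 1 + a * enorm xi = a * (a^-1 + enorm xi)); last first.
  by rewrite mulrDr divff// gt_eqF.
by rewrite exprMn invfM exprS invfM mulrA [a^-1 * _]mulrC.
Qed.

(** With r = |eta|, exp(- r^(2m)) <= exp(1 - r), and the exponential absorbs (1 + r)^(k + N + 1).
    The target [decay 1 1] is (1 + r)^-(N + 1), a common integrable majorant for the oscillatory
    integrals. *)
Lemma gE_decay p : polyfun p -> exists2 C : R, 0 <= C &
  forall eta, `|p eta * gE eta| <= C * decay 1 1 eta.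
Proof.
move=> /polyfun_growth[C [k [C0 pC]]].
exists (C * (expR 2 * (k + N.+1)`!%:R)).
  by rewrite !mulr_ge0// expR_ge0.
move=> eta; rewrite normrM (ger0_norm (gE_ge0 _)) decay1E// mul1r.
have r0 := enorm_ge0 eta; set r := enorm eta in r0 *.
have r1 : 0 < 1 + r by rewrite ltr_wpDr.
apply: (@le_trans _ _ (C * (1 + r) ^+ k * expR (1 - r))).
  apply: ler_pM; rewrite ?gE_ge0//.
  rewrite /gE -sqr_enorm -/r -exprM ler_expR lerNl opprB.
  have [rle1|/ltW rge1] := leP r 1.
    by rewrite (@le_trans _ _ 0) ?subr_le0// exprn_ge0.
  rewrite (@le_trans _ _ r)//; first by rewrite gerBl.
  by rewrite ler_eXnr// muln_gt0.
rewrite ler_pdivlMr ?exprn_gt0// -!mulrA ler_wpM2l//.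
rewrite (_ : 1 - r = 2 - (1 + r)); last by ring.
rewrite expRB.
rewrite (_ : _ * (_ * _) = expR 2 * ((1 + r) ^+ (k + N.+1) / expR (1 + r))).
  by rewrite ler_wpM2l ?expR_ge0// ler_pdivrMr ?expR_gt0// exprn_le_expR// ltW.
by rewrite exprD; ring.
Qed.

Lemma integrable_decay1 rho : 0 < rho ->
  mu.-integrable setT (EFin \o (@decay R N 1 rho)).
Proof.
move=> r0; apply/integrableP; split.
  by apply/measurable_EFinP; exact: measurable_decay.
have [C C0 /(_ _ r0) hC] := integral_decay N0 (@ltr01 R).
rewrite (le_lt_trans _ (ltry C))//.
rewrite (eq_integral (fun v => (decay 1 rho v)%:E))// => v _.
by rewrite /= ger0_norm// decay_ge0.
Qed.

Lemma integrable_dominated (f g : 'rV[R]_N -> R) : measurable_fun setT f ->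
  mu.-integrable setT (EFin \o g) -> (forall v, `|f v| <= g v) ->
  mu.-integrable setT (EFin \o f).
Proof.
move=> mf ig fg; apply: le_integrable ig => //; first exact/measurable_EFinP.
by move=> v _ /=; rewrite lee_fin (le_trans (fg v))// ler_norm.
Qed.

Lemma le_norm_Rintegral_dominated (f g : 'rV[R]_N -> R) : measurable_fun setT f ->
  mu.-integrable setT (EFin \o g) -> (forall v, `|f v| <= g v) ->
  `|\int[mu]_v f v| <= \int[mu]_v g v.
Proof.
move=> mf ig fg; have if_ := integrable_dominated mf ig fg.
rewrite (le_trans (le_normr_Rintegral _ if_))//.
by apply: le_Rintegral => //; exact: integrable_norm.
Qed.

Lemma measurable_scale_rV a : measurable_fun setT (fun v : 'rV[R]_N => a *: v).
Proof.
apply/measurable_fun_rVP => i; under eq_fun do rewrite mxE.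
by apply: measurable_funM => //; exact: measurable_coord_rV.
Qed.

Lemma measurable_wave x phi : measurable_fun setT (fun xi => cos (dotp x xi + phi)).
Proof.
apply: measurableT_comp.
  by apply: continuous_measurable_fun => y; exact: continuous_cos.
by apply: measurable_funD => //; exact: measurable_dotp.
Qed.

Lemma measurable_polyfunM_gE_scale p a : polyfun p ->
  measurable_fun setT (fun xi => p (a *: xi) * gE (a *: xi)).
Proof.
move=> pp; apply: (measurableT_comp (measurable_polyfunM_gE pp)).
exact: measurable_scale_rV.
Qed.

(** The phase phi merges sine and cosine transforms into one real family, stable under derivatives
    in x, each of which shifts the phase by pi / 2. *)
Definition osc p a phi x : R :=
  \int[mu]_xi (cos (dotp x xi + phi) * (p (a *: xi) * gE (a *: xi))).

Lemma osc_integrand_decay p : polyfun p -> exists2 C : R, 0 <= C &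
  forall a xi (c : R), 0 < a -> `|c| <= 1 ->
    `|c * (p (a *: xi) * gE (a *: xi))| <= C * a ^- N * decay 1 a^-1 xi.
Proof.
move=> pp; have [C C0 hC] := gE_decay pp.
exists C => // a xi c a0 c1; rewrite -mulrA -decay1Z// normrM.
by rewrite (le_trans _ (hC _))// ler_piMl.
Qed.

Lemma integrableZl_EFin (C : R) (f : 'rV[R]_N -> R) :
  mu.-integrable setT (EFin \o f) ->
  mu.-integrable setT (EFin \o (fun v => C * f v)).
Proof.
move=> if_; rewrite (_ : EFin \o _ = fun v => C%:E * (f v)%:E)%E//.
exact: integrableZl.
Qed.

Lemma integrableB_EFin (f g : 'rV[R]_N -> R) :
  mu.-integrable setT (EFin \o f) -> mu.-integrable setT (EFin \o g) ->
  mu.-integrable setT (EFin \o (fun v => f v - g v)).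
Proof.
move=> if_ ig; rewrite (_ : EFin \o _ = (EFin \o f) \- (EFin \o g))%E//.
exact: integrableB.
Qed.

Lemma integrable_osc p a (b : 'rV[R]_N -> R) : polyfun p -> 0 < a ->
  measurable_fun setT b -> (forall xi, `|b xi| <= 1) ->
  mu.-integrable setT (EFin \o (fun xi => b xi * (p (a *: xi) * gE (a *: xi)))).
Proof.
move=> pp a0 mb b1; have [C C0 hC] := osc_integrand_decay pp.
apply: (@integrable_dominated _ (fun xi => C * a ^- N * decay 1 a^-1 xi)).
- by apply: measurable_funM => //; exact: measurable_polyfunM_gE_scale.
- by apply: integrableZl_EFin; apply: integrable_decay1; rewrite invr_gt0.
- by move=> xi; exact: hC.
Qed.

Lemma osc_bound p : polyfun p -> exists2 C : R, 0 <= C &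
  forall a phi x, 0 < a -> `|osc p a phi x| <= C * a ^- N.
Proof.
move=> pp; have [C C0 hC] := osc_integrand_decay pp.
have [D D0 hD] := integral_decay N0 (@ltr01 R).
exists (C * D); first by rewrite mulr_ge0// ltW.
move=> a phi x a0; have a0' : 0 < a^-1 by rewrite invr_gt0.
apply: (@le_trans _ _ (\int[mu]_xi (C * a ^- N * decay 1 a^-1 xi))).
  apply: le_norm_Rintegral_dominated.
  - apply: measurable_funM; first exact: measurable_wave.
    exact: measurable_polyfunM_gE_scale.
  - by apply: integrableZl_EFin; exact: integrable_decay1.
  - by move=> xi; apply: hC => //; exact: cos_max.
rewrite RintegralZl//; last exact: integrable_decay1.
rewrite mulrAC ler_wpM2r ?invr_ge0 ?exprn_ge0 ?(ltW a0)// ler_wpM2l//.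
rewrite -lee_fin /Rintegral fineK ?hD//.
exact: (integrable_fin_num measurableT (integrable_decay1 a0')).
Qed.

Lemma osc_derive p a phi x v : polyfun p -> 0 < a ->
  is_derive x v (osc p a phi)
    (a^-1 * osc (fun u => dotp v u * p u) a (phi + pi / 2) x).
Proof.
move=> pp a0; pose w u := dotp v u * dotp v u * p u.
have pw : polyfun w.
  by apply: polyfun_mul => //; apply: polyfun_mul; exact: polyfun_dotpl.
have pvp : polyfun (fun u => dotp v u * p u).
  by apply: polyfun_mul => //; exact: polyfun_dotpl.
have io q psi y := fun pq => @integrable_osc q a (fun xi => cos (dotp y xi + psi))
  pq a0 (measurable_wave y psi) (fun xi => cos_max _).
pose W xi := `|1 * (w (a *: xi) * gE (a *: xi))|.
have iW : mu.-integrable setT (EFin \o W).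
  apply: integrable_norm => //; apply: integrable_osc => //.
  by move=> ?; rewrite normr1.
apply: (@is_derive_quadratic _ _ _ _ _ _ (a ^- 2 * \int[mu]_xi W xi) 1) => // h _.
rewrite /osc mulrA -RintegralZl//; last exact: (io _ _ _ pvp).
have i2 : mu.-integrable setT (EFin \o (fun xi =>
    cos (dotp (h *: v + x) xi + phi) * (p (a *: xi) * gE (a *: xi)) -
    cos (dotp x xi + phi) * (p (a *: xi) * gE (a *: xi)))).
  by apply: integrableB_EFin; exact: io.
have i3 : mu.-integrable setT (EFin \o (fun xi => h * a^-1 *
    (cos (dotp x xi + (phi + pi / 2)) * (dotp v (a *: xi) * p (a *: xi) * gE (a *: xi))))).
  by apply: integrableZl_EFin; exact: (io _ _ _ pvp).
rewrite -RintegralB//; [|exact: io|exact: io].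
rewrite -RintegralB// mulrAC -RintegralZl//.
apply: le_norm_Rintegral_dominated.
- by apply/measurable_EFinP; apply: (measurable_int mu); exact: integrableB_EFin.
- exact: integrableZl_EFin.
move=> xi; rewrite dotpDl dotpZl dotpZr.
set A := dotp x xi + phi; set u := h * dotp v xi.
rewrite (_ : u + dotp x xi + phi = A + u); last by rewrite /A; ring.
rewrite (_ : dotp x xi + (phi + pi / 2) = A + pi / 2); last by rewrite /A; ring.
set g := p (a *: xi) * gE (a *: xi).
rewrite (_ : _ - _ - _ = g * (cos (A + u) - cos A - u * cos (A + pi / 2))); last first.
  by rewrite /g /u; field; rewrite gt_eqF.
rewrite /W /w dotpZr mul1r.
rewrite (_ : a * dotp v xi * (a * dotp v xi) * p (a *: xi) * gE (a *: xi) =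
             g * (a * dotp v xi) ^+ 2); last by rewrite /g; ring.
rewrite (normrM g) (normrM g) [leRHS]mulrCA ler_wpM2l// (le_trans (cos_taylor _ _))//.
rewrite [`|_ ^+ 2|]ger0_norm ?sqr_ge0// [leRHS](_ : _ = u ^+ 2)//.
by rewrite /u; field; rewrite gt_eqF.
Qed.

End oscillatory.

Section oscillatory_decay.
Context {R : realType} {N : nat} (m : nat).
Hypothesis N0 : (0 < N)%N.
Hypothesis m0 : (0 < m)%N.
Implicit Types (p q : 'rV[R]_N -> R) (x xi eta w : 'rV[R]_N) (a phi : R).
Local Notation mu := (lebesgue_rV R N).
Local Notation osc := (@osc R N m).
Local Notation gE := (@gE R N m).

(** From 1 + |eta| <= (1 + |w|) (1 + |eta + t w|). It dominates p gE along a whole segment by one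
    integrable function, which the Taylor error in [osc_ibp] requires. *)
Lemma decay1_line w eta (t : R) : `|t| <= 1 ->
  decay 1 1 (line w eta t) <= (1 + enorm w) ^+ N.+1 * decay 1 1 eta.
Proof.
move=> t1; rewrite !decay1E// !mul1r.
have p1 v : 0 < 1 + @enorm R N v by rewrite ltr_wpDr// enorm_ge0.
rewrite ler_pdivlMr ?exprn_gt0// mulrC ler_pdivrMr ?exprn_gt0// -exprMn.
apply: lerXn2r; rewrite ?nnegrE ?mulr_ge0 ?(ltW (p1 _))//.
have := enormD (line w eta t) (- t *: w).
rewrite {1}/line scaleNr addrK enormN enormZ => h.
have tw : `|t| * enorm w <= enorm w by rewrite ler_piMl// enorm_ge0.
have := enorm_ge0 w; have := enorm_ge0 (line w eta t); nra.
Qed.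

(* Both sides are minus the derivative at h = 0 of
   \int cos (x.xi + phi) (p gE) (a (xi + h w)), computed before and after
   translating xi by - h w. *)
Lemma osc_ibp w p q a phi x : polyfun p -> polyfun q -> derivesE m w p q -> 0 < a ->
  dotp x w * osc p a (phi + pi / 2) x = - (a * osc q a phi x).
Proof.
move=> pp pq dpq a0; have [r pr dqr] := polyfun_derivesE m w pq.
have mw psi := measurable_wave x psi.
have io s psi := fun ps => @integrable_osc R N m N0 m0 s a
  (fun xi => cos (dotp x xi + psi)) ps a0 (mw psi) (fun xi => cos_max _).
have ioZ (C : R) s psi := fun ps => integrableZl_EFin C (io s psi ps).
pose J (h : R) := osc p a (phi - h * dotp x w) x.
pose W xi := `|1 * (p (a *: xi) * gE (a *: xi))|.
have iW : mu.-integrable setT (EFin \o W).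
  apply: integrable_norm => //; apply: integrable_osc => //.
  by move=> ?; rewrite normr1.
have lineE (h : R) xi : a *: (xi + h *: w) = line w (a *: xi) (h * a).
  by rewrite /line scalerDr scalerA [a * h]mulrC.
have mline (h : R) : measurable_fun setT (fun xi => cos (dotp x xi + phi) *
    (p (a *: (xi + h *: w)) * gE (a *: (xi + h *: w)))).
  apply: measurable_funM; first exact: mw.
  apply: (measurableT_comp (measurable_polyfunM_gE_scale m a pp)).
  exact: measurable_addr_rV.
have JE h : J h = \int[mu]_xi (cos (dotp x xi + phi) *
    (p (a *: (xi + h *: w)) * gE (a *: (xi + h *: w)))).
  rewrite -(Rintegral_rVD (- (h *: w))); last exact: mline.
  apply: eq_Rintegral => xi _; rewrite subrK dotpDr -[- (h *: w)]scaleNr dotpZr.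
  by congr (cos _ * _); ring.
have d1 : is_derive (0 : R) 1 J (- (dotp x w * osc p a (phi + pi / 2) x)).
  apply: (@is_derive_quadratic _ _ _ _ _ _ (dotp x w ^+ 2 * \int[mu]_xi W xi) 1) => // h _.
  rewrite addr0 /J /= /GRing.scale/= mulr1 mul0r subr0 /osc.
  rewrite mulrN opprK mulrA -RintegralZl//; last exact: io.
  have i2 : mu.-integrable setT (EFin \o (fun xi =>
      cos (dotp x xi + (phi - h * dotp x w)) * (p (a *: xi) * gE (a *: xi)) -
      cos (dotp x xi + phi) * (p (a *: xi) * gE (a *: xi)))).
    by apply: integrableB_EFin; exact: io.
  rewrite -RintegralB//; [|exact: io|exact: io].
  rewrite -RintegralD//; last exact: ioZ.
  rewrite mulrAC -RintegralZl//.
  apply: le_norm_Rintegral_dominated.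
  - apply: measurable_funD; apply/measurable_EFinP; apply: (measurable_int mu) => //.
    exact: ioZ.
  - exact: integrableZl_EFin.
  move=> xi; set A := dotp x xi + phi; set u := - h * dotp x w.
  rewrite (_ : dotp x xi + (phi - h * dotp x w) = A + u); last by rewrite /A /u; ring.
  rewrite (_ : dotp x xi + (phi + pi / 2) = A + pi / 2); last by rewrite /A; ring.
  rewrite /W mul1r; set g := p (a *: xi) * gE (a *: xi).
  rewrite (_ : _ - _ + _ = g * (cos (A + u) - cos A - u * cos (A + pi / 2))); last first.
    by rewrite /u; ring.
  rewrite (normrM g) [leRHS]mulrC ler_wpM2l// (le_trans (cos_taylor _ _))//.
  by rewrite [leRHS](_ : _ = u ^+ 2)// /u; ring.
have [C C0 hC] := gE_decay m0 pr.
pose W2 (C : R) xi := C * (1 + enorm w) ^+ N.+1 * (a ^- N * decay 1 a^-1 xi).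
have iW2 C' : mu.-integrable setT (EFin \o W2 C').
  apply: integrableZl_EFin; apply: integrableZl_EFin; apply: integrable_decay1 => //.
  by rewrite invr_gt0.
have d2 : is_derive (0 : R) 1 J (a * osc q a phi x).
  (* The restriction |h| <= 1/a gives |h a| <= 1, so [decay1_line] controls the second derivative
     between a xi and a (xi + h w). *)
  apply: (@is_derive_quadratic _ _ _ _ _ _ (a ^+ 2 * \int[mu]_xi W2 C xi) a^-1);
    first by rewrite invr_gt0.
  move=> h ha; rewrite addr0 {1}JE /J /= /GRing.scale/= mulr1 mul0r subr0 /osc.
  have ha1 : `|h * a| <= 1.
    by rewrite normrM (gtr0_norm a0) -ler_pdivlMr// mul1r.
  have ip : mu.-integrable setT (EFin \o (fun xi => cos (dotp x xi + phi) *
    (p (a *: (xi + h *: w)) * gE (a *: (xi + h *: w))))).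
    have [D D0 hD] := gE_decay m0 pp.
    apply: (@integrable_dominated _ _ _ (W2 D)) => // xi.
    rewrite normrM lineE /W2 -decay1Z// -mulrA.
    rewrite (@le_trans _ _ (D * decay 1 1 (line w (a *: xi) (h * a))))//.
      by rewrite (le_trans _ (hD _))// ler_piMl// cos_max.
    by rewrite ler_wpM2l// decay1_line.
  have i2 : mu.-integrable setT (EFin \o (fun xi =>
      cos (dotp x xi + phi) * (p (a *: (xi + h *: w)) * gE (a *: (xi + h *: w))) -
      cos (dotp x xi + phi) * (p (a *: xi) * gE (a *: xi)))).
    by apply: integrableB_EFin => //; exact: io.
  rewrite mulrA -RintegralZl//; last exact: io.
  rewrite -RintegralB//; last exact: io.
  rewrite -RintegralB//; last exact: ioZ.
  rewrite mulrAC -RintegralZl//.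
  apply: le_norm_Rintegral_dominated.
  - apply: measurable_funB; apply/measurable_EFinP; apply: (measurable_int mu) => //.
    exact: ioZ.
  - exact: integrableZl_EFin.
  move=> xi.
  have := @taylor2_bound R _ _ _ (h * a) (C * (1 + enorm w) ^+ N.+1 * decay 1 1 (a *: xi))
    (dpq (a *: xi)) (dqr (a *: xi)).
  have -> : line w (a *: xi) 0 = a *: xi by rewrite /line scale0r addr0.
  rewrite -(lineE h xi) => H.
  rewrite (_ : _ - _ - _ = cos (dotp x xi + phi) *
    (p (a *: (xi + h *: w)) * gE (a *: (xi + h *: w)) - p (a *: xi) * gE (a *: xi) -
     h * a * (q (a *: xi) * gE (a *: xi)))); last by ring.
  rewrite normrM (le_trans (ler_piMl _ (cos_max _)))//.
  apply: le_trans (H _) _.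
    move=> t th; apply: (le_trans (hC _)); rewrite -mulrA ler_wpM2l//.
    by rewrite decay1_line// (le_trans th).
  rewrite /W2 decay1Z//; set D := decay _ _ _.
  by rewrite le_eqVlt; apply/orP; left; apply/eqP; ring.
have e1 := @derive_val _ _ _ _ _ _ _ d1.
have e2 := @derive_val _ _ _ _ _ _ _ d2.
by rewrite -e2 e1 opprK.
Qed.

(** Each integration by parts in the i-th direction trades a factor x_i for a factor a. The phase
    shift that it causes is absorbed by the uniformity in phi. *)
Lemma osc_coord_decay p i k : polyfun p -> exists2 C : R, 0 <= C &
  forall a phi x, 0 < a -> `|x ord0 i| ^+ k * `|osc p a phi x| <= C * (a ^+ k * a ^- N).
Proof.
elim: k p => [|k IH] p pp.
  have [C C0 hC] := osc_bound N0 m0 pp; exists C => // a phi x a0.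
  by rewrite !expr0 !mul1r hC.
have [q pq dq] := polyfun_derivesE m (delta_mx ord0 i) pp.
have [C C0 hC] := IH q pq; exists C => // a phi x a0.
rewrite exprSr -mulrA -normrM -dotp_delta.
have := @osc_ibp _ _ _ a (phi - pi / 2) x pp pq dq a0; rewrite subrK => ->.
rewrite normrN normrM (gtr0_norm a0) mulrCA dotp_delta exprS.
by rewrite -[a * _ * _]mulrA [leRHS]mulrCA ler_wpM2l ?hC// ltW.
Qed.

End oscillatory_decay.

(** * Gaussians *)

Section ray.
Context {R : realType} {V : normedModType R}.

Lemma is_derive_ray (f : V -> R) (x : V) (r d : R) :
  is_derive (r *: x) x f d -> is_derive r 1 (fun s => f (s *: x)) d.
Proof.
move=> [df dE].
have e : (fun h : R => h^-1 *: (((fun s => f (s *: x)) \o shift r) (h *: 1) - f (r *: x)))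
  = (fun h : R => h^-1 *: ((f \o shift (r *: x)) (h *: x) - f (r *: x))).
  by apply/funext => h; rewrite /= [h *: 1]mulr1 scalerDl.
split; first by move: df; rewrite /derivable -e.
by move: dE; rewrite /derive -e.
Qed.

End ray.

Section gaussian.
Context {R : realType} {N : nat}.
Hypothesis N0 : (0 < N)%N.
Implicit Types (x : 'rV[R]_N) (a : R).
Local Notation mu := (lebesgue_rV R N).

Let m1 : (0 < 1)%N := ltnSn 0.
Let one : 'rV[R]_N -> R := cst 1.

Lemma derivesE_gaussian (w : 'rV[R]_N) : derivesE 1 w one (fun v => (- 2) * dotp w v).
Proof.
have d (xi : 'rV[R]_N) (t : R) : is_derive t 1
     (fun t => dotp (line w xi t) (line w xi t) ^+ 1) (2 * dotp w (line w xi t)).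
  pose c := dotp w xi; pose e := dotp w w.
  have -> : (fun t => dotp (line w xi t) (line w xi t) ^+ 1) =
      cst (dotp xi xi) + (2 * c) \*: (@id R) + e \*: ((@id R) ^+ 2).
    apply/funext => s; rewrite /line expr1 !(dotpDl, dotpDr, dotpZl, dotpZr).
    rewrite (dotpC xi w) -/c -/e.
    transitivity (dotp xi xi + (2 * c) * s + e * s ^+ 2); last by [].
    ring.
  have -> : dotp w (line w xi t) = c + t * e by rewrite /line dotpDr dotpZr.
  apply: is_derive_eq; rewrite /GRing.scale/=; ring.
have := @derivesEP R N 1 w one (fun v => 2 * dotp w v) (cst 0) d
  (fun xi t => is_derive_cst _ _ _).
rewrite (_ : (fun v => _) = (fun v => (- 2) * dotp w v))//.
by apply/funext => v; rewrite /one /=; ring.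
Qed.

Lemma oscZ (m : nat) (p : 'rV[R]_N -> R) (a phi : R) x (c : R) : (0 < m)%N -> polyfun p -> 0 < a ->
  osc m (fun u => c * p u) a phi x = c * osc m p a phi x.
Proof.
move=> m0 pp a0; rewrite /osc -RintegralZl//; last first.
  exact: (integrable_osc N0 m0 pp a0 (measurable_wave x phi) (fun=> cos_max _)).
by apply: eq_Rintegral => xi _; ring.
Qed.

Definition gauss a x : R := osc 1 one a 0 x.

(** Differentiation in x creates the factor v.(a xi), and integration by parts removes it because
    the derivative of gE is - 2 (v.eta) gE. The two quarter-turn phase shifts add up to pi, whence
    the sign. *)
Lemma gauss_derive a x v : 0 < a ->
  is_derive x v (gauss a) (- (dotp x v / (2 * a ^+ 2)) * gauss a x).
Proof.
move=> a0; have a0' := gt_eqF a0.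
have pone : polyfun one by exact: polyfun_cst.
have pdot := @polyfun_dotpl R N v.
have pdot2 : polyfun (fun u => (- 2) * dotp v u).
  by apply: polyfun_mul => //; exact: (polyfun_cst (-2)).
have h := osc_derive N0 m1 0 x v pone a0.
apply: is_derive_eq.
rewrite (_ : (fun u => dotp v u * one u) = dotp v); last first.
  by apply/funext => u; rewrite mulr1.
have := osc_ibp N0 m1 (pi / 2) x pone pdot2 (derivesE_gaussian v) a0.
rewrite oscZ// (_ : pi / 2 + pi / 2 = pi :> R); last by field.
rewrite (_ : osc 1 one a pi x = - gauss a x); last first.
  rewrite -mulN1r -[in RHS]oscZ//; apply: eq_Rintegral => xi _.
  by rewrite cosDpi addr0 /one /=; ring.
rewrite add0r => e.
have -> : osc 1 (dotp v) a (pi / 2) x = - (dotp x v) * gauss a x / (2 * a).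
  have a2 : 2 * a != 0 by rewrite mulf_neq0// ?pnatr_eq0// a0'.
  by apply: (mulIf a2); rewrite divfK// mulrC; move: e; lra.
by field; rewrite a0'.
Qed.

(** Along s x the equation reads f' = - s k f, with integrating factor g = exp(k s^2 / 2), so f g
    takes the same value at s = 0 and s = 1. The value at the origin is not computed: [gauss_ub] and
    [gauss_lb] fix its order a^-N. *)
Lemma gaussE a x : 0 < a -> gauss a x = gauss a 0 * expR (- (dotp x x / (4 * a ^+ 2))).
Proof.
move=> a0; pose k := dotp x x / (2 * a ^+ 2).
pose f (s : R) := gauss a (s *: x); pose g (s : R) := expR (k / 2 * s ^+ 2).
have df (s : R) : is_derive s 1 f (- (s * k) * f s).
  apply: is_derive_ray; apply: is_derive_eq; first exact: gauss_derive.
  by rewrite dotpZl /k /f mulrA.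
have dg (s : R) : is_derive s 1 g (s * k * g s).
  have d2 : is_derive s 1 ((k / 2) \*: ((@id R) ^+ 2)) (s * k).
    by apply: is_derive_eq; rewrite /GRing.scale/= ; field.
  have h := is_derive1_comp (is_derive_expR _) d2.
  have h' : is_derive s 1 g (expR (((k / 2) \*: ((@id R) ^+ 2)) s) * (s * k)) by exact: h.
  by apply: is_derive_eq; rewrite mulrC.
have dfg (s : R) : is_derive s 1 (f * g) 0.
  by apply: is_derive_eq; rewrite /GRing.scale/=; ring.
have [c _] := mvt_from0 1 dfg.
rewrite mul0r => /subr0_eq e.
have {}e : gauss a x * expR (k / 2) = gauss a 0.
  transitivity (f 1 * g 1); first by rewrite /f /g scale1r expr1n mulr1.
  transitivity (f 0 * g 0); first exact: e.
  by rewrite /f /g scale0r expr0n/= mulr0 expR0 mulr1.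
rewrite -e -mulrA -expRD (_ : _ + _ = 0) ?expR0 ?mulr1// /k.
by field; rewrite gt_eqF.
Qed.

Lemma gauss_ub : exists2 C : R, 0 < C & forall a, 0 < a -> gauss a 0 <= C * a ^- N.
Proof.
have pone : polyfun one by exact: polyfun_cst.
have [C C0 hC] := osc_bound N0 m1 pone; exists (C + 1); first by rewrite ltr_wpDl.
move=> a a0; rewrite (le_trans (ler_norm _))// (le_trans (hC _ _ _ _))//.
by rewrite ler_wpM2r ?lerDl// invr_ge0 exprn_ge0// ltW.
Qed.

(** At x = 0 the integrand is positive; on the cube |xi_i| <= 1/a, of volume (2/a)^N, it is at least
    exp(- N). *)
Lemma gauss_lb : exists2 c : R, 0 < c & forall a, 0 < a -> c * a ^- N <= gauss a 0.
Proof.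
exists (expR (- N%:R) * 2 ^+ N); first by rewrite mulr_gt0 ?expR_gt0 ?exprn_gt0.
move=> a a0; pose I : set R := `[- a^-1, a^-1]%classic.
pose B : set 'rV[R]_N := [set v | forall i, I (v ord0 i)].
have mB : measurable B by apply: (@measurable_box_rV R N (fun=> I)) => i; exact: measurable_itv.
have a1 : - a^-1 <= a^-1 by rewrite ge0_cp// invr_ge0 ltW.
have muB : mu B = ((2 / a) ^+ N)%:E.
  have -> : mu B = (\prod_(i < N) @lebesgue_measure R I)%E.
    by apply: (@lebesgue_rV_box R N (fun=> I)) => i; exact: measurable_itv.
  rewrite (eq_bigr (fun=> (2 / a)%:E)).
    by rewrite prodEFin prodr_const card_ord.
  move=> i _; rewrite /I lebesgue_measure_itv/= lte_fin gt0_cp ?invr_gt0//.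
  by rewrite -EFinB opprK -mulr2n -[_ *+ 2]mulr_natl.
have ig : mu.-integrable setT (EFin \o (fun xi : 'rV[R]_N => one (a *: xi) * gE 1 (a *: xi))).
  have normr1_le1 : `|1 : R| <= 1 by rewrite normr1.
  have i1 := @integrable_osc R N 1 N0 m1 one a (cst 1) (polyfun_cst 1) a0
    (@measurable_cst _ _ _ _ setT (1 : R)) 
    (fun=> normr1_le1).
  rewrite (_ : EFin \o _ = EFin \o (fun xi => cst 1 xi * (one (a *: xi) * gE 1 (a *: xi))))//.
  by apply/funext => xi; rewrite /= mul1r.
have mg : measurable_fun setT (fun v : 'rV[R]_N => (one (a *: v) * gE 1 (a *: v))%:E).
  exact: (measurable_int mu ig).
have -> : gauss a 0 = \int[mu]_xi (one (a *: xi) * gE 1 (a *: xi)).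
  by apply: eq_Rintegral => xi _; rewrite dotp0l addr0 cos0 mul1r.
rewrite -lee_fin /Rintegral fineK; last exact: (integrable_fin_num measurableT ig).
apply: (@le_trans _ _ (\int[mu]_(v in B) (expR (- N%:R))%:E)%E).
  by rewrite integral_cst// [X in (_ <= _ * X)%E]muB -EFinM lee_fin expr_div_n mulrA.
apply: (@le_trans _ _ (\int[mu]_(v in B) (one (a *: v) * gE 1 (a *: v))%:E)%E).
  apply: ge0_le_integral => //.
  - exact: measurable_funTS.
  - move=> v Bv; rewrite lee_fin /one mul1r /gE ler_expR lerN2 expr1.
    rewrite -[N in leRHS](card_ord N) -sum1_card natr_sum; apply: ler_sum => i _.
    rewrite !mxE -expr2 -real_normK ?num_real// expr_le1// normrM gtr0_norm//.
    rewrite mulrC -ler_pdivlMr// mul1r ler_norml.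
    by have := Bv i; rewrite /I /= in_itv.
apply: ge0_subset_integral => // v _.
by rewrite lee_fin mulr_ge0// gE_ge0.
Qed.

End gaussian.

(** * Derivatives of the polyharmonic kernel *)

Section polyharmonic.
Context {R : realType} {N : nat}.
Hypothesis N0 : (0 < N)%N.
Implicit Types (p : 'rV[R]_N -> R) (x : 'rV[R]_N).

Lemma fundsolE (p : R -> R) x t : fundsol p x t =
  (2 * pi) ^- N * \int[lebesgue_rV R N]_xi (cos (dotp x xi) * expR (- (t * p (enorm xi)))).
Proof.
rewrite /fundsol /cfundsol /cintegral /= mul0r subr0; congr (_ * _).
by apply: eq_Rintegral => xi _; rewrite mulr0 subr0.
Qed.

Lemma poly_kernel_osc m x a : 0 <= a ->
  poly_kernel m x (a ^+ (2 * m)) = (2 * pi) ^- N * osc m (cst 1) a 0 x.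
Proof.
move=> a0; rewrite /poly_kernel fundsolE; congr (_ * _).
apply: eq_Rintegral => xi _; rewrite addr0 mul1r /gE -sqr_enorm enormZ.
by rewrite ger0_norm// -exprMn -exprM.
Qed.

Definition monomial (alpha : {ffun 'I_N -> nat}) (s : seq 'I_N) : 'rV[R]_N -> R :=
  foldr (fun i p => iter (alpha i) (fun (q : 'rV[R]_N -> R) v => v ord0 i * q v) p) (cst 1) s.

Lemma polyfun_monomial alpha s : polyfun (monomial alpha s).
Proof.
elim: s => [|i s IH] /=; first exact: polyfun_cst.
elim: (alpha i) => [//|k IHk] /=; apply: polyfun_mul => //; exact: polyfun_coord.
Qed.

Lemma partial_osc m p (c a phi : R) i : (0 < m)%N -> polyfun p -> 0 < a ->
  partial i (fun y => c * osc m p a phi y) =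
  (fun y => c / a * osc m (fun v => v ord0 i * p v) a (phi + pi / 2) y).
Proof.
move=> m0 pp a0; apply/funext => y; rewrite /partial.
have h := is_deriveZ c (osc_derive N0 m0 phi y (delta_mx ord0 i) pp a0).
have e : (fun v => dotp (delta_mx ord0 i) v * p v) = (fun v => v ord0 i * p v).
  by apply/funext => v; rewrite dotpC dotp_delta.
rewrite e in h.
transitivity (c *: (a^-1 * osc m (fun v => v ord0 i * p v) a (phi + pi / 2) y)).
  exact: (@derive_val _ _ _ _ _ _ _ h).
by rewrite /GRing.scale/= mulrA.
Qed.

(** Each derivative contributes 1/a, a coordinate factor and a quarter turn of the phase. The final
    phase stays existential because the estimates are uniform in it. *)
Lemma mpartial_osc m (alpha : {ffun 'I_N -> nat}) (c a phi : R) : (0 < m)%N -> 0 < a ->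
  exists psi : R, mpartial alpha (fun y => c * osc m (cst 1) a phi y) =
    (fun y => c * a ^- (\sum_(i < N) alpha i) * osc m (monomial alpha (enum 'I_N)) a psi y).
Proof.
move=> m0 a0; rewrite -big_enum/= /mpartial.
elim: (enum 'I_N) => [|i s [psi IH]].
  by exists phi; rewrite big_nil expr0 invr1 mulr1.
rewrite big_cons /= {}IH; have := polyfun_monomial alpha s.
rewrite -/(monomial alpha s); move: (monomial alpha s) => q pq.
elim: (alpha i) => [|k [psi' IH]]; first by exists psi.
have pqk : polyfun (iter k (fun (q0 : 'rV[R]_N -> R) v => v ord0 i * q0 v) q).
  by elim: (k) => [//|l IHl] /=; apply: polyfun_mul => //; exact: polyfun_coord.
exists (psi' + pi / 2); rewrite iterS IH partial_osc//.
by apply/funext => y; rewrite addSn exprS invfM [a^-1 * _]mulrC mulrA.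
Qed.

Lemma enorm_le_coord x : exists i, enorm x <= N%:R * `|x ord0 i|.
Proof.
apply: contrapT => /forallNP h.
have : \sum_(i < N) `|x ord0 i| < \sum_(i < N) (enorm x / N%:R).
  apply: ltr_sum => [|i _]; first by apply/hasP; exists (Ordinal N0); rewrite ?mem_index_enum.
  by rewrite ltr_pdivlMr ?ltr0n// mulrC ltNge; apply/negP/h.
rewrite sumr_const card_ord -[X in _ < X]mulr_natr divfK ?pnatr_eq0 -?lt0n//.
by rewrite ltNge enorm_le_sum.
Qed.

(** The quotient of the two profiles is (rho / (rho + |x|))^(th' - th) <= 1. *)
Lemma le_decay (th th' rho : R) x : 0 < rho -> th <= th' ->
  decay th' rho x <= decay th rho x.
Proof.
move=> r0 tt; have e0 := enorm_ge0 x; have re : 0 < rho + enorm x by rewrite ltr_wpDr.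
have -> : decay th' rho x = decay th rho x *
    (rho `^ (th' - th) * (rho + enorm x) `^ (- (th' - th))).
  rewrite /decay mulrACA -!powRD ?(gt_eqF r0) ?(gt_eqF re) ?implybT//.
  by congr (_ `^ _ * _ `^ _); ring.
rewrite ler_piMr ?decay_ge0// powRN ler_pdivrMr ?powR_gt0// mul1r ge0_ler_powR ?subr_ge0//.
- by rewrite nnegrE ltW.
- by rewrite nnegrE ltW.
- by rewrite lerDl.
Qed.

(** Decay in one coordinate suffices, since some coordinate is at least |x| / N. Which one depends
    on x, hence the sum of the constants over i. *)
Lemma osc_decay m p (th : R) : (0 < m)%N -> polyfun p -> th <= 2 ->
  exists2 C : R, 0 <= C & forall a phi x, 0 < a -> `|osc m p a phi x| <= C * decay th a x.
Proof.
move=> m0 pp th2; have [C0 C00 hC0] := osc_bound N0 m0 pp.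
(* With N + 2 integrations by parts, a^M a^-N = a^2, which yields a multiple of [decay 2 a x];
   [le_decay] then relaxes 2 to th. *)
pose M := (N + 2)%N.
have /choice[C hC] (i : 'I_N) : exists C : R, 0 <= C /\
  forall a phi x, 0 < a -> `|x ord0 i| ^+ M * `|osc m p a phi x| <= C * (a ^+ M * a ^- N).
  by have [C ? ?] := osc_coord_decay N0 m0 i M pp; exists C.
exists (2 ^+ M * (C0 + N%:R ^+ M * \sum_(i < N) C i)).
  by rewrite mulr_ge0// addr_ge0// mulr_ge0// sumr_ge0// => i _; have [] := hC i.
move=> a phi x a0.
have e0 := enorm_ge0 x; have re : 0 < a + enorm x by rewrite ltr_wpDr.
apply: (@le_trans _ _ (2 ^+ M * (C0 + N%:R ^+ M * \sum_(i < N) C i) * decay 2 a x));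
  last first.
  rewrite ler_wpM2l ?le_decay// mulr_ge0// addr_ge0// mulr_ge0// sumr_ge0// => i _.
  by have [] := hC i.
rewrite /decay -natrD -/M powR_mulrn ?(ltW a0)// powR_invn ?(ltW re)//.
rewrite mulrA ler_pdivlMr ?exprn_gt0//.
have [i xi] := enorm_le_coord x.
have [Ci0 /(_ a phi x a0) hCi] := hC i.
have aMN : a ^+ M * a ^- N = a ^+ 2.
  by rewrite /M addnC exprD mulfK// expf_neq0// gt_eqF.
have hM : (a + enorm x) ^+ M <= 2 ^+ M * (a ^+ M + N%:R ^+ M * `|x ord0 i| ^+ M).
  rewrite mulrDr -!exprMn; have [xa|/ltW ax] := leP (enorm x) a.
    rewrite ler_wpDr ?exprn_ge0 ?mulr_ge0//.
    by apply: lerXn2r; rewrite ?nnegrE ?mulr_ge0 ?(ltW re) ?(ltW a0)//; lra.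
  rewrite ler_wpDl ?exprn_ge0 ?mulr_ge0 ?(ltW a0)//.
  by apply: lerXn2r; rewrite ?nnegrE ?mulr_ge0 ?(ltW re)//; lra.
rewrite mulrC (le_trans (ler_wpM2r _ hM))// -!mulrA ler_wpM2l// mulrDl.
rewrite -aMN mulrDl; apply: lerD.
  rewrite mulrCA ler_wpM2l ?exprn_ge0 ?(ltW a0)//.
  exact: hC0.
rewrite -!mulrA ler_wpM2l ?exprn_ge0// (le_trans hCi)// ler_wpM2r//.
  by rewrite aMN exprn_ge0// ltW.
by rewrite (bigD1 i)//= lerDl sumr_ge0// => k _; have [] := hC k.
Qed.

End polyharmonic.

(** * Mixtures of exponentials *)

Section absolutely_monotone.
Context {R : realType}.

Lemma ge0_derive_le (g g' : R -> R) (p q : R) : 0 <= p <= q -> q <= 1 ->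
  (forall t : R, 0 <= t <= 1 -> is_derive t 1 g (g' t)) ->
  (forall t : R, 0 <= t <= 1 -> 0 <= g' t) -> g p <= g q.
Proof.
move=> /andP[p0 pq] q1 dg g'0.
have in01 t : t \in `[p, q] -> 0 <= t <= 1.
  by rewrite in_itv/= => /andP[/(le_trans p0) -> /le_trans]; apply.
have cg : {within `[p, q], continuous g}.
  by apply: derivable_within_continuous => t /in01 /dg[].
have dg' t : t \in `]p, q[ -> is_derive t 1 g (g' t).
  by move=> tpq; apply/dg/in01; exact: subset_itv_oo_cc.
have [c /in01 c01] := MVT_segment pq dg' cg.
by rewrite -subr_ge0 => ->; rewrite mulr_ge0 ?g'0// subr_ge0.
Qed.

Lemma is_derive_power_sum K (W : nat -> R) (q : R) :
  is_derive q 1 (fun q => \sum_(k < K.+1) W k * q ^+ k)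
    (\sum_(k < K) W k.+1 * k.+1%:R * q ^+ k).
Proof.
elim: K => [|K IH].
  have -> : (fun q : R => \sum_(k < 1) W k * q ^+ k) = cst (W 0).
    by apply/funext => t; rewrite big_ord1 mulr1.
  rewrite big_ord0; exact: is_derive_cst.
have -> : (fun q : R => \sum_(k < K.+2) W k * q ^+ k) =
    (fun q => \sum_(k < K.+1) W k * q ^+ k) + W K.+1 \*: ((@id R) ^+ K.+1).
  by apply/funext => t; rewrite [LHS]big_ord_recr /= !fctE.
by apply: is_derive_eq; rewrite big_ord_recr/= /GRing.scale/= mulr1 mulrA.
Qed.

Variable P : (R -> R) -> Prop.
Hypothesis P_ge0 : forall g, P g -> forall q, 0 <= q <= 1 -> 0 <= g q.
Hypothesis P_derive : forall g, P g -> exists2 g', P g' &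
  forall q : R, 0 <= q <= 1 -> is_derive q 1 g (g' q).

(* The remainder r of the Taylor expansion at 0 of an absolutely monotone
   function satisfies r (c q) <= c^K r q, by integrating the same inequality
   for the derivative. *)
Lemma absolutely_monotone_taylor K g : P g -> exists2 w : nat -> R,
  (forall k, 0 <= w k) &
  forall q c, 0 <= q <= 1 -> 0 <= c <= 1 ->
    0 <= g q - \sum_(k < K) w k * q ^+ k /\
    g (c * q) - \sum_(k < K) w k * (c * q) ^+ k <=
      c ^+ K * (g q - \sum_(k < K) w k * q ^+ k).
Proof.
have cq01 (q c : R) : 0 <= q <= 1 -> 0 <= c <= 1 -> 0 <= c * q <= 1.
  by move=> /andP[q0 q1] /andP[c0 c1]; rewrite mulr_ge0//= mulr_ile1.
have z01 : 0 <= (0 : R) <= 1 by rewrite lexx ler01.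
elim: K g => [|K IH] g Pg.
  exists (fun=> 0) => // q c q01 c01; rewrite !big_ord0 !subr0 mul1r.
  split; first exact: P_ge0.
  have [g' Pg' dg] := P_derive Pg.
  case/andP: (q01) => q0 q1; case/andP: (c01) => c0 c1.
  apply: (ge0_derive_le _ q1 dg (P_ge0 Pg')).
  by rewrite mulr_ge0//= ler_piMl.
have [g' Pg' dg] := P_derive Pg; have [w w0 hw] := IH g' Pg'.
pose W k := if k is k'.+1 then w k' / k'.+1%:R else g 0.
exists W; first by case=> [|k]; [exact: P_ge0|rewrite /= divr_ge0].
pose r q := g q - \sum_(k < K.+1) W k * q ^+ k.
pose r' q := g' q - \sum_(k < K) w k * q ^+ k.
have dr (q : R) : 0 <= q <= 1 -> is_derive q 1 r (r' q).
  move=> q01; have d1 := dg q q01; have d2 := is_derive_power_sum K W q.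
  have -> : r = g - (fun q => \sum_(k < K.+1) W k * q ^+ k) by [].
  apply: is_derive_eq; congr (_ - _); apply: eq_bigr => k _.
  by rewrite /W divfK// pnatr_eq0.
have r0 : r 0 = 0.
  rewrite /r big_ord_recl expr0 mulr1 big1 ?addr0 ?subrr// => i _.
  by rewrite expr0n mulr0.
move=> q c q01 c01; split.
  case/andP: q01 => q0 q1; rewrite -/(r q) -r0.
  apply: (@ge0_derive_le r r' 0 q _ q1 dr) => [|t t01]; first by rewrite lexx.
  by have [] := hw t 0 t01 z01.
rewrite -/(r q) -/(r (c * q)) -subr_ge0.
pose D q := c ^+ K.+1 * r q - r (c * q).
have -> : 0 = D 0 by rewrite /D mulr0 r0 mulr0 subrr.
case/andP: q01 => q0 q1.
have dD (t : R) : 0 <= t <= 1 ->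
    is_derive t 1 D (c * (c ^+ K * r' t - r' (c * t))).
  move=> t01; have d1 := dr t t01; have d2 := dr _ (cq01 _ _ t01 c01).
  have dc : is_derive t 1 (c \*: (@id R)) c.
    by apply: is_derive_eq; rewrite /GRing.scale/= mulr1.
  have d3 : is_derive t 1 (fun t => r (c * t)) (r' (c * t) * c).
    exact: (@is_derive1_comp _ r (c \*: (@id R)) t _ _ d2 dc).
  have -> : D = (c ^+ K.+1 \*: r) - (fun t => r (c * t)) by [].
  by apply: is_derive_eq; rewrite /GRing.scale/= exprS; ring.
apply: (@ge0_derive_le D _ 0 q _ q1 dD) => [|t t01]; first by rewrite lexx.
have [_] := hw t c t01 c01; rewrite -subr_ge0 => h.
by case/andP: c01 => c0 _; rewrite mulr_ge0.
Qed.

End absolutely_monotone.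

Section stable_mixture.
Context {R : realType} (b : R).
Hypothesis b01 : 0 < b < 1.

Let b0 : 0 < b. Proof. by case/andP: b01. Qed.
Let b1 : b < 1. Proof. by case/andP: b01. Qed.

(* A cone of completely monotone functions containing exp(- l^b) and stable
   under - d/dl. *)
Inductive cm : (R -> R) -> Prop :=
| cm_term c g : 0 <= c -> 0 <= g -> cm (fun l => c * l `^ (- g) * expR (- l `^ b))
| cm_add f g : cm f -> cm g -> cm (fun l => f l + g l).

Lemma cm_ge0 f l : cm f -> 0 <= f l.
Proof.
elim=> [c g c0 g0|{}f g _ f0 _ g0]; last exact: addr_ge0.
by rewrite !mulr_ge0 ?powR_ge0 ?expR_ge0.
Qed.

Lemma cm_scale a f : 0 <= a -> cm f -> cm (fun l => a * f l).
Proof.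
move=> a0; elim=> [c g c0 g0|{}f g _ cf _ cg].
  rewrite (_ : (fun _ => _) = fun l => (a * c) * l `^ (- g) * expR (- l `^ b)).
    by apply: cm_term => //; exact: mulr_ge0.
  by apply/funext => l; rewrite !mulrA.
rewrite (_ : (fun _ => _) = fun l => a * f l + a * g l); first exact: cm_add.
by apply/funext => l; rewrite mulrDr.
Qed.

(** Differentiating l^(-g) exp(- l^b) gives two nonpositive terms, with powers -(g + 1) and -(g + 1
    - b); the latter is again nonpositive because b < 1. *)
Lemma cm_derive f : cm f -> exists2 f', cm f' &
  forall l : R, 0 < l -> is_derive l 1 f (- f' l).
Proof.
elim=> [c g c0 g0|{}f g cf [f' cf' df] cg [g' cg' dg]]; last first.
  exists (fun l => f' l + g' l); first exact: cm_add.
  move=> l l0; rewrite opprD; apply: is_deriveD; [exact: df|exact: dg].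
exists (fun l => (c * g) * l `^ (- (g + 1)) * expR (- l `^ b) +
                 (c * b) * l `^ (- (g + 1 - b)) * expR (- l `^ b)).
  apply: cm_add; apply: cm_term; [exact: mulr_ge0|exact: addr_ge0| |].
    by rewrite mulr_ge0// ltW.
  by rewrite subr_ge0 ltW// (lt_le_trans b1)// lerDr.
move=> l l0; have l0' := gt_eqF l0.
have d1 := is_derive1_powR (- g) l0.
have d2 := @is_derive1_comp R expR (- (fun t : R => t `^ b)) l _ _
  (is_derive_expR _) (is_deriveN (is_derive1_powR b l0)).
have -> : (fun l0 : R => c * l0 `^ (- g) * expR (- l0 `^ b)) =
  (c \*: (fun t : R => t `^ (- g))) * (expR \o (- (fun t : R => t `^ b))) by [].
apply: is_derive_eq; rewrite /GRing.scale/=.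
have -> : (- (fun t : R => t `^ b)) l = - l `^ b by [].
have -> : l `^ (- (g + 1 - b)) = l `^ (- g) * l `^ (b - 1).
  by rewrite -powRD ?l0' ?implybT//; congr (_ `^ _); ring.
have -> : - (g + 1) = - g - 1 by ring.
rewrite -[c *: _]/(c * _); ring.
Qed.

Let comp_derive f f' (n q : R) : 0 < n -> q <= 1 ->
  (forall l : R, 0 < l -> is_derive l 1 f (- f' l)) ->
  is_derive q 1 (fun q => f (n^-1 + n * (1 - q))) (n * f' (n^-1 + n * (1 - q))).
Proof.
move=> n0 q1 df; have p0 : 0 < n^-1 + n * (1 - q).
  by rewrite ltr_pwDl ?invr_gt0// mulr_ge0 ?subr_ge0// ltW.
have da : is_derive q 1 (cst (n^-1 + n) - n \*: (@id R)) (- n).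
  by apply: is_derive_eq; rewrite /GRing.scale/= sub0r mulr1.
have e : (fun q => n^-1 + n * (1 - q)) = cst (n^-1 + n) - n \*: (@id R).
  apply/funext => t; transitivity (n^-1 + n - n * t); last by [].
  by ring.
have := @is_derive1_comp R f (fun q => n^-1 + n * (1 - q)) q _ _ (df _ p0).
rewrite e => /(_ _ da); rewrite -e => h.
by apply: is_derive_eq; rewrite mulrNN mulrC.
Qed.

(** The shift 1/n keeps the argument away from 0, where l^b is not differentiable, so the expansion
    is valid up to q = 1. The sign of the remainder at q = 1 bounds the sum of the weights, and the
    contraction inequality of [absolutely_monotone_taylor], taken at the point 1 with c = q, bounds
    the remainder by q^K. *)
Lemma taylor_stable (n : R) K : 0 < n -> exists2 w : nat -> R,
  (forall k, 0 <= w k) & \sum_(k < K) w k <= 1 /\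
  forall q, 0 <= q <= 1 ->
    0 <= expR (- (n^-1 + n * (1 - q)) `^ b) - \sum_(k < K) w k * q ^+ k <= q ^+ K.
Proof.
move=> n0; pose P phi := exists2 f, cm f & phi = fun q : R => f (n^-1 + n * (1 - q)).
have P0 phi : P phi -> forall q, 0 <= q <= 1 -> 0 <= phi q.
  by move=> [f cf ->] q _; exact: cm_ge0.
have Pd phi : P phi -> exists2 phi', P phi' &
    forall q : R, 0 <= q <= 1 -> is_derive q 1 phi (phi' q).
  move=> [f cf ->]; have [f' cf' df] := cm_derive cf.
  exists (fun q => n * f' (n^-1 + n * (1 - q))).
    by exists (fun l => n * f' l) => //; apply: cm_scale => //; exact: ltW.
  by move=> q /andP[q0 q1]; exact: comp_derive.
have Pf : P (fun q => expR (- (n^-1 + n * (1 - q)) `^ b)).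
  exists (fun l => 1 * l `^ (- 0) * expR (- l `^ b)); first exact: cm_term.
  by apply/funext => q; rewrite oppr0 powRr0 !mul1r.
have [w w0 hw] := absolutely_monotone_taylor P0 Pd K Pf.
have sw : \sum_(k < K) w k = \sum_(k < K) w k * 1 ^+ k.
  by apply: eq_bigr => k _; rewrite expr1n mulr1.
have z1 : 0 <= (1 : R) <= 1 by rewrite ler01 lexx.
have f1 : expR (- (n^-1 + n * (1 - 1)) `^ b) <= 1.
  by rewrite expR_le1 oppr_le0 powR_ge0.
have r1 : expR (- (n^-1 + n * (1 - 1)) `^ b) - \sum_(k < K) w k * 1 ^+ k <= 1.
  by rewrite (le_trans _ f1)// gerBl -sw sumr_ge0.
exists w => //; split.
  by have [] := hw _ _ z1 z1; rewrite subr_ge0 -sw => /le_trans + _; apply.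
move=> q q01; have [r0 _] := hw _ _ q01 z1; rewrite r0/=.
have [_] := hw _ _ z1 q01; rewrite mulr1 => /le_trans; apply.
by rewrite ler_piMr// exprn_ge0//; case/andP: q01.
Qed.

Let inv (n : nat) : R := n.+1%:R^-1.
Let del n : R := inv n `^ (1 - b).

Let inv_gt0 n : 0 < inv n. Proof. by rewrite invr_gt0. Qed.

Let cvg_inv : inv @ \oo --> (0 : R).
Proof. exact: cvg_harmonic. Qed.

Let cvg_del : del @ \oo --> (0 : R).
Proof.
have h0 : 0 < 1 - b by rewrite subr_gt0.
have /cvg_at_rightP := powR_cvg0 h0; apply.
by split; [exact: inv_gt0|exact: cvg_inv].
Qed.

Lemma expRN_bounds (u : R) : 0 <= u -> 1 - u <= expR (- u) <= 1 - u + u ^+ 2.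
Proof.
move=> u0; rewrite expR_ge1Dx/= expRN.
have p1 : 0 < 1 + u by rewrite ltr_wpDr.
rewrite (@le_trans _ _ (1 + u)^-1)//; first by rewrite lef_pV2 ?posrE ?expR_gt0// expR_ge1Dx.
rewrite -div1r ler_pdivrMr//.
have -> : (1 - u + u ^+ 2) * (1 + u) = 1 + u ^+ 3 by ring.
by rewrite lerDl exprn_ge0.
Qed.

Lemma stable_mixture : exists (K : nat -> nat) (w s : nat -> nat -> R),
  [/\ forall n k, 0 <= w n k, forall n k, 0 < s n k,
     forall n, \sum_(k < K n) w n k <= 1,
     forall n l, 0 <= l ->
       \sum_(k < K n) w n k * expR (- (s n k * l)) <= expR (- (l `^ b / 2)) &
     forall l, 0 < l ->
       \sum_(k < K n) w n k * expR (- (s n k * l)) @[n --> \oo] --> expR (- l `^ b)].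
Proof.
(* Truncation order chosen so that q^(K n) = exp(- (n+1) l), which vanishes in the limit for every l
   > 0. *)
pose K n := (n.+1 ^ 2)%N.
have /choice[w hw] (n : nat) : exists w : nat -> R, [/\ forall k, 0 <= w k,
    \sum_(k < K n) w k <= 1 & forall q, 0 <= q <= 1 ->
    0 <= expR (- (inv n + n.+1%:R * (1 - q)) `^ b) - \sum_(k < K n) w k * q ^+ k <= q ^+ K n].
  by have [w ? [? ?]] := @taylor_stable n.+1%:R (K n) (ltr0Sn _ _); exists w.
pose q n l : R := expR (- (l * inv n)).
pose u n l := inv n + n.+1%:R * (1 - q n l).
pose r n l := expR (- u n l `^ b) - \sum_(k < K n) w n k * q n l ^+ k.
have q01 n l : 0 <= l -> 0 <= q n l <= 1.
  by move=> l0; rewrite expR_ge0/= expR_le1 oppr_le0 mulr_ge0// ltW.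
have FE n l : \sum_(k < K n) w n k * expR (- ((k%:R * inv n + del n) * l)) =
    expR (- (del n * l)) * (expR (- u n l `^ b) - r n l).
  rewrite /r opprB addrC subrK mulr_sumr; apply: eq_bigr => k _.
  rewrite mulrCA; congr (_ * _); rewrite /q -expRM_natl -expRD; congr expR; ring.
have nl n : n.+1%:R * inv n = 1 by rewrite divff// pnatr_eq0.
(* The extra rate [del n] = (n+1)^(b-1) tends to 0. It makes the rate of the term k = 0 positive,
   and for l > n + 1, where u n l no longer grows linearly, it supplies the decay: del n * l >=
   l^b. *)
exists K, w, (fun n k => k%:R * inv n + del n); split.
- by move=> n k; have [] := hw n.
- by move=> n k; rewrite ltr_wpDl ?powR_gt0// mulr_ge0// ltW.
- by move=> n; have [] := hw n.
- move=> n l l0; rewrite FE.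
  have r0 : 0 <= r n l by have [_ _ /(_ _ (q01 n l l0))/andP[]] := hw n.
  apply: (@le_trans _ _ (expR (- (del n * l)) * expR (- u n l `^ b))).
    by rewrite ler_wpM2l ?expR_ge0// gerBl.
  rewrite -expRD ler_expR -opprD lerN2.
  (* For v = l / (n+1) <= 1 one has exp(- v) <= 1 / (1 + v) <= 1 - v / 2, hence u n l >= l / 2 and
     u^b >= l^b / 2. *)
  have [ln|nl'] := leP (l * inv n) 1.
    rewrite (@le_trans _ _ (u n l `^ b))//; last first.
      by rewrite lerDr mulr_ge0 ?powR_ge0.
    have hu : l / 2 <= u n l.
      have i0 := inv_gt0 n; rewrite /u.
      have : l * inv n / 2 <= 1 - q n l.
        rewrite /q; have v0 : 0 <= l * inv n by rewrite mulr_ge0// ltW.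
        move: (l * inv n) v0 ln => v v0 v1; have p1 : 0 < 1 + v by rewrite ltr_wpDr.
        have h1 : expR (- v) * (1 + v) <= 1.
          by rewrite expRN mulrC ler_pdivrMr ?expR_gt0// mul1r expR_ge1Dx.
        rewrite lerBrDr -lerBrDl -(ler_pM2r p1) (le_trans h1)//; nra.
      rewrite -(ler_pM2l (ltr0Sn R n)) => h.
      apply: (@le_trans _ _ (n.+1%:R * (1 - q n l))); last by rewrite lerDr ltW.
      rewrite (le_trans _ h)// [leRHS](_ : _ = n.+1%:R * inv n * (l / 2)).
        by rewrite nl mul1r.
      by ring.
    rewrite (@le_trans _ _ ((l / 2) `^ b))//; last first.
      by rewrite ge0_ler_powR ?nnegrE ?(ltW b0) ?(le_trans _ hu) ?divr_ge0.
    rewrite powRM// ler_wpM2l ?powR_ge0//.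
    by apply: ger1_powR; [apply/andP; split; lra|exact: ltW].
  rewrite (@le_trans _ _ (del n * l))//; last by rewrite lerDl powR_ge0.
  have lp : 0 < l.
    by rewrite lt_neqAle l0 andbT; apply: contraTneq nl' => <-; rewrite mul0r ltr10.
  have -> : l `^ b / 2 = 2^-1 * l `^ (b - 1) * l.
    by rewrite -mulrA [_ * l]mulrC mulr_powRB1// mulrC.
  rewrite ler_pM2r// (@le_trans _ _ (l `^ (b - 1)))//.
    by rewrite ler_piMl ?powR_ge0// invf_le1// ler1n.
  have -> : del n = n.+1%:R `^ (- (1 - b)).
    by rewrite /del /inv -powR_inv1// -powRrM mulN1r.
  rewrite (_ : b - 1 = - (1 - b)); last by ring.
  rewrite le_powRN ?subr_ge0 ?(ltW b1)//.
  by rewrite -(ler_pM2r (inv_gt0 n)) nl ltW.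
move=> l l0; under eq_cvg do rewrite FE.
have -> : expR (- l `^ b) = expR (- (0 * l)) * (expR (- l `^ b) - 0).
  by rewrite mul0r subr0 oppr0 expR0 mul1r.
have il0 : inv n * (l ^+ 2) @[n --> \oo] --> (0 : R).
  by rewrite -(mul0r (l ^+ 2)); apply: cvgMl; exact: cvg_inv.
have cu : u n l @[n --> \oo] --> l.
  rewrite -[X in _ --> X]add0r; apply: cvgD; first exact: cvg_inv.
  apply: (@squeeze_cvgr _ _ _ _ (fun n => l - inv n * l ^+ 2) (cst l)); last 2 first.
  - by rewrite -[X in _ --> X]subr0; apply: cvgB => //; exact: cvg_cst.
  - exact: cvg_cst.
  apply: nearW => n /=.
  have v0 : 0 <= l * inv n by rewrite mulr_ge0// ltW.
  have /andP[h1 h2] := expRN_bounds v0; have np : 0 < n.+1%:R :> R by [].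
  apply/andP; split.
    have -> : l - inv n * l ^+ 2 = n.+1%:R * (l * inv n - (l * inv n) ^+ 2).
      transitivity (n.+1%:R * inv n * (l - inv n * l ^+ 2)); last by ring.
      by rewrite nl mul1r.
    by rewrite ler_pM2l// /q; lra.
  rewrite [leRHS](_ : l = n.+1%:R * (l * inv n)); last by rewrite mulrCA nl mulr1.
  by rewrite ler_pM2l// /q; lra.
apply: cvgM.
  apply: (@continuous_cvg _ R R _ _ _ expR); first exact: continuous_expR.
  by apply: cvgN; apply: cvgMl; exact: cvg_del.
apply: cvgB.
  apply: (@continuous_cvg _ R R _ _ _ expR); first exact: continuous_expR.
  apply: cvgN; apply: (@continuous_cvg _ R R _ _ _ (fun y : R => y `^ b)) => //.
  apply/differentiable_continuous/derivable1_diffP.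
  by have [] := is_derive1_powR b l0.
apply: (@squeeze_cvgr _ _ _ _ (cst 0) (fun n => inv n * l^-1)); last 2 first.
- exact: cvg_cst.
- by rewrite -(mul0r l^-1); apply: cvgMl; exact: cvg_inv.
apply: nearW => n /=.
have [_ _ /(_ _ (q01 n l (ltW l0)))/andP[-> /= rq]] := hw n.
apply: (le_trans rq); rewrite /q /K -expRM_natl natrX.
have -> : n.+1%:R ^+ 2 * - (l * inv n) = - (n.+1%:R * l).
  transitivity (- (n.+1%:R * inv n * (n.+1%:R * l))); first by ring.
  by rewrite nl mul1r.
have nl0 : 0 < n.+1%:R * l by rewrite mulr_gt0.
rewrite expRN -invfM lef_pV2 ?posrE ?expR_gt0//.
by rewrite (le_trans _ (expR_ge1Dx _))// lerDr.
Qed.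

End stable_mixture.

(** * Two-sided bounds for the stable density *)

Section gaussian_profile.
Context {R : realType} {N : nat}.
Hypothesis N0 : (0 < N)%N.

Let pow1D_le (k : nat) (v : R) : 0 <= v -> (1 + v) ^+ k <= k`!%:R * expR 1 * expR v.
Proof. by move=> v0; rewrite -mulrA -expRD exprn_le_expR// addr_ge0. Qed.

(** With y = r/a, a^-N exp(- r^2 / (4 a^2)) is r^-N times the left-hand side. As 1 - exp(- y^-2) >=
    1 / (1 + y^2), it is enough to bound y^N (1 + y^2) exp(- y^2 / 4). *)
Lemma gauss_profile_ub : exists2 C : R, 0 < C & forall (y : R), 0 < y ->
  y ^+ N * expR (- (y ^+ 2 / 4)) <= C * (1 - expR (- y ^- 2)).
Proof.
exists (4 ^+ N.+1 * (N.+1`!%:R * expR 1)).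
  by rewrite !mulr_gt0 ?expR_gt0 ?ltr0n ?fact_gt0.
move=> y y0; have y2 : 0 < y ^+ 2 by rewrite exprn_gt0.
have h1 : (1 + y ^+ 2)^-1 <= 1 - expR (- y ^- 2).
  have z0 : 0 < y ^- 2 by rewrite invr_gt0.
  have -> : (1 + y ^+ 2)^-1 = 1 - (1 + y ^- 2)^-1.
    by field; rewrite !gt_eqF// ltr_wpDr// ltW.
  by rewrite lerB// expRN lef_pV2 ?posrE ?expR_gt0 ?expR_ge1Dx// ltr_wpDr// ltW.
apply: le_trans (ler_wpM2l _ h1); last first.
  by rewrite !mulr_ge0 ?expR_ge0.
rewrite ler_pdivlMr; last by rewrite ltr_wpDr// ltW.
apply: (@le_trans _ _ ((1 + y ^+ 2) ^+ N.+1 * expR (- (y ^+ 2 / 4)))).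
  rewrite [leLHS]mulrAC; apply: ler_wpM2r; first exact: expR_ge0.
  rewrite [(1 + y ^+ 2) ^+ N.+1]exprSr; apply: ler_wpM2r; first by rewrite addr_ge0// ltW.
  by apply: lerXn2r; rewrite ?nnegrE ?addr_ge0 ?(ltW y2) ?(ltW y0)//; nra.
rewrite expRN ler_pdivrMr ?expR_gt0//.
apply: (@le_trans _ _ ((4 * (1 + y ^+ 2 / 4)) ^+ N.+1)).
  by apply: lerXn2r; rewrite ?nnegrE ?mulr_ge0 ?addr_ge0 ?divr_ge0 ?(ltW y2)//; lra.
have v0 : 0 <= y ^+ 2 / 4 by rewrite divr_ge0// ltW.
by rewrite exprMn -[leRHS]mulrA ler_wpM2l ?exprn_ge0// pow1D_le.
Qed.

(** With q = exp(- y^-2) the combination is q (1 - q) (1 - q - e), and 1 - q <= y^-2 makes it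
    nonpositive for y^-2 <= e. Otherwise y^2 < 1/e keeps the Gaussian factor above exp(- 1 / (4e)),
    while q <= N! exp(1) y^N; the constant c is the quotient of these two. *)
Lemma gauss_profile_lb (e : R) : 0 < e -> exists2 c : R, 0 < c & forall (y : R), 0 < y ->
  c * ((1 - e) * expR (- y ^- 2) - (2 - e) * expR (- (2 * y ^- 2)) + expR (- (3 * y ^- 2)))
    <= y ^+ N * expR (- (y ^+ 2 / 4)).
Proof.
move=> e0; pose c := expR (- (e^-1 / 4)) / (N`!%:R * expR 1).
have c0 : 0 < c by rewrite divr_gt0 ?mulr_gt0 ?expR_gt0 ?ltr0n ?fact_gt0.
exists c => // y y0; have y2 : 0 < y ^+ 2 by rewrite exprn_gt0.
have z0 : 0 < y ^- 2 by rewrite invr_gt0.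
set z := y ^- 2 in z0 *; pose q := expR (- z).
have -> : expR (- (2 * z)) = q ^+ 2 by rewrite -mulrN expRM_natl.
have -> : expR (- (3 * z)) = q ^+ 3 by rewrite -mulrN expRM_natl.
rewrite -/q (_ : _ - _ + _ = q * (1 - q) * (1 - q - e)); last by ring.
have q0 : 0 < q by rewrite expR_gt0.
have q1 : q <= 1 by rewrite expR_le1 oppr_le0 ltW.
have [ze|ez] := leP z e.
  apply: (@le_trans _ _ 0); last by rewrite mulr_ge0 ?expR_ge0// exprn_ge0// ltW.
  rewrite pmulr_rle0// mulr_ge0_le0//; first by rewrite mulr_ge0 ?(ltW q0)// subr_ge0.
  by have := expR_ge1Dx (- z); rewrite -/q; lra.
apply: (@le_trans _ _ (c * q)).
  rewrite ler_wpM2l ?(ltW c0)// -mulrA ler_piMr ?(ltW q0)//.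
  have q1' : 0 <= 1 - q by rewrite subr_ge0.
  have : 0 <= (1 - q) * (q + e) by rewrite mulr_ge0// ltW// addr_gt0.
  lra.
have hy : y ^+ 2 <= e^-1.
  by rewrite -[y ^+ 2]invrK lef_pV2 ?posrE ?invr_gt0// ltW.
have qy : q <= N`!%:R * expR 1 * y ^+ N.
  rewrite -ler_pdivrMr ?exprn_gt0// -exprVn mulrC /q expRN ler_pdivrMr ?expR_gt0//.
  apply: (@le_trans _ _ ((1 + z) ^+ N)); last exact/pow1D_le/ltW.
  apply: lerXn2r; rewrite ?nnegrE ?addr_ge0 ?(ltW z0) ?invr_ge0 ?(ltW y0) ?(ltW y2)//.
  rewrite /z -exprVn; have : 0 < y^-1 by rewrite invr_gt0.
  by nra.
apply: (@le_trans _ _ (y ^+ N * expR (- (e^-1 / 4)))).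
  apply: (@le_trans _ _ (c * (N`!%:R * expR 1 * y ^+ N))).
    by rewrite ler_wpM2l// ltW.
  have M0 : N`!%:R * expR 1 != 0 :> R.
    by rewrite gt_eqF// mulr_gt0 ?expR_gt0 ?ltr0n ?fact_gt0.
  by rewrite mulrA /c divfK// mulrC.
by rewrite ler_wpM2l ?exprn_ge0 ?(ltW y0)// ler_expR lerN2 ler_pM2r.
Qed.

End gaussian_profile.

Section stable_density.
Context {R : realType} {N : nat} (th : R).
Hypothesis N0 : (0 < N)%N.
Hypothesis th02 : 0 < th < 2.
Implicit Types (x xi : 'rV[R]_N) (rho : R).
Local Notation mu := (lebesgue_rV R N).

Let b : R := th / 2.
Let th0 : 0 < th. Proof. by case/andP: th02. Qed.
Let b01 : 0 < b < 1. Proof. by rewrite /b; move: th02; lra. Qed.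

Definition stable rho x : R :=
  \int[mu]_xi (cos (dotp x xi) * expR (- (rho * enorm xi) `^ th)).

Lemma frac_kernel_stable rho x : 0 <= rho ->
  frac_kernel th x (rho `^ th) = (2 * pi) ^- N * stable rho x.
Proof.
move=> r0; rewrite /frac_kernel fundsolE; congr (_ * _).
by apply: eq_Rintegral => xi _; rewrite powRM// enorm_ge0.
Qed.

Lemma powR_half (y : R) : 0 <= y -> (y ^+ 2) `^ b = y `^ th.
Proof.
by move=> y0; rewrite -powR_mulrn// -powRrM /b mulrCA mulfV ?mulr1// pnatr_eq0.
Qed.

(** Provides the majorant, uniform in n, of the mixtures. As L + 1 >= 1/th, 1 + y <= 2 (1 + y^th)^(L
    + 1), which reduces to integer powers against an exponential. *)
Lemma expR_powR_decay k : exists2 C : R, 0 <= C & forall y, 0 <= y ->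
  expR (- (y `^ th / 2)) <= C * (1 + y) ^- k.
Proof.
pose L := Num.truncn th^-1; pose M := (L.+1 * k)%N.
have thL : th^-1 <= L.+1%:R by rewrite ltW// truncnS_gt.
exists (2 ^+ k * (2 ^+ M * (M`!%:R * expR 1))).
  by rewrite !mulr_ge0// expR_ge0.
move=> y y0; rewrite -[y in 1 + y](powRr1 y0).
have -> : y `^ 1 = (y `^ th) `^ th^-1 by rewrite -powRrM mulfV// gt_eqF.
have z0 := powR_ge0 y th; set z := y `^ th in z0 *.
have p1 : 0 < 1 + z `^ th^-1 by rewrite ltr_wpDr// powR_ge0.
have h : 1 + z `^ th^-1 <= 2 * (1 + z) ^+ L.+1.
  have h1 : z `^ th^-1 <= (1 + z) ^+ L.+1.
    rewrite (@le_trans _ _ ((1 + z) `^ th^-1))//.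
      by rewrite ge0_ler_powR ?invr_ge0 ?(ltW th0) ?nnegrE ?addr_ge0// lerDr.
    by rewrite -powR_mulrn ?addr_ge0// ler_powR// lerDl.
  have h2 : 1 <= (1 + z) ^+ L.+1 by rewrite exprn_ege1// lerDl.
  lra.
rewrite ler_pdivlMr ?exprn_gt0// expRN mulrC ler_pdivrMr ?expR_gt0//.
apply: (@le_trans _ _ ((2 * (1 + z) ^+ L.+1) ^+ k)).
  by apply: lerXn2r; rewrite ?nnegrE ?(ltW p1)// mulr_ge0// exprn_ge0// addr_ge0.
rewrite exprMn -exprM -/M -!mulrA ler_wpM2l ?exprn_ge0//.
apply: (@le_trans _ _ ((2 * (1 + z / 2)) ^+ M)).
  by apply: lerXn2r; rewrite ?nnegrE ?mulr_ge0 ?addr_ge0 ?divr_ge0//; lra.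
rewrite exprMn ler_wpM2l ?exprn_ge0// -expRD exprn_le_expR// addr_ge0// divr_ge0//.
Qed.

(* To be instantiated by stable_mixture. *)
Variables (K : nat -> nat) (w s : nat -> nat -> R).
Hypothesis w_ge0 : forall n k, 0 <= w n k.
Hypothesis s_gt0 : forall n k, 0 < s n k.
Hypothesis w_sum : forall n, \sum_(k < K n) w n k <= 1.
Let F n l := \sum_(k < K n) w n k * expR (- (s n k * l)).
Hypothesis F_ub : forall n l, 0 <= l -> F n l <= expR (- (l `^ b / 2)).
Hypothesis F_cvg : forall l, 0 < l -> F n l @[n --> \oo] --> expR (- l `^ b).

Definition approx n rho x : R := \sum_(k < K n) w n k * gauss (rho * Num.sqrt (s n k)) x.

Let F_ge0 n l : 0 <= F n l.
Proof. by apply: sumr_ge0 => k _; rewrite mulr_ge0// expR_ge0. Qed.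

Let mcos x : measurable_fun setT (fun xi => cos (dotp x xi)).
Proof.
by have := measurable_wave x 0; under eq_fun do rewrite addr0.
Qed.

Lemma Rintegral_bigsum k (f : nat -> 'rV[R]_N -> R) :
  (forall i, mu.-integrable setT (EFin \o f i)) ->
  \int[mu]_v (\sum_(i < k) f i v) = \sum_(i < k) \int[mu]_v f i v.
Proof.
move=> if_.
have is_ l : mu.-integrable setT (EFin \o (fun v => \sum_(i < l) f i v)).
  have := @integrable_sum _ _ _ mu setT measurableT _ (index_enum 'I_l) xpredT
    (fun i => EFin \o f i) (fun i _ => if_ i).
  by apply: eq_integrable => // v _ /=; rewrite sumEFin.
elim: k => [|k IH].
  rewrite big_ord0; under eq_Rintegral do rewrite big_ord0.
  by rewrite Rintegral_cst// mul0r.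
rewrite big_ord_recr /= -IH -RintegralD//.
by apply: eq_Rintegral => v _; rewrite big_ord_recr.
Qed.

Lemma approxE n rho x : 0 < rho ->
  approx n rho x = \int[mu]_xi (cos (dotp x xi) * F n ((rho * enorm xi) ^+ 2)).
Proof.
move=> r0; have a0 k : 0 < rho * Num.sqrt (s n k) by rewrite mulr_gt0 ?sqrtr_gt0.
have gaussE_ k : gauss (rho * Num.sqrt (s n k)) x =
    \int[mu]_xi (cos (dotp x xi) * expR (- (s n k * (rho * enorm xi) ^+ 2))).
  apply: eq_Rintegral => xi _; rewrite addr0 /gE mul1r expr1 -sqr_enorm enormZ.
  by rewrite gtr0_norm// mulrAC exprMn sqr_sqrtr ?(ltW (s_gt0 _ _))// [_ * s n k]mulrC.
have int_ k : mu.-integrable setT (EFin \o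
    (fun xi => cos (dotp x xi) * expR (- (s n k * (rho * enorm xi) ^+ 2)))).
  have := integrable_osc N0 (ltnSn 0) (polyfun_cst 1) (a0 k) (mcos x) (fun=> cos_max _).
  apply: eq_integrable => //= xi _; rewrite /gE mul1r expr1 -sqr_enorm enormZ.
  by rewrite gtr0_norm// mulrAC exprMn sqr_sqrtr ?(ltW (s_gt0 _ _))// [_ * s n k]mulrC.
pose g k xi := w n k * (cos (dotp x xi) * expR (- (s n k * (rho * enorm xi) ^+ 2))).
transitivity (\sum_(k < K n) \int[mu]_xi g k xi).
  by apply: eq_bigr => k _; rewrite gaussE_ RintegralZl.
rewrite -(@Rintegral_bigsum (K n) g); last by move=> k; exact: integrableZl_EFin.
by apply: eq_Rintegral => xi _; rewrite /F mulr_sumr; apply: eq_bigr => k _; rewrite /g mulrCA.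
Qed.

Lemma F_decay : exists2 C : R, 0 <= C & forall n rho x, 0 < rho ->
  F n ((rho * enorm x) ^+ 2) <= C * rho ^- N * decay 1 rho^-1 x.
Proof.
have [C C0 hC] := expR_powR_decay N.+1; exists C => // n rho x r0.
rewrite -mulrA -decay1Z// decay1E// mul1r enormZ gtr0_norm//.
have re0 : 0 <= rho * enorm x by rewrite mulr_ge0 ?enorm_ge0// ltW.
rewrite (le_trans (F_ub _ (sqr_ge0 _)))// powR_half//.
exact: hC.
Qed.

Let mF n rho : measurable_fun setT (fun xi => F n ((rho * enorm xi) ^+ 2)).
Proof.
apply: measurable_sum => k; apply: measurable_funM => //.
apply: (measurableT_comp (@measurable_expR R)); apply: measurable_funN.
apply: measurable_funM => //; apply: measurable_funX.
by apply: measurable_funM => //; exact: measurable_enorm.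
Qed.

Lemma approx_cvg rho x : 0 < rho -> approx n rho x @[n --> \oo] --> stable rho x.
Proof.
move=> r0; have [C C0 hC] := F_decay.
pose g xi := (C * rho ^- N * decay 1 rho^-1 xi).
have ig : mu.-integrable setT (EFin \o g).
  by apply: integrableZl_EFin; apply: integrable_decay1; rewrite ?invr_gt0.
pose f_ n xi := (cos (dotp x xi) * F n ((rho * enorm xi) ^+ 2)).
pose f xi := cos (dotp x xi) * expR (- (rho * enorm xi) `^ th).
have fg n xi : `|f_ n xi| <= g xi.
  rewrite normrM (ger0_norm (F_ge0 _ _)) (le_trans _ (hC n _ xi r0))//.
  by rewrite ler_piMl ?cos_max.
have mf_ n : measurable_fun setT (f_ n) by apply: measurable_funM.
have mf : measurable_fun setT f.
  apply: measurable_funM => //; apply: (measurableT_comp (@measurable_expR R)).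
  apply: measurable_funN; apply: measurable_powR_comp.
  by apply: measurable_funM => //; exact: measurable_enorm.
have [] := @dominated_convergence _ _ _ mu setT measurableT
  (fun n => EFin \o f_ n) (EFin \o f) (EFin \o g).
- by move=> n; exact/measurable_EFinP.
- exact/measurable_EFinP.
(* [F_cvg] leaves out l = 0, that is xi = 0: a degenerate box, null because N > 0. *)
- pose Z : set R := [set 0]; pose B : set 'rV[R]_N := [set v | forall i, Z (v ord0 i)].
  have mB : measurable B by apply: (@measurable_box_rV R N (fun=> Z)) => i; exact: measurable_set1.
  exists B; split => //.
    have muB : mu B = (\prod_(i < N) @lebesgue_measure R Z)%E.
      by apply: (@lebesgue_rV_box R N (fun=> Z)) => i; exact: measurable_set1.
    by rewrite [LHS]muB (bigD1 (Ordinal N0))//= lebesgue_measure_set1 mul0e.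
  move=> xi /= h i; apply: contrapT => xi0; apply: h => _.
  have p0 : 0 < rho * enorm xi.
    rewrite mulr_gt0// (lt_le_trans _ (coord_le_enorm i xi))// normr_gt0.
    by apply/eqP.
  apply: cvg_EFin; first by apply: nearW.
  rewrite /f -powR_half ?(ltW p0)//; apply: cvgMr.
  by apply: F_cvg; rewrite exprn_gt0.
- exact: ig.
- by apply: aeW => xi n _; rewrite /= lee_fin.
move=> iff _ h.
rewrite (_ : (fun n => approx n rho x) = fun n => \int[mu]_xi f_ n xi); last first.
  by apply/funext => n; rewrite approxE.
apply: fine_cvg; rewrite fineK//.
exact: (integrable_fin_num measurableT iff).
Qed.


Lemma stable_le_cst : exists2 C : R, 0 < C & forall rho x, 0 < rho ->
  stable rho x <= C * rho ^- N.
Proof.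
have [C C0 hC] := F_decay; have [D D0 hD] := integral_decay N0 (@ltr01 R).
exists (C * D + 1) => [|rho x r0]; first by rewrite ltr_wpDl// mulr_ge0// ltW.
have i0 : 0 < rho^-1 by rewrite invr_gt0.
apply: (@le_trans _ _ (C * D * rho ^- N)); last first.
  by rewrite ler_wpM2r ?lerDl// invr_ge0 exprn_ge0// ltW.
apply: (cvgr_to_le (@approx_cvg rho x r0)).
apply: nearW => n /=; rewrite approxE// (le_trans (ler_norm _))//.
apply: (@le_trans _ _ (\int[mu]_xi (C * rho ^- N * decay 1 rho^-1 xi))).
  apply: le_norm_Rintegral_dominated; first exact: measurable_funM.
    by apply: integrableZl_EFin; exact: integrable_decay1.
  move=> xi; rewrite normrM (ger0_norm (F_ge0 _ _)) (le_trans _ (hC n _ xi r0))//.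
  by rewrite ler_piMl ?cos_max.
rewrite RintegralZl//; last exact: integrable_decay1.
rewrite mulrAC ler_wpM2r ?invr_ge0 ?exprn_ge0 ?(ltW r0)// ler_wpM2l//.
rewrite -lee_fin /Rintegral fineK ?hD//.
exact: (integrable_fin_num measurableT (integrable_decay1 N0 i0)).
Qed.

Let gauss_scaled a x : 0 < a -> 0 < enorm x ->
  a ^- N * expR (- (dotp x x / (4 * a ^+ 2))) =
  enorm x ^- N * ((enorm x / a) ^+ N * expR (- ((enorm x / a) ^+ 2 / 4))).
Proof.
move=> a0 x0; rewrite [RHS]mulrA; congr (_ * _).
  by rewrite expr_div_n mulrA mulVf ?mul1r// expf_neq0// gt_eqF.
by congr (expR (- _)); rewrite -sqr_enorm; field; rewrite gt_eqF.
Qed.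

(** In the variable y = r/a of the profiles, with a = rho sqrt(s), exp(- k y^-2) becomes exp(- s (k
    l)) for l = (rho/r)^2, a term of F at k l. *)
Let sqr_scaled rho r n k : 0 < r ->
  (r / (rho * Num.sqrt (s n k))) ^- 2 = s n k * (rho / r) ^+ 2.
Proof.
move=> r0; rewrite -exprVn invf_div mulrAC exprMn sqr_sqrtr ?(ltW (s_gt0 _ _))//.
by rewrite mulrC.
Qed.

Let powR_ratio rho r : 0 < rho -> 0 < r -> ((rho / r) ^+ 2) `^ b = rho `^ th * r `^ (- th).
Proof.
move=> r0 p0; rewrite powR_half ?divr_ge0 ?(ltW r0) ?(ltW p0)//.
rewrite powRM ?invr_ge0 ?(ltW r0) ?(ltW p0)//.
by rewrite -[r^-1]powR_inv1 ?(ltW p0)// -powRrM mulN1r.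
Qed.

Let decayE rho r : 0 < r -> rho `^ th * r `^ (- (N%:R + th)) =
  r ^- N * (rho `^ th * r `^ (- th)).
Proof.
move=> r0; rewrite opprD powRD ?(gt_eqF r0) ?implybT// powR_invn ?(ltW r0)//.
by rewrite mulrCA.
Qed.

(** For |x| <= rho the profile is comparable to rho^-N and the uniform bound is enough. Beyond, the
    Gaussian bounds add up to at most 1 - F, whose limit 1 - exp(- l^b) <= l^b = (rho/|x|)^th has
    the right tail. *)
Lemma stable_ub : exists2 C : R, 0 < C & forall rho x, 0 < rho ->
  stable rho x <= C * decay th rho x.
Proof.
have [A A0 hA] := stable_le_cst; have [G G0 hG] := @gauss_ub R N N0.
have [P P0 hP] := @gauss_profile_ub R N.
have GP0 : 0 < G * P by rewrite mulr_gt0.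
pose M := N%:R + th; have M0 : 0 < M by rewrite ltr_wpDl.
exists ((A + G * P) * 2 `^ M) => [|rho x r0].
  by rewrite mulr_gt0 ?powR_gt0// addr_gt0.
have e0 := enorm_ge0 x; set r := enorm x in e0 *.
have rr : 0 < rho + r by rewrite ltr_wpDr.
have decay_lb (y : R) : 0 < y -> rho + r <= 2 * y ->
    rho `^ th * y `^ (- M) <= 2 `^ M * decay th rho x.
  move=> y0 ry; rewrite [leRHS]mulrCA ler_wpM2l ?powR_ge0//.
  rewrite -/M -/r -[y in leLHS](mulKf (_ : (2 : R) != 0)) ?pnatr_eq0//.
  rewrite powRM ?invr_ge0 ?mulr_ge0 ?(ltW y0)// -powR_inv1// -powRrM mulN1r opprK.
  by rewrite ler_wpM2l ?powR_ge0// le_powRN// ltW.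
have [rle|rlt] := leP r rho.
  apply: (@le_trans _ _ (A * (2 `^ M * decay th rho x))); last first.
    by rewrite mulrA ler_wpM2r ?decay_ge0// ler_wpM2r ?powR_ge0// lerDl ltW.
  rewrite (le_trans (hA _ _ r0))// ler_wpM2l ?(ltW A0)//.
  rewrite (le_trans _ (decay_lb rho r0 _))//; last by rewrite mulr_natl mulr2n lerD2l.
  rewrite decayE// powRN mulfV ?mulr1//.
  by rewrite gt_eqF// powR_gt0.
have p0 : 0 < r by rewrite (lt_trans r0).
apply: (@le_trans _ _ (G * P * (2 `^ M * decay th rho x))); last first.
  by rewrite mulrA ler_wpM2r ?decay_ge0// ler_wpM2r ?powR_ge0// lerDr ltW.
apply: (@le_trans _ _ (G * P * (rho `^ th * r `^ (- M)))); last first.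
  by rewrite ler_wpM2l ?(ltW GP0)// decay_lb// mulr_natl mulr2n lerD2r ltW.
rewrite decayE// -powR_ratio//; set l := (rho / r) ^+ 2.
have l0 : 0 < l by rewrite exprn_gt0// divr_gt0.
apply: (@le_trans _ _ (G * P * (r ^- N * (1 - expR (- l `^ b))))); last first.
  rewrite ler_wpM2l ?(ltW GP0)// ler_wpM2l ?invr_ge0 ?exprn_ge0//.
  by have := expR_ge1Dx (- l `^ b); lra.
have cv : G * P * (r ^- N * (1 - F n l)) @[n --> \oo] -->
    G * P * (r ^- N * (1 - expR (- l `^ b))).
  apply: cvgMr; apply: cvgMr; apply: cvgB; first exact: cvg_cst.
  exact: F_cvg.
apply: (ler_cvg_to (@approx_cvg rho x r0) cv); apply: nearW => n /=.
apply: (@le_trans _ _ (\sum_(k < K n) w n k * (G * P * (r ^- N * (1 - expR (- (s n k * l))))))).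
  apply: ler_sum => k _; rewrite ler_wpM2l//.
  have a0 : 0 < rho * Num.sqrt (s n k) by rewrite mulr_gt0 ?sqrtr_gt0.
  rewrite gaussE// (le_trans (ler_wpM2r (expR_ge0 _) (hG _ a0)))//.
  rewrite -[leLHS]mulrA gauss_scaled// -[leRHS]mulrA ler_wpM2l ?(ltW G0)//.
  rewrite [leRHS]mulrCA ler_wpM2l ?invr_ge0 ?exprn_ge0//.
  have := hP (r / (rho * Num.sqrt (s n k))); rewrite sqr_scaled// => -> //.
  by rewrite divr_gt0.
rewrite (eq_bigr (fun k : 'I_(K n) => G * P * r ^- N *
  (w n k - w n k * expR (- (s n k * l))))); last by move=> k _; ring.
(* The constant 1 of the profile adds up to the total weight, at most 1. *)
rewrite -mulr_sumr sumrB [leRHS]mulrA ler_wpM2l ?lerB//.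
  by rewrite mulr_ge0 ?(ltW GP0)// invr_ge0 exprn_ge0.
exact: w_sum.
Qed.


(** Mean value theorem on [1, 2] and [2, 3]: the derivative b t^(b - 1) is strictly decreasing since
    b < 1. *)
Lemma powR_strict_concave : 1 + 3 `^ b < 2 * 2 `^ b.
Proof.
have [b0 b1] := andP b01.
have cont (y z : R) : 0 < y -> {within `[y, z], continuous (fun t : R => t `^ b)}.
  move=> y0; apply: derivable_within_continuous => t; rewrite in_itv/= => /andP[yt _].
  by have [] := is_derive1_powR b (lt_le_trans y0 yt).
have der (y z : R) : 0 < y -> forall t, t \in `]y, z[ ->
    is_derive t 1 (fun t : R => t `^ b) (b * t `^ (b - 1)).
  move=> y0 t; rewrite in_itv/= => /andP[yt _].
  by apply: is_derive1_powR; rewrite (lt_trans y0).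
have [|c + ec] := @MVT R (fun t => t `^ b) (fun t => b * t `^ (b - 1)) 1 2 _
  (der 1 2 ltr01) (cont 1 2 ltr01); first by rewrite ltr1n.
have [|d + ed] := @MVT R (fun t => t `^ b) (fun t => b * t `^ (b - 1)) 2 3 _
  (der 2 3 (ltr0Sn _ _)) (cont 2 3 (ltr0Sn _ _)); first by rewrite ltr_nat.
rewrite !in_itv/= => /andP[d2 d3] /andP[c1 c2].
have c0 : 0 < c by rewrite (lt_trans ltr01).
have : d `^ (b - 1) < c `^ (b - 1).
  rewrite (_ : b - 1 = - (1 - b)); last by ring.
  rewrite !powRN ltf_pV2 ?posrE ?powR_gt0 ?(lt_trans c0 (lt_trans c2 d2))//.
  by rewrite gt0_ltr_powR ?subr_gt0 ?nnegrE ?(ltW c0)// ?(ltW (lt_trans c0 (lt_trans c2 d2)))//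
    (lt_trans c2 d2).
rewrite -(ltr_pM2l b0) => h.
move: ec ed; rewrite powR1; move: h.
set u := b * _; set v := b * _; set p := 2 `^ b; set q := 3 `^ b; lra.
Qed.

(** Constant terms cancel, and the first-order terms give k (D - (p - 1) D/2) >= k D/2 because p <=
    2. The second-order loss is at most 8 k^2, and k <= D/32 makes this at most k D/4. *)
Let exp_combination (p q D k : R) : 1 <= p <= 2 -> 1 <= q -> D = 2 * p - 1 - q -> 0 < D ->
  0 <= k <= D / 32 ->
  k * (D / 4) <= (1 - D / 2) * expR (- k) - (2 - D / 2) * expR (- (p * k)) + expR (- (q * k)).
Proof.
move=> /andP[p1 p2] q1 DE D0 /andP[k0 kD].
have h1 := expR_ge1Dx (- k); have h3 := expR_ge1Dx (- (q * k)).
have pk0 : 0 <= p * k by rewrite mulr_ge0// (le_trans ler01).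
have /andP[_ h2] := expRN_bounds pk0.
have D2 : D <= 2 by lra.
apply: (@le_trans _ _ ((1 - D / 2) * (1 - k) -
    (2 - D / 2) * (1 - p * k + (p * k) ^+ 2) + (1 - q * k))); last first.
  apply: lerD => //; apply: lerB; rewrite ler_wpM2l//; lra.
have pk2 : (p * k) ^+ 2 <= 4 * k ^+ 2.
  by rewrite exprMn ler_wpM2r ?sqr_ge0//; nra.
have f1 : (p - 1) * (k * (D / 2)) <= k * (D / 2).
  by rewrite ler_piMl ?mulr_ge0 ?divr_ge0 ?(ltW D0)//; lra.
have f2 : (2 - D / 2) * (p * k) ^+ 2 <= 2 * (4 * k ^+ 2).
  by rewrite ler_pM ?sqr_ge0//; lra.
have f3 : k ^+ 2 <= k * (D / 32) by rewrite expr2 ler_wpM2l.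
have -> : q = 2 * p - 1 - D by rewrite DE; ring.
move: f2; set S := (p * k) ^+ 2; lra.
Qed.

Let stable_lb_far : exists2 c : R, 0 < c & exists2 L : R, 1 <= L & forall rho x,
  0 < rho -> L * rho <= enorm x -> c * decay th rho x <= stable rho x.
Proof.
pose p := 2 `^ b : R; pose q := 3 `^ b : R; pose D := 2 * p - 1 - q.
have D0 : 0 < D by rewrite /D /p /q; have := powR_strict_concave; lra.
have [b0 b1] := andP b01.
have p12 : 1 <= p <= 2.
  apply/andP; split; first by rewrite -[leLHS](powRr0 2) ler_powR ?(ltW b0) ?ler1n.
  by rewrite -[leRHS]powRr1// ler_powR ?(ltW b1)// ler1n.
have q1 : 1 <= q by rewrite -[leLHS](powRr0 3) ler_powR ?(ltW b0)// ler1n.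
have D2 : D <= 2 by rewrite /D; move: p12; lra.
have [A A0 hA] := @gauss_lb R N N0.
(* The parameter e = D/2 is positive, yet leaves at least half of the first-order gain D. *)
have [c c0 hc] := @gauss_profile_lb R N (D / 2) (divr_gt0 D0 (ltr0Sn _ _)).
have Ac0 : 0 < A * c by rewrite mulr_gt0.
exists (A * c * (D / 4)); first by rewrite mulr_gt0// divr_gt0.
have D32 : 1 <= 32 / D by rewrite ler_pdivlMr//; lra.
(* Chosen so that |x| >= L rho forces (rho/|x|)^th <= D/32, the range of [exp_combination]. *)
exists ((32 / D) `^ th^-1).
  by rewrite -[leLHS](powRr0 (32 / D)) ler_powR// invr_ge0 ltW.
move=> rho x r0; set L := (32 / D) `^ th^-1 => Lx.
have L0 : 0 < L by rewrite powR_gt0// divr_gt0.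
have e0 : 0 < enorm x by rewrite (lt_le_trans _ Lx)// mulr_gt0.
set r := enorm x in Lx e0 *.
pose l := (rho / r) ^+ 2; have l0 : 0 < l by rewrite exprn_gt0// divr_gt0.
have kE : l `^ b = rho `^ th * r `^ (- th) by exact: powR_ratio.
have kD : 0 <= l `^ b <= D / 32.
  rewrite powR_ge0/= powR_half ?divr_ge0 ?(ltW r0) ?(ltW e0)//.
  have h : rho / r <= L^-1 by rewrite ler_pdivrMr// mulrC ler_pdivlMr// mulrC.
  rewrite (@le_trans _ _ ((L^-1) `^ th))//.
    by rewrite ge0_ler_powR ?nnegrE ?(ltW th0) ?invr_ge0 ?divr_ge0 ?(ltW L0) ?(ltW r0) ?(ltW e0).
  rewrite -powR_inv1 ?(ltW L0)// -powRrM mulN1r powRN /L -powRrM mulVf ?gt_eqF//.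
  by rewrite powRr1 ?divr_ge0 ?(ltW D0)// invf_div.
have dE : decay th rho x <= r ^- N * l `^ b.
  rewrite kE -decayE// ler_wpM2l ?powR_ge0// le_powRN ?lerDr ?(ltW r0)//.
  by rewrite addr_ge0// ltW.
apply: (@le_trans _ _ (A * c * (r ^- N * (l `^ b * (D / 4))))).
  rewrite [leRHS](_ : _ = A * c * (D / 4) * (r ^- N * l `^ b)); last by ring.
  by apply: ler_wpM2l => //; rewrite mulr_ge0 ?(ltW Ac0)// divr_ge0// ltW.
apply: (@le_trans _ _ (A * c * (r ^- N * ((1 - D / 2) * expR (- l `^ b) -
    (2 - D / 2) * expR (- (2 * l) `^ b) + expR (- (3 * l) `^ b))))).
  rewrite ler_wpM2l ?(ltW Ac0)// ler_wpM2l ?invr_ge0 ?exprn_ge0 ?(ltW e0)//.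
  rewrite (@powRM _ 2 l) ?(ltW l0)// (@powRM _ 3 l) ?(ltW l0)//.
  exact: (exp_combination p12 q1).
have cv : A * c * (r ^- N * ((1 - D / 2) * F n l - (2 - D / 2) * F n (2 * l) + F n (3 * l)))
    @[n --> \oo] --> A * c * (r ^- N * ((1 - D / 2) * expR (- l `^ b) -
    (2 - D / 2) * expR (- (2 * l) `^ b) + expR (- (3 * l) `^ b))).
  have cvF k : 0 < k -> F n (k * l) @[n --> \oo] --> expR (- (k * l) `^ b).
    by move=> k0; apply: F_cvg; exact: mulr_gt0.
  apply: cvgMr; apply: cvgMr; apply: cvgD; last exact: cvF.
  by apply: cvgB; apply: cvgMr; [exact: F_cvg|exact: cvF].
apply: (ler_cvg_to cv (@approx_cvg rho x r0)); apply: nearW => n /=.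
apply: (@le_trans _ _ (\sum_(k < K n) w n k * (A * c * (r ^- N *
  ((1 - D / 2) * expR (- (s n k * l)) - (2 - D / 2) * expR (- (2 * (s n k * l))) +
   expR (- (3 * (s n k * l)))))))).
  rewrite le_eqVlt; apply/orP; left; apply/eqP.
  rewrite /F !mulr_sumr -sumrB -big_split/= !mulr_sumr; apply: eq_bigr => k _.
  by rewrite ![s n k * (_ * l)]mulrCA; ring.
apply: ler_sum => k _; rewrite ler_wpM2l//.
have a0 : 0 < rho * Num.sqrt (s n k) by rewrite mulr_gt0 ?sqrtr_gt0.
rewrite gaussE// (le_trans _ (ler_wpM2r (expR_ge0 _) (hA _ a0)))//.
rewrite -[leRHS]mulrA gauss_scaled// -[leLHS]mulrA ler_wpM2l ?(ltW A0)//.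
rewrite [leLHS]mulrCA ler_wpM2l ?invr_ge0 ?exprn_ge0 ?(ltW e0)//.
have := hc (r / (rho * Num.sqrt (s n k))); rewrite sqr_scaled// => -> //.
by rewrite divr_gt0.
Qed.

(** Every Gaussian decreases with |x| and the weights are nonnegative. This carries the lower bound
    from the sphere |x| = L rho to its interior. *)
Let stable_antitone rho x x' : 0 < rho -> enorm x <= enorm x' ->
  stable rho x' <= stable rho x.
Proof.
move=> r0 xx; apply: (ler_cvg_to (@approx_cvg rho x' r0) (@approx_cvg rho x r0)).
apply: nearW => n; apply: ler_sum => k _; rewrite ler_wpM2l//.
have a0 : 0 < rho * Num.sqrt (s n k) by rewrite mulr_gt0 ?sqrtr_gt0.
rewrite gaussE// [leRHS]gaussE// ler_wpM2l//.
  have [A A0 hA] := @gauss_lb R N N0; rewrite (le_trans _ (hA _ a0))//.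
  by rewrite mulr_ge0 ?(ltW A0)// invr_ge0 exprn_ge0// ltW.
rewrite ler_expR lerN2; apply: ler_wpM2r; first by rewrite invr_ge0 mulr_ge0// sqr_ge0.
by rewrite -!sqr_enorm lerXn2r// nnegrE enorm_ge0.
Qed.

Lemma stable_lb : exists2 c : R, 0 < c & forall rho x, 0 < rho ->
  c * decay th rho x <= stable rho x.
Proof.
have [c c0 [L L1 h]] := stable_lb_far.
have L0 : 0 < L by rewrite (lt_le_trans ltr01).
pose M := N%:R + th; have M0 : 0 < M by rewrite ltr_wpDl.
have d0 : 0 < (1 + L) `^ (- M) by rewrite powR_gt0// addr_gt0.
exists (c * (1 + L) `^ (- M)) => [|rho x r0]; first by rewrite mulr_gt0.
have d1 : (1 + L) `^ (- M) <= 1.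
  rewrite powRN invf_le1 ?powR_gt0 ?addr_gt0//.
  by rewrite -[leLHS](powRr0 (1 + L)) ler_powR ?(ltW M0)// lerDl ltW.
have [Lx|xL] := leP (L * rho) (enorm x).
  apply: le_trans (h _ _ r0 Lx); rewrite ler_wpM2r ?decay_ge0//.
  by rewrite ler_piMr// ltW.
(* On the sphere of radius L rho the profile equals (1 + L)^(- M) rho^-N, hence is at least (1 +
   L)^(- M) times its value at x. *)
pose x' : 'rV[R]_N := (L * rho) *: delta_mx ord0 (Ordinal N0).
have x'E : enorm x' = L * rho.
  by rewrite enormZ enorm_delta mulr1 ger0_norm// mulr_ge0// ltW.
apply: (@le_trans _ _ (stable rho x')); last first.
  by apply: stable_antitone => //; rewrite x'E ltW.
apply: le_trans (h _ x' r0 _); last by rewrite x'E.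
rewrite -mulrA ler_wpM2l ?(ltW c0)// /decay x'E -/M mulrCA ler_wpM2l ?powR_ge0//.
rewrite -[X in X + L * rho]mul1r -mulrDl powRM ?addr_ge0 ?(ltW L0) ?(ltW r0)//.
rewrite [leRHS]mulrC [leLHS]mulrC ler_wpM2r ?(ltW d0)//.
by rewrite le_powRN ?(ltW M0)// lerDl enorm_ge0.
Qed.

Lemma measurable_stable rho : 0 < rho -> measurable_fun setT (stable rho).
Proof.
move=> r0; apply: (@measurable_fun_cvg _ _ _ _ (fun n x => approx n rho x)); last first.
  by move=> x _; exact: approx_cvg.
move=> n; rewrite /approx; apply: measurable_sum => k; apply: measurable_funM => //.
have a0 : 0 < rho * Num.sqrt (s n k) by rewrite mulr_gt0 ?sqrtr_gt0.
have -> : @gauss R N (rho * Num.sqrt (s n k)) = fun x =>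
    @gauss R N (rho * Num.sqrt (s n k)) 0 *
    expR (- (dotp x x / (4 * (rho * Num.sqrt (s n k)) ^+ 2))).
  by apply/funext => x; exact: gaussE.
apply: measurable_funM => //; apply: (measurableT_comp (@measurable_expR R)).
apply: measurable_funN; apply: measurable_funM => //.
by apply: measurable_polyfun; exact: polyfun_dotp.
Qed.

End stable_density.

(** * Convolutions and potentials *)

Section kernel_estimates.
Context {R : realType} {N : nat} (th : R).
Hypothesis N0 : (0 < N)%N.
Hypothesis th02 : 0 < th < 2.
Implicit Types (x y : 'rV[R]_N) (rho : R).
Local Notation mu := (lebesgue_rV R N).

Let th0 : 0 < th. Proof. by case/andP: th02. Qed.

Lemma frac_kernel_bounds : exists c C : R, [/\ 0 < c, 0 < C,
  forall rho, 0 < rho -> measurable_fun setT (fun x => frac_kernel th x (rho `^ th)) &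
  forall rho x, 0 < rho ->
    c * decay th rho x <= frac_kernel th x (rho `^ th) <= C * decay th rho x].
Proof.
have b01 : 0 < th / 2 < 1 by move: th02; lra.
have [K [w [s [w0 s0 w1 Fub Fcv]]]] := stable_mixture b01.
have [c c0 hc] := stable_lb N0 th02 w0 s0 Fub Fcv.
have [C C0 hC] := stable_ub N0 th02 w0 s0 w1 Fub Fcv.
have p0 : 0 < (2 * pi) ^- N :> R by rewrite invr_gt0 exprn_gt0// mulr_gt0// pi_gt0.
exists ((2 * pi) ^- N * c), ((2 * pi) ^- N * C); split; [exact: mulr_gt0|exact: mulr_gt0| |].
  move=> rho r0; under eq_fun do rewrite (frac_kernel_stable _ _ (ltW r0)).
  apply: measurable_funM => //.
  exact: (measurable_stable N0 th02 w0 s0 Fub Fcv).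
move=> rho x r0; rewrite (frac_kernel_stable _ _ (ltW r0)).
rewrite -!mulrA; apply/andP; split; apply: ler_wpM2l; rewrite ?(ltW p0)//.
  exact: hc.
exact: hC.
Qed.

Lemma decay_le_rhoN rho x : 0 < rho -> decay th rho x <= rho ^- N.
Proof.
move=> r0; rewrite /decay.
have -> : rho ^- N = rho `^ th * rho `^ (- (N%:R + th)).
  rewrite -powRD ?(gt_eqF r0) ?implybT// -powR_invn ?(ltW r0)//.
  by congr (_ `^ _); ring.
by rewrite ler_wpM2l ?powR_ge0// le_powRN ?addr_ge0 ?(ltW th0)// lerDl enorm_ge0.
Qed.

(* One of r1 + |x|, r2 + |y| is at least half of rho + |x + y|. *)
Lemma decay_mul r1 r2 rho x y : 0 < r1 <= rho -> 0 < r2 <= rho -> rho <= r1 + r2 ->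
  decay th r1 x * decay th r2 y <=
  2 `^ (N%:R + th) * decay th rho (x + y) * (decay th r1 x + decay th r2 y).
Proof.
move=> /andP[r10 r1r] /andP[r20 r2r] rr; pose M := N%:R + th.
have M0 : 0 <= M by rewrite addr_ge0// ltW.
have r0 : 0 < rho by rewrite (lt_le_trans r10).
have e := enormD x y; have ex := enorm_ge0 x; have ey := enorm_ge0 y.
have exy := enorm_ge0 (x + y).
have key (r : R) (z : 'rV[R]_N) : 0 < r <= rho -> rho + enorm (x + y) <= 2 * (r + enorm z) ->
    decay th r z <= 2 `^ M * decay th rho (x + y).
  move=> /andP[p0 pr] h; rewrite /decay -/M mulrCA.
  rewrite ler_pM ?powR_ge0//.
    by rewrite ge0_ler_powR ?nnegrE ?(ltW th0) ?(ltW p0) ?(ltW r0).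
  have -> : 2 `^ M = (2^-1) `^ (- M) :> R by rewrite -powR_inv1// -powRrM mulrNN mul1r.
  rewrite -powRM ?invr_ge0 ?addr_ge0 ?(ltW r0)//.
  by rewrite le_powRN ?mulr_gt0 ?invr_gt0 ?ltr_wpDr//; lra.
have [h|h] := leP (rho + enorm (x + y)) (2 * (r1 + enorm x)).
  have := key r1 x; rewrite r10 r1r => /(_ isT h) k.
  rewrite mulrDr ler_wpDl ?mulr_ge0 ?powR_ge0 ?decay_ge0//.
  by rewrite ler_wpM2r ?decay_ge0.
have := key r2 y; rewrite r20 r2r => /(_ isT) k.
rewrite mulrDr ler_wpDr ?mulr_ge0 ?powR_ge0 ?decay_ge0// mulrC.
by rewrite ler_wpM2r ?decay_ge0// k//; lra.
Qed.

Lemma measurable_subr_rV x : measurable_fun setT (fun y => x - y).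
Proof.
rewrite (_ : (fun y => _) = (fun y => - y + x)).
  exact: (measurableT_comp (measurable_addr_rV x) (@measurable_oppr_rV R N)).
by apply/funext => y; rewrite addrC.
Qed.

Lemma measurable_decay_sub x rho : measurable_fun setT (fun y => decay th rho (x - y)).
Proof. exact: (measurableT_comp (measurable_decay _ _) (measurable_subr_rV x)). Qed.

(** Integrating [decay_mul] leaves two integrals of profiles, each bounded independently of its
    scale. *)
Lemma decay_convolution : exists2 C : R, 0 < C & forall r1 r2 rho x,
  0 < r1 <= rho -> 0 < r2 <= rho -> rho <= r1 + r2 ->
  (\int[mu]_y (decay th r1 (x - y) * decay th r2 y)%:E <= (C * decay th rho x)%:E)%E.
Proof.
have [D D0 hD] := integral_decay N0 th0.
exists (2 `^ (N%:R + th) * (D + D)).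
  by rewrite mulr_gt0 ?powR_gt0 ?addr_gt0.
move=> r1 r2 rho x h1 h2 h12; have [r10 _] := andP h1; have [r20 _] := andP h2.
pose k := 2 `^ (N%:R + th) * decay th rho x.
have k0 : 0 <= k by rewrite mulr_ge0 ?powR_ge0 ?decay_ge0.
have m1 : measurable_fun setT (fun y => (decay th r1 (x - y))%:E).
  by apply/measurable_EFinP; exact: measurable_decay_sub.
have m2 : measurable_fun setT (fun y : 'rV[R]_N => (decay th r2 y)%:E).
  by apply/measurable_EFinP; exact: measurable_decay.
apply: (@le_trans _ _ (\int[mu]_y (k%:E * ((decay th r1 (x - y))%:E + (decay th r2 y)%:E))))%E.
  apply: ge0_le_integral => //.
  - by move=> y _; rewrite lee_fin mulr_ge0 ?decay_ge0.
  - apply/measurable_EFinP; apply: measurable_funM; first exact: measurable_decay_sub.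
    exact: measurable_decay.
  - by apply: emeasurable_funM => //; exact: emeasurable_funD.
  - move=> y _; rewrite -EFinD -EFinM lee_fin.
    by have := @decay_mul r1 r2 rho (x - y) y h1 h2 h12; rewrite subrK.
rewrite ge0_integralZl//; last 2 first.
- exact: emeasurable_funD.
- by move=> y _; rewrite adde_ge0// lee_fin decay_ge0.
rewrite ge0_integralD//; last 2 first.
- by move=> y _; rewrite lee_fin decay_ge0.
- by move=> y _; rewrite lee_fin decay_ge0.
rewrite (ge0_integral_rVB x (f := fun v => (decay th r1 v)%:E)); last 2 first.
- by apply/measurable_EFinP; exact: measurable_decay.
- by move=> y; rewrite lee_fin decay_ge0.
rewrite (@le_trans _ _ (k%:E * (D%:E + D%:E))%E)//.
  by rewrite lee_wpmul2l// leeD// hD.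
by rewrite -EFinD -EFinM lee_fin /k mulrAC.
Qed.

End kernel_estimates.

Section sigma_finite_copy.
Context d (T : measurableType d) (R : realType) (mu : {measure set T -> \bar R}).
Hypothesis sf : sigma_finite setT mu.

(* mu, repackaged as a sigma-finite measure so that Tonelli's theorem applies. *)
Definition sigma_finite_copy (_ : sigma_finite setT mu) : set T -> \bar R := mu.

HB.instance Definition _ := isMeasure.Build _ _ _ (sigma_finite_copy sf)
  (measure0 mu) (measure_ge0 mu) (@measure_semi_sigma_additive _ _ _ mu).

HB.instance Definition _ := Measure_isSigmaFinite.Build _ _ _ (sigma_finite_copy sf) sf.

End sigma_finite_copy.

(** * Potentials of Radon measures *)

Section radon_potential.
Context {R : realType} {N : nat} (th : R).
Hypothesis N0 : (0 < N)%N.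
Hypothesis th0 : 0 < th.
Implicit Types (x y z : 'rV[R]_N) (rho : R).
Local Notation leb := (lebesgue_rV R N).

Lemma radon_sigma_finite (mu : {measure set 'rV[R]_N -> \bar R}) :
  radon mu -> sigma_finite setT mu.
Proof.
move=> [mu_compact _].
exists (fun k => [set v : 'rV[R]_N | forall i, `[- k%:R, k%:R]%classic (v ord0 i)]).
  apply/seteqP; split=> // v _.
  exists (Num.truncn (enorm v)).+1 => // i /=.
  rewrite in_itv/= -ler_norml (le_trans (coord_le_enorm i v))//.
  by rewrite ltW// truncnS_gt.
move=> k; split.
  apply: (@measurable_box_rV R N (fun=> `[- k%:R, k%:R]%classic)) => i.
  exact: measurable_itv.
apply: mu_compact.
have h := @rV_compact R N (fun=> `[- k%:R, k%:R]%classic).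
by apply: h => i; exact: segment_compact.
Qed.

Lemma measurable_eball_pair rho :
  measurable [set p : 'rV[R]_N * 'rV[R]_N | enorm (p.2 - p.1) < rho].
Proof.
have mf : measurable_fun setT (fun p : 'rV[R]_N * 'rV[R]_N => enorm (p.2 - p.1)).
  apply: (measurableT_comp (@measurable_enorm R N)).
  apply/measurable_fun_rVP => i; under eq_fun do rewrite !mxE.
  apply: measurable_funB.
  - exact: (measurableT_comp (measurable_coord_rV i) measurable_snd).
  - exact: (measurableT_comp (measurable_coord_rV i) measurable_fst).
rewrite (_ : mkset _ =
    (fun p : 'rV[R]_N * 'rV[R]_N => enorm (p.2 - p.1)) @^-1` `]-oo, rho[%classic).
  by rewrite -[X in measurable X]setTI; apply: mf => //; exact: measurable_itv.
by apply/seteqP; split=> p /=; rewrite in_itv.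
Qed.

Lemma measurable_eball z rho : measurable (eball z rho).
Proof.
have mf : measurable_fun setT (fun y : 'rV[R]_N => enorm (z - y)).
  exact: (measurableT_comp (@measurable_enorm R N) (measurable_subr_rV z)).
rewrite (_ : eball z rho = (fun y => enorm (z - y)) @^-1` `]-oo, rho[%classic).
  by rewrite -[X in measurable X]setTI; apply: mf => //; exact: measurable_itv.
by apply/seteqP; split=> p /=; rewrite in_itv.
Qed.

(** The cube of side rho/N centred at z lies in the ball, since the norm is at most the sum of the
    coordinates, here at most rho/2. *)
Lemma lebesgue_eball_ge z rho : 0 < rho ->
  (((rho / N%:R) ^+ N)%:E <= leb (eball z rho))%E.
Proof.
move=> r0; pose h := rho / (2 * N%:R).
have N0' : 0 < N%:R :> R by rewrite ltr0n.
have h0 : 0 < h by rewrite divr_gt0// mulr_gt0.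
pose A i : set R := `[z ord0 i - h, z ord0 i + h]%classic.
pose B : set 'rV[R]_N := [set v | forall i, A i (v ord0 i)].
have mB : measurable B by apply: (@measurable_box_rV R N A) => i; exact: measurable_itv.
have muB : leb B = (\prod_(i < N) @lebesgue_measure R (A i))%E.
  by apply: (@lebesgue_rV_box R N A) => i; exact: measurable_itv.
have -> : ((rho / N%:R) ^+ N)%:E = leb B.
  rewrite [RHS]muB (eq_bigr (fun=> (rho / N%:R)%:E)).
    by rewrite prodEFin prodr_const card_ord.
  move=> i _; rewrite /A lebesgue_measure_itv/= lte_fin ltrBlDr -addrA ltrDl addr_gt0//.
  by rewrite -EFinB; congr EFin; rewrite /h; field; rewrite gt_eqF.
apply: le_measure; rewrite ?inE//; first exact: measurable_eball.
move=> v Bv; rewrite /eball /= (le_lt_trans (enorm_le_sum _))//.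
apply: (@le_lt_trans _ _ (\sum_(i < N) h)).
  apply: ler_sum => i _; rewrite !mxE.
  have := Bv i; rewrite /A /= in_itv/= => /andP[h1 h2].
  by rewrite ler_distl; lra.
rewrite sumr_const card_ord -[X in X < _]mulr_natr /h.
rewrite (_ : rho / (2 * N%:R) * N%:R = rho / 2); last by field; rewrite gt_eqF.
by lra.
Qed.

(** If |y - z| < rho then rho + |x - z| <= 2 (rho + |x - y|), so moving from y to z costs at most a
    factor 2^M, and the ball has volume at least (rho/N)^N. *)
Lemma decay_average : exists2 C : R, 0 < C & forall rho x y, 0 < rho ->
  ((decay th rho (x - y))%:E <=
    (C * rho ^- N)%:E * \int[leb]_(z in eball y rho) (decay th rho (x - z))%:E)%E.
Proof.
pose M := N%:R + th; have M0 : 0 <= M by rewrite addr_ge0// ltW.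
have N0' : 0 < N%:R :> R by rewrite ltr0n.
exists (2 `^ M * N%:R ^+ N) => [|rho x y r0].
  by rewrite mulr_gt0 ?powR_gt0 ?exprn_gt0.
have lb z : eball y rho z -> 2 `^ (- M) * decay th rho (x - y) <= decay th rho (x - z).
  rewrite /eball /= => yz; rewrite /decay mulrCA ler_wpM2l ?powR_ge0//.
  have e := enormD (x - y) (y - z); rewrite addrA subrK in e.
  have e0 := enorm_ge0 (x - y); have e1 := enorm_ge0 (x - z).
  rewrite -powRM ?addr_ge0 ?(ltW r0)// le_powRN ?ltr_wpDr//; lra.
apply: (@le_trans _ _ ((2 `^ M * N%:R ^+ N * rho ^- N)%:E *
  \int[leb]_(z in eball y rho) (2 `^ (- M) * decay th rho (x - y))%:E)%E).
  rewrite integral_cst; last exact: measurable_eball.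
  apply: (@le_trans _ _ ((2 `^ M * N%:R ^+ N * rho ^- N)%:E *
    ((2 `^ (- M) * decay th rho (x - y))%:E * ((rho / N%:R) ^+ N)%:E))%E).
    rewrite -!EFinM lee_fin powRN expr_div_n le_eqVlt; apply/orP; left; apply/eqP.
    by field; rewrite !gt_eqF ?exprn_gt0 ?powR_gt0.
  apply: lee_wpmul2l.
    by rewrite lee_fin !mulr_ge0 ?powR_ge0 ?exprn_ge0 ?invr_ge0 ?exprn_ge0// ltW.
  apply: lee_wpmul2l; first by rewrite lee_fin mulr_ge0 ?powR_ge0 ?decay_ge0.
  exact: lebesgue_eball_ge.
apply: lee_wpmul2l.
  by rewrite lee_fin !mulr_ge0 ?powR_ge0 ?exprn_ge0 ?invr_ge0 ?exprn_ge0// ltW.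
apply: ge0_le_integral => //.
- exact: measurable_eball.
- by move=> z _; rewrite lee_fin mulr_ge0 ?powR_ge0 ?decay_ge0.
- by apply/measurable_EFinP; apply: measurable_funTS; exact: measurable_decay_sub.
Qed.

(** Bounding the profile at y by its average over the ball B(y, rho) and exchanging the integrals
    makes mu enter only through mu(B(z, rho)); what remains is the integral of one profile in z. *)
Lemma decay_potential : exists2 C : R, 0 < C &
  forall rho x (mu : {measure set 'rV[R]_N -> \bar R}), 0 < rho -> radon mu ->
  (\int[mu]_y (decay th rho (x - y))%:E <=
   (C * rho ^- N)%:E * ereal_sup [set mu (eball z rho) | z in setT])%E.
Proof.
have [A A0 hA] := decay_average; have [D D0 hD] := integral_decay N0 th0.
exists (A * D) => [|rho x mu r0 rmu]; first exact: mulr_gt0.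
have sf := radon_sigma_finite rmu.
pose mu' : {sigma_finite_measure set 'rV[R]_N -> \bar R} := sigma_finite_copy sf.
set S := ereal_sup _.
have S0 : (0 <= S)%E.
  by apply: (@le_trans _ _ (mu (eball 0 rho))) => //; apply: ereal_sup_ubound; exists 0.
(* A symmetric relation: its slices in either variable are balls of radius rho. *)
pose B := [set p : 'rV[R]_N * 'rV[R]_N | enorm (p.2 - p.1) < rho].
pose g (p : 'rV[R]_N * 'rV[R]_N) : \bar R :=
  ((decay th rho (x - p.2)) * \1_B p)%:E.
have g0 p : (0 <= g p)%E by rewrite lee_fin mulr_ge0 ?decay_ge0.
have mg : measurable_fun setT g.
  apply/measurable_EFinP; apply: measurable_funM.
    exact: (measurableT_comp (measurable_decay_sub _ _ _) measurable_snd).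
  by apply: measurable_indic; exact: measurable_eball_pair.
have BE y z : \1_B (y, z) = \1_(eball y rho) z :> R.
  rewrite !indicE (_ : ((y, z) \in B) = (z \in eball y rho))//.
  by apply/idP/idP; rewrite !inE /B /eball /= -opprB enormN.
have BE' y z : \1_B (y, z) = \1_(eball z rho) y :> R.
  by rewrite !indicE (_ : ((y, z) \in B) = (y \in eball z rho)).
have sliceE y : (\int[leb]_(z in eball y rho) (decay th rho (x - z))%:E =
    \int[leb]_z g (y, z))%E.
  rewrite integral_mkcond; apply: eq_integral => z _.
  by rewrite /g BE patchE indicE; case: ifP => _ /=; rewrite ?mulr1 ?mulr0.
have slice2E z : (\int[mu]_y g (y, z) = (decay th rho (x - z))%:E * mu (eball z rho))%E.
  have me := measurable_eball z rho.
  under eq_integral do rewrite /g BE' /= EFinM.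
  rewrite ge0_integralZl ?lee_fin ?decay_ge0//;
    last exact/measurable_EFinP/measurable_indic.
  by rewrite integral_indic// setIT.
have CR0 : (0 <= (A * rho ^- N)%:E)%E.
  by rewrite lee_fin mulr_ge0 ?(ltW A0)// invr_ge0 exprn_ge0// ltW.
apply: (@le_trans _ _ (\int[mu]_y ((A * rho ^- N)%:E * \int[leb]_z g (y, z)))%E).
  apply: ge0_le_integral => //.
  - by move=> y _; rewrite lee_fin decay_ge0.
  - by apply/measurable_EFinP; exact: measurable_decay_sub.
  - apply: emeasurable_funM => //.
    exact: (@measurable_fun_fubini_tonelli_F _ _ _ _ _ leb g mg g0).
  - by move=> y _; rewrite -sliceE; exact: hA.
rewrite ge0_integralZl//; last 2 first.
- exact: (@measurable_fun_fubini_tonelli_F _ _ _ _ _ leb g mg g0).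
- by move=> y _; exact: integral_ge0.
rewrite (@fubini_tonelli _ _ _ _ _ mu' leb g mg g0).
have -> : (A * D * rho ^- N)%:E = ((A * rho ^- N)%:E * D%:E)%E.
  by rewrite -EFinM mulrAC.
rewrite -muleA; apply: lee_wpmul2l => //.
apply: (@le_trans _ _ (\int[leb]_z (S * (decay th rho (x - z))%:E))%E).
  apply: ge0_le_integral => //.
  - by move=> z _; apply: integral_ge0.
  - exact: (@measurable_fun_fubini_tonelli_G _ _ _ _ _ mu' g mg g0).
  - apply: emeasurable_funM => //; apply/measurable_EFinP; exact: measurable_decay_sub.
  - move=> z _; rewrite slice2E muleC lee_wpmul2r ?lee_fin ?decay_ge0//.
    by apply: ereal_sup_ubound; exists z.
rewrite ge0_integralZl//; last 2 first.
- by apply/measurable_EFinP; exact: measurable_decay_sub.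
- by move=> z _; rewrite lee_fin decay_ge0.
rewrite (ge0_integral_rVB x (f := fun v => (decay th rho v)%:E)); last 2 first.
- by apply/measurable_EFinP; exact: measurable_decay.
- by move=> z; rewrite lee_fin decay_ge0.
by rewrite [leRHS]muleC lee_wpmul2l// hD.
Qed.

End radon_potential.

(** * Derivatives of G_m against the decay profile, and the estimates for K *)

Lemma mpartial_poly_kernel_bound (R : realType) (N m : nat) (th : R) (j : nat) :
  (0 < N)%N -> (0 < m)%N -> th <= 2 -> exists2 C : R, 0 <= C &
  forall (rho : R) (x : 'rV[R]_N) (alpha : {ffun 'I_N -> nat}), 0 < rho ->
    (\sum_(i < N) alpha i)%N = j ->
    `|mpartial alpha (fun y => poly_kernel m y (rho ^+ (2 * m))) x| <=
      C * rho ^- j * decay th rho x.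
Proof.
move=> N0 m0 th2; have p0 : 0 < (2 * pi) ^- N :> R.
  by rewrite invr_gt0 exprn_gt0// mulr_gt0// pi_gt0.
(* One constant must serve all alpha of order j. Their entries are at most j, so they are encoded in
   a finite type, over which the constants are summed. *)
pose nat_of (beta : {ffun 'I_N -> 'I_j.+1}) : {ffun 'I_N -> nat} := [ffun i => beta i : nat].
have /choice[C hC] (beta : {ffun 'I_N -> 'I_j.+1}) : exists C : R, 0 <= C /\
    forall a phi x, 0 < a -> `|osc m (monomial (nat_of beta) (enum 'I_N)) a phi x|
       <= C * decay th a x.
  by have [C ? ?] := osc_decay N0 m0 (polyfun_monomial (nat_of beta) (enum 'I_N)) th2; exists C.
exists ((2 * pi) ^- N * \sum_beta C beta).
  by rewrite mulr_ge0 ?(ltW p0)// sumr_ge0// => beta _; have [] := hC beta.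
move=> rho x alpha r0 aj.
pose beta : {ffun 'I_N -> 'I_j.+1} := [ffun i => inord (alpha i)].
have betaE : nat_of beta = alpha.
  apply/ffunP => i; rewrite !ffunE inordK// ltnS -aj.
  by rewrite (bigD1 i)//= leq_addr.
have -> : (fun y => poly_kernel m y (rho ^+ (2 * m))) =
    (fun y : 'rV[R]_N => (2 * pi) ^- N * osc m (cst 1) rho 0 y).
  by apply/funext => y; rewrite poly_kernel_osc// ltW.
have [psi ->] := mpartial_osc N0 alpha ((2 * pi) ^- N) 0 m0 r0.
rewrite aj normrM ger0_norm; last first.
  by rewrite mulr_ge0 ?(ltW p0)// invr_ge0 exprn_ge0// ltW.
have [Cb0 /(_ rho psi x r0)] := hC beta; rewrite betaE => h.
rewrite [leRHS](_ : _ = (2 * pi) ^- N * rho ^- j *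
  ((\sum_beta0 C beta0) * decay th rho x)); last by ring.
apply: ler_wpM2l; first by rewrite mulr_ge0 ?(ltW p0)// invr_ge0 exprn_ge0// ltW.
rewrite (le_trans h)// ler_wpM2r ?decay_ge0// (bigD1 beta)//= lerDl sumr_ge0//.
by move=> b _; have [] := hC b.
Qed.

(** Superadditivity of powers, needed for the inverse function: t^(1/2m) is subadditive. *)
Lemma exprD_ge (R : realType) (a b : R) k : 0 <= a -> 0 <= b -> (0 < k)%N ->
  a ^+ k + b ^+ k <= (a + b) ^+ k.
Proof.
move=> a0 b0; case: k => // k _; elim: k => [//|k IH].
rewrite [leRHS]exprS; apply: le_trans (ler_wpM2l (addr_ge0 a0 b0) IH).
rewrite mulrDr !mulrDl -!exprS.
by apply: lerD; rewrite ?lerDl ?lerDr mulr_ge0// exprn_ge0.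
Qed.

Theorem theorem4p1 (R : realType) (N m : nat) (theta : R)
    (hN : (1 <= N)%N) (hm : (2 <= m)%N) (htheta : 0 < theta < 2) :
  let K : 'rV[R]_N -> R -> R :=
    fun x t => frac_kernel theta x (t `^ (theta / (2 * m)%:R)) in
  [/\ forall (x : 'rV[R]_N) (t : R), 0 < t -> 0 < K x t,
      forall j : nat, exists d d' : R, [/\ 0 < d, 0 < d' &
        forall (x : 'rV[R]_N) (t : R) (alpha : {ffun 'I_N -> nat}),
          0 < t -> (\sum_(i < N) alpha i)%N = j ->
          `|mpartial alpha (fun y => poly_kernel m y t) x|
            <= d * t `^ (- (j%:R / (2 * m)%:R)) * K x t /\
          d * t `^ (- (j%:R / (2 * m)%:R)) * K x t
            <= d' * t `^ (- (N%:R / (2 * m)%:R) - j%:R / (2 * m)%:R)],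
      exists2 d : R, 0 < d &
        forall (t : R) (mu : {measure set 'rV[R]_N -> \bar R}),
          0 < t -> radon mu ->
          ('N[lebesgue_rV R N]_+oo[potential K t mu]
            <= (d * t `^ (- (N%:R / (2 * m)%:R)))%:E *
               ereal_sup [set mu (eball x (t `^ (2 * m)%:R^-1)) | x in setT])%E
    & exists2 d : R, 0 < d &
        forall (x : 'rV[R]_N) (t s : R), 0 < s -> s < t ->
          (\int[lebesgue_rV R N]_y (K (x - y) (t - s) * K y s)%:E
            <= (d * K x t)%:E)%E].
Proof.
move=> K; have th0 : 0 < theta by case/andP: htheta.
have th2 : theta <= 2 by case/andP: htheta => _ /ltW.
have m0 : (0 < m)%N by exact: leq_trans hm.
have M0 : (2 * m)%:R != 0 :> R by rewrite pnatr_eq0 muln_eq0/= -lt0n.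
(* The spatial scale of K at time t: the stable kernel is taken at time (rho t)^theta, so K is
   comparable to [decay theta (rho t)]. *)
pose rho (t : R) := t `^ (2 * m)%:R^-1.
have rho_gt0 t : 0 < t -> 0 < rho t by exact: powR_gt0.
have KE x t : K x t = frac_kernel theta x (rho t `^ theta).
  by rewrite /K /rho -powRrM mulrC.
have rhoX t : 0 < t -> rho t ^+ (2 * m) = t.
  by move=> t0; rewrite -powR_mulrn ?powR_ge0// -powRrM mulVf// powRr1// ltW.
have rhoN t k : 0 < t -> t `^ (- (k%:R / (2 * m)%:R)) = rho t ^- k.
  by move=> t0; rewrite -powR_invn ?powR_ge0// -powRrM mulrN mulrC.
have [c [C [c0 C0 mK hK]]] := frac_kernel_bounds hN htheta.
have K_ge x t : 0 < t -> c * decay theta (rho t) x <= K x t.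
  by move=> /rho_gt0 r0; have := hK _ x r0; rewrite -KE => /andP[].
have K_le x t : 0 < t -> K x t <= C * decay theta (rho t) x.
  by move=> /rho_gt0 r0; have := hK _ x r0; rewrite -KE => /andP[].
have K_gt0 x t : 0 < t -> 0 < K x t.
  move=> t0; apply: lt_le_trans (K_ge x t t0).
  by rewrite mulr_gt0// decay_gt0// rho_gt0.
have measurable_K t : 0 < t -> measurable_fun setT (K ^~ t).
  move=> t0; rewrite (_ : K ^~ t = fun x => frac_kernel theta x (rho t `^ theta)).
    by apply: mK; exact: rho_gt0.
  by apply/funext => x; exact: KE.
split=> //.
- move=> j; have [B B0 hB] := mpartial_poly_kernel_bound j hN m0 th2.
  (* B may vanish; the added 1 keeps the constant positive. *)
  have d0 : 0 < B / c + 1 by rewrite ltr_wpDl// divr_ge0// ltW.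
  exists (B / c + 1), ((B / c + 1) * C); split=> //; first exact: mulr_gt0.
  move=> x t alpha t0 aj; rewrite rhoN//.
  have r0 := rho_gt0 t t0; have rj : 0 < rho t ^- j by rewrite invr_gt0 exprn_gt0.
  split.
    have h := hB (rho t) x alpha r0 aj; rewrite rhoX// in h.
    apply: (le_trans h).
    rewrite mulrAC [leRHS]mulrAC ler_wpM2r ?(ltW rj)//.
    apply: (@le_trans _ _ (B / c * K x t)); last first.
      by rewrite ler_wpM2r ?lerDl// ltW// K_gt0.
    rewrite -mulrA ler_wpM2l// ler_pdivlMl// ?K_ge//.
  rewrite powRD; last by rewrite (gt_eqF t0) implybT.
  rewrite !rhoN// -!mulrA ler_wpM2l ?(ltW d0)//.
  rewrite mulrC [leRHS]mulrA ler_wpM2r ?(ltW rj)// (le_trans (K_le x t t0))//.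
  by rewrite ler_wpM2l ?(ltW C0)// decay_le_rhoN.
- have [B B0 hB] := decay_potential hN th0.
  exists (C * B) => [|t mu t0 rmu]; first exact: mulr_gt0.
  have r0 := rho_gt0 t t0.
  set S := ereal_sup _.
  have pot_ge0 x : (0 <= potential K t mu x)%E.
    by apply: integral_ge0 => y _; rewrite lee_fin ltW// K_gt0.
  have pot_le x : (potential K t mu x <= (C * B * t `^ (- (N%:R / (2 * m)%:R)))%:E * S)%E.
    rewrite rhoN// -mulrA EFinM -muleA.
    apply: le_trans (lee_wpmul2l _ (hB _ x mu r0 rmu)); last by rewrite lee_fin ltW.
    rewrite -ge0_integralZl//; last 3 first.
    + by apply/measurable_EFinP; exact: measurable_decay_sub.
    + by move=> y _; rewrite lee_fin decay_ge0.
    + by rewrite lee_fin ltW.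
    apply: ge0_le_integral => //.
    + by move=> y _; rewrite lee_fin ltW// K_gt0.
    + apply/measurable_EFinP.
      exact: (measurableT_comp (measurable_K t t0) (measurable_subr_rV x)).
    + apply: emeasurable_funM => //; apply/measurable_EFinP.
      exact: measurable_decay_sub.
    + by move=> y _; rewrite -EFinM lee_fin K_le.
  (* The norm at exponent +oo is defined by cases. Its default value 0 is below the bound because
     the potential at the origin is nonnegative; in the other case the pointwise bound holds
     everywhere. *)
  rewrite unlock /=; case: ifPn => _; last first.
    by rewrite (le_trans _ (pot_le 0)).
  apply/ess_supP; apply: aeW => x /=.
  by rewrite gee0_abs.
- have [D D0 hD] := decay_convolution hN htheta.
  exists (C ^+ 2 * D / c) => [|x t s s0 st].
    by rewrite divr_gt0// mulr_gt0// exprn_gt0.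
  have t0 : 0 < t by exact: lt_trans st.
  have ts0 : 0 < t - s by rewrite subr_gt0.
  have mD : measurable_fun setT (fun y : 'rV[R]_N =>
      decay theta (rho (t - s)) (x - y) * decay theta (rho s) y).
    apply: measurable_funM; first exact: measurable_decay_sub.
    exact: measurable_decay.
  apply: (@le_trans _ _ (\int[lebesgue_rV R N]_y ((C ^+ 2)%:E *
      (decay theta (rho (t - s)) (x - y) * decay theta (rho s) y)%:E))%E).
    apply: ge0_le_integral => //.
    + by move=> y _; rewrite lee_fin mulr_ge0// ltW// K_gt0.
    + apply/measurable_EFinP; apply: measurable_funM; last exact: measurable_K.
      exact: (measurableT_comp (measurable_K _ ts0) (measurable_subr_rV x)).
    + by apply: emeasurable_funM => //; apply/measurable_EFinP; exact: mD.
    + move=> y _; rewrite -EFinM lee_fin expr2 mulrACA.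
      by rewrite ler_pM ?K_le// ltW// K_gt0.
  rewrite ge0_integralZl//; last 3 first.
  + exact/measurable_EFinP.
  + by move=> y _; rewrite lee_fin mulr_ge0// decay_ge0.
  + by rewrite lee_fin sqr_ge0.
  have le_rho u : 0 < u -> u <= t -> 0 < rho u <= rho t.
    move=> u0 ut; rewrite rho_gt0//= ge0_ler_powR ?nnegrE ?invr_ge0 ?(ltW u0) ?(ltW t0)//.
  (* Subadditivity of the scale stands in for the semigroup identity; it is checked after raising to
     the power 2m. *)
  have rho_add : rho t <= rho (t - s) + rho s.
    have a0 := rho_gt0 _ ts0; have b0 := rho_gt0 _ s0.
    have k0 : (0 < 2 * m)%N by rewrite muln_gt0.
    have := exprD_ge (ltW a0) (ltW b0) k0; rewrite !rhoX// subrK => h.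
    rewrite -(ler_pXn2r k0) ?nnegrE ?addr_ge0 ?(ltW a0) ?(ltW b0) ?powR_ge0//.
    by rewrite rhoX.
  apply: (@le_trans _ _ ((C ^+ 2)%:E * (D * decay theta (rho t) x)%:E)%E).
    apply: lee_wpmul2l; first by rewrite lee_fin sqr_ge0.
    apply: hD => //; apply: le_rho => //; last exact: ltW.
    by rewrite gerBl ltW.
  rewrite -EFinM lee_fin.
  rewrite [leRHS](_ : _ = C ^+ 2 * (D * (c^-1 * K x t))); last by ring.
  rewrite ler_wpM2l ?sqr_ge0// ler_wpM2l ?(ltW D0)//.
  by rewrite ler_pdivlMl// K_ge.
Qed.
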